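(* Let $A$ be a Hopf algebra with bijective antipode, let $\Lambda^1$ be a right $A$-crossed module and let $\theta\in\Lambda^1$ be such that $\Delta_R\theta-\theta\otimes1\in\Lambda^1\square A$. Suppose that $$\Psi(\eta\otimes\theta)=\theta\otimes\eta,\qquad\{\Delta_R\theta-\theta\otimes1,\Delta_R\eta\}=0$$ for all $\eta\in\Lambda^1$. Then $\omega(a)=\theta\triangleleft a$ for all $a\in A^+$ and $\delta=[\theta,\ \}$ provide an inner strongly bicovariant differential exterior algebra $\Omega=A\#B_-(\Lambda^1)$.
   Context: We work over a field $k$ of characteristic not $2$. $A^+=\ker\epsilon$, $\pi(a)=a-\epsilon(a)1$. A right $A$-crossed module is a vector space $V$ with right action $\triangleleft$ and right coaction $\Delta_Rv=v_0\otimes v_1$ of $A$ such that $\Delta_R(v\triangleleft a)=v_0\triangleleft a_{(2)}\otimes(Sa_{(1)})v_1a_{(3)}$; these form a braided category with $\Psi(v\otimes w)=w_0\otimes v\triangleleft w_1$. $\Lambda^1\square A=\{\sum v_i\otimes w_i\in\Lambda^1\otimes A\mid\sum v_i\triangleleft a\otimes w_i=\sum v_i\otimes a\triangleright w_i\ \forall a\in A\}$, where $A$ acts on itself by the left adjoint action $a\triangleright w=a_{(1)}wSa_{(2)}$. $T_-V$ is the tensor algebra of $V$ with the braided-super Hopf algebra structure in which elements of $V$ are odd and $\underline\Delta v=v\otimes1+1\otimes v$. With $\Psi_i$ denoting $\Psi$ in tensor factors $i,i+1$, let $[n,\Psi]=\mathrm{id}+\Psi_1+\Psi_1\Psi_2+\cdots+\Psi_1\cdots\Psi_{n-1}$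 and $[n,\Psi]!=(\mathrm{id}\otimes[n-1,\Psi]!)[n,\Psi]$ on $V^{\otimes n}$. Then $B_-(V)=T_-V/\oplus_n\ker[n,-\Psi]!$, a graded braided-super Hopf algebra in the category of right $A$-crossed modules. The bracket $\{\ ,\ \}$ is the anticommutator in the tensor product algebra $B_-(\Lambda^1)\otimes A$ (more generally the analogous condition for $\eta$ of any degree uses the graded commutator), and $[\theta,\eta\}=\theta\eta-(-1)^{|\eta|}\eta\theta$. For a braided-super Hopf algebra $\Lambda$ in this category, $A\#\Lambda$ is the super-bosonisation: the super-Hopf algebra $A\otimes\Lambda$ with $(a\otimes\eta)(b\otimes\zeta)=ab_{(1)}\otimes(\eta\triangleleft b_{(2)})\zeta$ and $\Delta(a\otimes\eta)=a_{(1)}\otimes(\eta^1)_0\otimes a_{(2)}(\eta^1)_1\otimes\eta^2$, where $\underline\Delta\eta=\eta^1\otimes\eta^2$. The differential given by $(\omega,\delta)$ is $\mathrm{d}(a\otimes\eta)=a_{(1)}\otimes\omega(\pi(a_{(2)}))\eta+a\otimes\delta\eta$. A strongly bicovariant differential exterior algebra over $A$ is a graded super-Hopf algebra $\Omega=\oplus_{n\ge0}\Omega^n$ with $\Omega^0=A$ (parity given by the degree) with a degree $1$ map $\mathrm{d}$ with $\mathrm{d}^2=0$ that is a super-derivation and a super-coderivation, $\Delta\mathrm{d}=(\mathrm{d}\otimes\mathrm{id}+(-1)^{|\ |}\otimes\mathrm{d})\Delta$. It is inner (via $\theta\in\Omega^1$) if $\mathrm{d}=[\theta,\ \}$. *)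

(* Defs.v *)
From HB Require Import structures.
From mathcomp Require Import all_boot all_order all_algebra.
From mathcomp Require Import generic_quotient.
From mathcomp Require Import boolp classical_sets fsbigop.
Set Implicit Arguments.
Unset Strict Implicit.
Unset Printing Implicit Defensive.
Import GRing.Theory.
Local Open Scope quotient_scope.
Local Open Scope ring_scope.

(* [pres R] is the vector space with generators X and relations R, each
   relation being a formal linear combination (a list of pairs
   coefficient/generator) declared to be zero.  Two formal combinations are
   identified when every map X -> U that respects R gives them the same value;
   the universal property is [plift_gen] / [pres_ext] below. *)
Section Presentation.
Context {k : fieldType} {X : choiceType}.
Implicit Types (U : lmodType k) (R : seq (k * X) -> Prop).

Definition fsum U (f : X -> U) (s : seq (k * X)) : U :=
  \sum_(p <- s) p.1 *: f p.2.

Definition respects R U (f : X -> U) : Prop := forall r, R r -> fsum f r = 0.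

Definition pres_eqv R (s t : seq (k * X)) : bool :=
  `[< forall U (f : X -> U), respects R f -> fsum f s = fsum f t >].

Lemma pres_eqvP R : equiv_class_of (pres_eqv R).
Proof.
split=> [s|s t|t s u].
- exact/asboolP.
- by apply/asboolP/asboolP => h U f hf; rewrite h.
- by move=> /asboolP h1 /asboolP h2; apply/asboolP => U f hf; rewrite h1 ?h2.
Qed.
Canonical pres_equiv R := EquivRelPack (pres_eqvP R).

Definition pres R := {eq_quot pres_equiv R}.
HB.instance Definition _ R := Choice.on (pres R).
HB.instance Definition _ R := EqQuotient.on (pres R).

Definition pclass R (s : seq (k * X)) : pres R := \pi_({eq_quot pres_equiv R}) s.
Definition preprs R (x : pres R) : seq (k * X) := repr x.

Lemma pclassW R (Q : pres R -> Prop) : (forall s, Q (pclass R s)) -> forall x, Q x.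
Proof. by move=> h x; rewrite -[x]reprK; exact: h. Qed.

Lemma pclass_eqP R (s t : seq (k * X)) :
  (forall U (f : X -> U), respects R f -> fsum f s = fsum f t) <->
  pclass R s = pclass R t.
Proof. by split=> [h|/eqquotP/asboolP//]; apply/eqquotP/asboolP. Qed.

Lemma fsum_repr R U (f : X -> U) s :
  respects R f -> fsum f (preprs (pclass R s)) = fsum f s.
Proof.
by have /pclass_eqP h : pclass R (preprs (pclass R s)) = pclass R s
  := reprK _; exact: h.
Qed.

Lemma fsum_cat U (f : X -> U) s t : fsum f (s ++ t) = fsum f s + fsum f t.
Proof. by rewrite /fsum big_cat. Qed.

Definition fscale (c : k) (s : seq (k * X)) := [seq (c * p.1, p.2) | p <- s].

Lemma fsum_scale U (f : X -> U) c s : fsum f (fscale c s) = c *: fsum f s.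
Proof.
by rewrite /fsum big_map scaler_sumr; apply: eq_bigr => p _; rewrite scalerA.
Qed.

Section Module.
Variable R : seq (k * X) -> Prop.
Local Notation P := (pres R).

Definition pres_add (x y : P) : P := pclass R (preprs x ++ preprs y).
Definition pres_scale c (x : P) : P := pclass R (fscale c (preprs x)).
Definition pres_zero : P := pclass R [::].
Definition pres_opp := pres_scale (-1).

Lemma pres_addE s t : pres_add (pclass R s) (pclass R t) = pclass R (s ++ t).
Proof. by apply/pclass_eqP => U f hf; rewrite !fsum_cat !(fsum_repr _ hf). Qed.
Lemma pres_scaleE c s : pres_scale c (pclass R s) = pclass R (fscale c s).
Proof. by apply/pclass_eqP => U f hf; rewrite !fsum_scale (fsum_repr _ hf). Qed.

Local Ltac pres_tac := rewrite ?(pres_addE, pres_scaleE);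
  apply/pclass_eqP => U f hf; rewrite ?(fsum_cat, fsum_scale).

Lemma pres_addA : associative pres_add.
Proof. by elim/pclassW=> x; elim/pclassW=> y; elim/pclassW=> z; pres_tac; rewrite addrA. Qed.
Lemma pres_addC : commutative pres_add.
Proof. by elim/pclassW=> x; elim/pclassW=> y; pres_tac; rewrite addrC. Qed.
Lemma pres_add0 : left_id pres_zero pres_add.
Proof. by elim/pclassW=> x; pres_tac; rewrite /fsum big_nil add0r. Qed.
Lemma pres_addN : left_inverse pres_zero pres_opp pres_add.
Proof.
elim/pclassW=> x; rewrite /pres_opp; pres_tac.
by rewrite scaleN1r addNr /fsum big_nil.
Qed.
HB.instance Definition _ :=
  GRing.isZmodule.Build P pres_addA pres_addC pres_add0 pres_addN.

Lemma pres_scaleA a b (x : P) :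
  pres_scale a (pres_scale b x) = pres_scale (a * b) x.
Proof. by elim/pclassW: x => x; pres_tac; rewrite scalerA. Qed.
Lemma pres_scale1 : left_id 1 pres_scale.
Proof. by elim/pclassW=> x; pres_tac; rewrite scale1r. Qed.
Lemma pres_scaleDr : right_distributive pres_scale +%R.
Proof.
move=> c; elim/pclassW=> x; elim/pclassW=> y.
by rewrite /GRing.add /=; pres_tac; rewrite scalerDr.
Qed.
Lemma pres_scaleDl v : {morph pres_scale^~ v : a b / a + b}.
Proof.
move=> a b; elim/pclassW: v => x.
by rewrite [in RHS]/GRing.add /=; pres_tac; rewrite scalerDl.
Qed.
HB.instance Definition _ := GRing.Zmodule_isLmodule.Build k P
  pres_scaleA pres_scale1 pres_scaleDr pres_scaleDl.

Definition pgen (x : X) : P := pclass R [:: (1, x)].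

(* The linear map on [pres R] extending f; by convention it is zero when f does
   not respect the relations, so that it is always linear. *)
Definition plift U (f : X -> U) (x : P) : U :=
  if `[< respects R f >] then fsum f (preprs x) else 0.

Lemma plift_pi U (f : X -> U) s :
  respects R f -> plift f (pclass R s) = fsum f s.
Proof. by move=> hf; rewrite /plift (asboolT hf) fsum_repr. Qed.

Lemma plift_linear U (f : X -> U) : linear (plift f).
Proof.
move=> c; elim/pclassW=> x; elim/pclassW=> y.
have [hf|hf] := pselect (respects R f); last first.
  by rewrite /plift (asboolF hf) scaler0 addr0.
have -> : c *: pclass R x + pclass R y = pclass R (fscale c x ++ y).
  by rewrite -pres_addE -pres_scaleE.
by rewrite !plift_pi // fsum_cat fsum_scale.
Qed.
HB.instance Definition _ U (f : X -> U) :=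
  GRing.isLinear.Build k P U *:%R (plift f) (plift_linear f).

Lemma plift_gen U (f : X -> U) x : respects R f -> plift f (pgen x) = f x.
Proof. by move=> hf; rewrite plift_pi // /fsum big_seq1 scale1r. Qed.

Lemma pres_piE s : pclass R s = fsum pgen s.
Proof.
elim: s => [|[c x] s IH]; first by rewrite /fsum big_nil.
rewrite /fsum big_cons -/(fsum _ s) -IH /= [_ *: _]pres_scaleE.
by rewrite [_ + _]pres_addE /= mulr1.
Qed.

Lemma pgen_respects : respects R pgen.
Proof.
move=> r hr; rewrite -pres_piE; apply/pclass_eqP => U f hf.
by rewrite hf // /fsum big_nil.
Qed.

Lemma pres_ext U (f g : {linear P -> U}) :
  (forall x, f (pgen x) = g (pgen x)) -> f =1 g.
Proof.
move=> h; elim/pclassW=> s; rewrite pres_piE /fsum !linear_sum.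
by apply: eq_bigr => p _; rewrite !linearZ /= h.
Qed.

End Module.
End Presentation.

Section Tensor.
Context {k : fieldType}.
Implicit Types V W U : lmodType k.

Inductive tens_rel {V W} : seq (k * (V * W)) -> Prop :=
| TensL c u v w :
    tens_rel [:: (1, (c *: u + v, w)); (- c, (u, w)); (- 1, (v, w))]
| TensR c u v w :
    tens_rel [:: (1, (w, c *: u + v)); (- c, (w, u)); (- 1, (w, v))].

Definition tens V W := pres (@tens_rel V W).
HB.instance Definition _ V W := GRing.Lmodule.on (tens V W).

Definition tpure V W (v : V) (w : W) : tens V W := pgen tens_rel (v, w).

Definition tlift V W U (f : V -> W -> U) : tens V W -> U :=
  plift (R := @tens_rel V W) (fun p => f p.1 p.2).
HB.instance Definition _ V W U (f : V -> W -> U) :=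
  GRing.Linear.on (tlift f).

Lemma tlift_respects V W U (f : V -> W -> U) :
  (forall w, linear (f^~ w)) -> (forall v, linear (f v)) ->
  respects (@tens_rel V W) (fun p => f p.1 p.2).
Proof.
move=> hl hr _ [c u v w|c u v w]; rewrite /fsum !big_cons big_nil /=.
  by rewrite hl scale1r scaleNr scaleN1r addr0 addrACA !subrr addr0.
by rewrite hr scale1r scaleNr scaleN1r addr0 addrACA !subrr addr0.
Qed.

Lemma tlift_pure V W U (f : V -> W -> U) v w :
  (forall w, linear (f^~ w)) -> (forall v, linear (f v)) ->
  tlift f (tpure v w) = f v w.
Proof. by move=> hl hr; rewrite /tlift plift_gen //; exact: tlift_respects. Qed.

Lemma tpure_linear_l V W (w : W) : linear (fun v : V => tpure v w).
Proof.
move=> c u v; have := pgen_respects (TensL c u v w).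
rewrite /fsum !big_cons big_nil /= scale1r scaleNr scaleN1r addr0.
by rewrite -opprD => /eqP; rewrite subr_eq0 => /eqP.
Qed.

Lemma tpure_linear_r V W (v : V) : linear (tpure v : W -> tens V W).
Proof.
move=> c u w; have := pgen_respects (TensR c u w v).
rewrite /fsum !big_cons big_nil /= scale1r scaleNr scaleN1r addr0.
by rewrite -opprD => /eqP; rewrite subr_eq0 => /eqP.
Qed.

Lemma tens_ext V W U (f g : {linear tens V W -> U}) :
  (forall v w, f (tpure v w) = g (tpure v w)) -> f =1 g.
Proof. by move=> h; apply: pres_ext => -[v w]; exact: h. Qed.

End Tensor.

Arguments tens {k} (V W)%_type_scope.
Notation "V ⊗ W" := (tens V W) (at level 40, left associativity) : type_scope.
Notation "v ⊗ w" := (tpure v w) (at level 40, left associativity) : ring_scope.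

(* Sweedler notation: if x = sum_i a_i ⊗ b_i then this is sum_i E(a_i, b_i),
   for E bilinear in (a, b). *)
Notation "\sw_ ( a , b <- x ) E" := (tlift (fun a b => E) x)
  (at level 41, E at level 41, a name, b name, x at level 50,
   format "'[' \sw_ ( a ,  b  <-  x ) '/  '  E ']'") : ring_scope.

Section Quotient.
Context {k : fieldType}.
Implicit Types M U : lmodType k.

Inductive quo_rel M (N : M -> Prop) : seq (k * M) -> Prop :=
| QuoLin c u v : quo_rel N [:: (1, c *: u + v); (- c, u); (- 1, v)]
| QuoSub u : N u -> quo_rel N [:: (1, u)].

(* M / span N *)
Definition quo M (N : M -> Prop) := pres (quo_rel N).
HB.instance Definition _ M (N : M -> Prop) := GRing.Lmodule.on (quo N).

Definition quo_proj M (N : M -> Prop) (u : M) : quo N := pgen (quo_rel N) u.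
Definition quo_lift M (N : M -> Prop) U (f : M -> U) : quo N -> U :=
  plift (R := quo_rel N) f.
HB.instance Definition _ M (N : M -> Prop) U (f : M -> U) :=
  GRing.Linear.on (quo_lift (N := N) f).

Lemma quo_liftE M (N : M -> Prop) U (f : {linear M -> U}) u :
  (forall v, N v -> f v = 0) -> quo_lift (N := N) f (quo_proj N u) = f u.
Proof.
move=> h; rewrite /quo_lift plift_gen // => _ [c x y|x hx].
  rewrite /fsum !big_cons big_nil /= linearP.
  by rewrite scale1r scaleNr scaleN1r addr0 addrACA !subrr addr0.
by rewrite /fsum big_seq1 scale1r h.
Qed.

End Quotient.

HB.mixin Record isHopfAlgebra (k : fieldType) A of GRing.Algebra k A := {
  hcop : A -> A ⊗ A;
  heps : A -> k;
  hS : A -> A;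
  hcop_linear : linear hcop;
  heps_linear : linear (heps : A -> k^o);
  hS_linear : linear hS;
  hcopA : forall a : A,
    \sw_(b, c <- hcop a) (\sw_(b1, b2 <- hcop b) b1 ⊗ (b2 ⊗ c)) =
    \sw_(b, c <- hcop a) b ⊗ hcop c;
  hepsl : forall a : A, \sw_(b, c <- hcop a) heps b *: c = a;
  hepsr : forall a : A, \sw_(b, c <- hcop a) heps c *: b = a;
  hcop1 : hcop 1 = 1 ⊗ 1;
  hcopM : forall a b : A, hcop (a * b) =
    \sw_(a1, a2 <- hcop a) (\sw_(b1, b2 <- hcop b) (a1 * b1) ⊗ (a2 * b2));
  heps1 : heps 1 = 1;
  hepsM : forall a b : A, heps (a * b) = heps a * heps b;
  hSl : forall a : A, \sw_(b, c <- hcop a) hS b * c = (heps a)%:A;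
  hSr : forall a : A, \sw_(b, c <- hcop a) b * hS c = (heps a)%:A
}.

#[short(type="hopfAlgType")]
HB.structure Definition HopfAlgebra (k : fieldType) :=
  {A of GRing.Algebra k A & isHopfAlgebra k A}.

(* [hpi] is the projection A -> A^+ = ker epsilon *)
Definition hpi (k : fieldType) (A : hopfAlgType k) (a : A) : A :=
  a - (heps a)%:A.

Definition left_ad (k : fieldType) (A : hopfAlgType k) (a w : A) : A :=
  \sw_(a1, a2 <- hcop a) a1 * w * hS a2.

HB.mixin Record isCrossedModule (k : fieldType) (A : hopfAlgType k) V
    of GRing.Lmodule k V := {
  cact : V -> A -> V;
  ccoact : V -> V ⊗ A;
  cact_linear_l : forall a, linear (cact^~ a);
  cact_linear_r : forall v, linear (cact v);
  cact1 : forall v, cact v 1 = v;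
  cactM : forall v a b, cact v (a * b) = cact (cact v a) b;
  ccoact_linear : linear ccoact;
  ccoactA : forall v : V,
    \sw_(v', a <- ccoact v) (\sw_(v0, v1 <- ccoact v') v0 ⊗ (v1 ⊗ a)) =
    \sw_(v', a <- ccoact v) v' ⊗ hcop a;
  ccoact_eps : forall v : V, \sw_(v0, v1 <- ccoact v) heps v1 *: v0 = v;
  ccoact_act : forall (v : V) (a : A), ccoact (cact v a) =
    \sw_(v0, v1 <- ccoact v) (\sw_(a1, a' <- hcop a) (\sw_(a2, a3 <- hcop a')
      cact v0 a2 ⊗ (hS a1 * v1 * a3)))
}.

#[short(type="crossedModType")]
HB.structure Definition CrossedModule (k : fieldType) (A : hopfAlgType k) :=
  {V of GRing.Lmodule k V & isCrossedModule k A V}.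

Section Parity.
Context {k : fieldType} {H : lmodType k}.
Variable deg : nat -> H -> H. (* projections onto the homogeneous components *)

Definition is_grading : Prop := [/\ forall n, linear (deg n),
  forall m n x, deg m (deg n x) = if m == n then deg n x else 0 &
  forall x, exists N, x = \sum_(n < N) deg n x].

Definition parity_part (b : bool) (x : H) : H :=
  \sum_(n \in [set n : nat | odd n = b]%classic) deg n x.

(* x |-> (-1)^|x| x *)
Definition parity_inv (x : H) : H := parity_part false x - parity_part true x.

End Parity.

Section CrossedModules.
Context {k : fieldType} {A : hopfAlgType k} {V : crossedModType A}.

Definition Psi : V ⊗ V -> V ⊗ V :=
  tlift (fun v w => \sw_(w0, w1 <- ccoact w) w0 ⊗ cact v w1).
HB.instance Definition _ := GRing.Linear.on Psi.

Definition cotensor (x : V ⊗ A) : Prop := forall a : A,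
  \sw_(v, w <- x) cact v a ⊗ w = \sw_(v, w <- x) v ⊗ left_ad a w.

End CrossedModules.

(* The tensor algebra of V: its degree n component is spanned by the words of
   length n, which are multilinear in their letters. *)
Section TensorAlgebra.
Context {k : fieldType} {V : lmodType k}.

Inductive word_rel : seq (k * seq V) -> Prop :=
| WordLin c (s t : seq V) u v : word_rel
    [:: (1, s ++ (c *: u + v) :: t); (- c, s ++ u :: t); (- 1, s ++ v :: t)].

Definition talg := pres word_rel.
HB.instance Definition _ := GRing.Lmodule.on talg.

Definition tword (s : seq V) : talg := pgen word_rel s.
Definition wlift (U : lmodType k) (f : seq V -> U) : talg -> U :=
  plift (R := word_rel) f.
HB.instance Definition _ (U : lmodType k) (f : seq V -> U) :=
  GRing.Linear.on (wlift f).

Definition talg_mul (x y : talg) : talg :=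
  wlift (fun s => wlift (fun t => tword (s ++ t)) y) x.

Definition talg_deg (n : nat) : talg -> talg :=
  wlift (fun s => if size s == n then tword s else 0).
HB.instance Definition _ n := GRing.Linear.on (talg_deg n).

(* [braid_at psi i] is psi in tensor factors i, i+1, the factors being numbered
   from 1 *)
Definition braid_at (psi : V ⊗ V -> V ⊗ V) (i : nat) : talg -> talg :=
  wlift (fun s => if drop i.-1 s is v :: w :: t then
    \sw_(x, y <- psi (v ⊗ w)) tword (take i.-1 s ++ [:: x, y & t]) else 0).
HB.instance Definition _ psi i := GRing.Linear.on (braid_at psi i).

(* id ⊗ f, where id is the identity of the first factor V *)
Definition id_tens (f : talg -> talg) : talg -> talg :=
  wlift (fun s => if s is v :: t then talg_mul (tword [:: v]) (f (tword t))
                  else 0).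
HB.instance Definition _ f := GRing.Linear.on (id_tens f).

Definition braided_int (psi : V ⊗ V -> V ⊗ V) (n : nat) (x : talg) : talg :=
  \sum_(j < n) foldr (braid_at psi) x (iota 1 j).

Fixpoint braided_fact (psi : V ⊗ V -> V ⊗ V) (n : nat) : talg -> talg :=
  if n is m.+1 then id_tens (braided_fact psi m) \o braided_int psi n else id.

End TensorAlgebra.
Arguments talg {k} V.

(* Operations of a braided-super Hopf algebra in the category of right
   A-crossed modules *)
Record bsHopfData (k : fieldType) (A : hopfAlgType k) := BsHopfData {
  bs_sort :> lmodType k;
  bs_deg : nat -> bs_sort -> bs_sort;
  bs_act : bs_sort -> A -> bs_sort;
  bs_coact : bs_sort -> bs_sort ⊗ A;
  bs_one : bs_sort;
  bs_mul : bs_sort -> bs_sort -> bs_sort;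
  bs_cop : bs_sort -> bs_sort ⊗ bs_sort;
  bs_eps : bs_sort -> k^o
}.

Section TensorHopf.
Context {k : fieldType} {A : hopfAlgType k}.
Variable V : crossedModType A.
Local Notation T := (talg V).

Fixpoint word_act (s : seq V) (a : A) : T :=
  if s is v :: t then
    \sw_(a1, a2 <- hcop a) talg_mul (tword [:: cact v a1]) (word_act t a2)
  else heps a *: tword [::].

Fixpoint word_coact (s : seq V) : T ⊗ A :=
  if s is v :: t then
    \sw_(v0, v1 <- ccoact v) (\sw_(t0, t1 <- word_coact t)
      talg_mul (tword [:: v0]) t0 ⊗ (v1 * t1))
  else tword [::] ⊗ 1.

Definition talg_act (x : T) (a : A) : T := wlift (word_act^~ a) x.
Definition talg_coact : T -> T ⊗ A := wlift word_coact.
HB.instance Definition _ := GRing.Linear.on talg_coact.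

(* The braided-super tensor product algebra:
   (x ⊗ y)(z ⊗ w) = (-1)^(|y||z|) x Psi(y ⊗ z) w *)
Definition talg_tmul (p q : T ⊗ T) : T ⊗ T :=
  \sw_(x, y <- p) (\sw_(z, w <- q) \sum_(b : bool) \sum_(c : bool)
    (-1) ^+ (b && c) *:
      (\sw_(z0, z1 <- talg_coact (parity_part talg_deg c z))
        talg_mul x z0 ⊗ talg_mul (talg_act (parity_part talg_deg b y) z1) w)).

Definition word_cop (s : seq V) : T ⊗ T :=
  foldr (fun v => talg_tmul (tword [:: v] ⊗ tword [::] +
                             tword [::] ⊗ tword [:: v]))
        (tword [::] ⊗ tword [::]) s.
Definition talg_cop : T -> T ⊗ T := wlift word_cop.
HB.instance Definition _ := GRing.Linear.on talg_cop.

Definition talg_eps : T -> k^o := wlift (fun s => (size s == 0%N)%:R : k^o).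

Definition Tminus : bsHopfData A :=
  BsHopfData talg_deg talg_act talg_coact (tword [::]) talg_mul talg_cop
    talg_eps.

End TensorHopf.

(* The operations induced on the quotient of L by the subspace N.  They are
   lifted with [quo_lift], hence meaningful when the operations of L descend to
   L / N; this is so for N = [bminus_ker] below, whose quotient is the graded
   braided-super Hopf algebra B_-(V). *)
Section BsQuotient.
Context {k : fieldType} {A : hopfAlgType k}.
Variables (L : bsHopfData A) (N : L -> Prop).
Local Notation Q := (quo N).
Local Notation q := (quo_proj N).

Definition bs_quo : bsHopfData A := @BsHopfData k A Q
  (fun n => quo_lift (fun x => q (bs_deg n x)))
  (fun x a => quo_lift (fun x => q (bs_act x a)) x)
  (quo_lift (fun x => \sw_(x0, x1 <- bs_coact x) q x0 ⊗ x1))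
  (q (bs_one L))
  (fun x y => quo_lift (fun x => quo_lift (fun y => q (bs_mul x y)) y) x)
  (quo_lift (fun x => \sw_(x1, x2 <- bs_cop x) q x1 ⊗ q x2))
  (quo_lift (fun x => bs_eps x)).

End BsQuotient.

Section Bminus.
Context {k : fieldType} {A : hopfAlgType k}.
Variable V : crossedModType A.

(* the subspace \oplus_n ker [n, -Psi]! of the tensor algebra *)
Definition bminus_ker (x : Tminus V) : Prop := forall n,
  braided_fact (fun z : V ⊗ V => - Psi z) n (talg_deg n x) = 0.

Definition Bminus : bsHopfData A := bs_quo bminus_ker.

Definition bminus_in (v : V) : Bminus := quo_proj bminus_ker (tword [:: v]).

Definition bminus_inA (x : V ⊗ A) : Bminus ⊗ A :=
  \sw_(v, a <- x) bminus_in v ⊗ a.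

End Bminus.

Definition tens_alg_mul (k : fieldType) (A : hopfAlgType k) (L : bsHopfData A)
    (x y : L ⊗ A) : L ⊗ A :=
  \sw_(l, a <- x) (\sw_(m, b <- y) bs_mul l m ⊗ (a * b)).

Definition anticommutator (k : fieldType) (A : hopfAlgType k)
    (L : bsHopfData A) (x y : L ⊗ A) : L ⊗ A :=
  tens_alg_mul x y + tens_alg_mul y x.

(* [theta, eta} = theta eta - (-1)^|eta| eta theta *)
Definition scomm (k : fieldType) (H : lmodType k) (deg : nat -> H -> H)
    (mul : H -> H -> H) (theta eta : H) : H :=
  mul theta eta - mul (parity_inv deg eta) theta.

Record superHopfData (k : fieldType) := SuperHopfData {
  sh_sort :> lmodType k;
  sh_deg : nat -> sh_sort -> sh_sort;
  sh_one : sh_sort;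
  sh_mul : sh_sort -> sh_sort -> sh_sort;
  sh_cop : sh_sort -> sh_sort ⊗ sh_sort;
  sh_eps : sh_sort -> k^o
}.

Section SuperHopf.
Context {k : fieldType}.
Variable H : superHopfData k.
Local Notation deg := (@sh_deg k H).
Local Notation one := (sh_one H).
Local Notation mul := (@sh_mul k H).
Local Notation cop := (@sh_cop k H).
Local Notation eps := (@sh_eps k H).

Definition is_graded_algebra : Prop :=
  is_grading deg /\
  [/\ forall x, linear (mul x), forall y, linear (mul^~ y),
      associative mul, left_id one mul & right_id one mul] /\
  deg 0%N one = one /\
  (forall m n x y, deg (m + n)%N (mul (deg m x) (deg n y)) =
                   mul (deg m x) (deg n y)).

Definition is_graded_coalgebra : Prop :=
  [/\ linear cop, linear eps,
      forall x, \sw_(y, z <- cop x) (\sw_(y1, y2 <- cop y) y1 ⊗ (y2 ⊗ z)) =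
                \sw_(y, z <- cop x) y ⊗ cop z,
      forall x, \sw_(y, z <- cop x) eps y *: z = x &
      forall x, \sw_(y, z <- cop x) eps z *: y = x] /\
  (forall n x, cop (deg n x) = \sum_(i < n.+1)
     \sw_(y, z <- cop (deg n x)) deg i y ⊗ deg (n - i)%N z) /\
  (forall n x, (0 < n)%N -> eps (deg n x) = 0).

(* the super tensor product algebra:
   (x ⊗ y)(z ⊗ w) = (-1)^(|y||z|) x z ⊗ y w *)
Definition super_tmul (p q : H ⊗ H) : H ⊗ H :=
  \sw_(x, y <- p) (\sw_(z, w <- q) \sum_(b : bool) \sum_(c : bool)
    (-1) ^+ (b && c) *:
      (mul x (parity_part deg c z) ⊗ mul (parity_part deg b y) w)).

Definition is_super_antipode (S : H -> H) : Prop :=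
  [/\ linear S, forall n x, deg n (S (deg n x)) = S (deg n x),
      forall x, \sw_(y, z <- cop x) mul (S y) z = eps x *: one &
      forall x, \sw_(y, z <- cop x) mul y (S z) = eps x *: one].

Definition is_graded_super_hopf : Prop :=
  [/\ is_graded_algebra, is_graded_coalgebra,
      [/\ cop one = one ⊗ one,
          forall x y, cop (mul x y) = super_tmul (cop x) (cop y),
          eps one = 1 &
          forall x y, eps (mul x y) = eps x * eps y] &
      exists S, is_super_antipode S].

Definition is_super_derivation (d : H -> H) : Prop :=
  forall x y, d (mul x y) = mul (d x) y + mul (parity_inv deg x) (d y).

Definition is_super_coderivation (d : H -> H) : Prop := forall x,
  cop (d x) = \sw_(y, z <- cop x) (d y ⊗ z + parity_inv deg y ⊗ d z).

(* [i] identifies the Hopf algebra A with the degree 0 part of H *)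
Definition is_degree0_embedding (A : hopfAlgType k) (i : A -> H) : Prop :=
  [/\ linear i, injective i,
      forall x, deg 0%N x = x <-> exists a, x = i a,
      i 1 = one /\ (forall a b, i (a * b) = mul (i a) (i b)) &
      (forall a, cop (i a) = \sw_(a1, a2 <- hcop a) i a1 ⊗ i a2) /\
      (forall a, eps (i a) = heps a)].

Definition strongly_bicovariant_exterior_algebra
    (A : hopfAlgType k) (i : A -> H) (d : H -> H) : Prop :=
  [/\ is_graded_super_hopf, is_degree0_embedding i,
      [/\ linear d, forall n x, deg n.+1 (d (deg n x)) = d (deg n x) &
          forall x, d (d x) = 0],
      is_super_derivation d & is_super_coderivation d].

Definition inner_via (d : H -> H) (theta : H) : Prop :=
  deg 1%N theta = theta /\ (forall x, d x = scomm deg mul theta x).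

End SuperHopf.

(* The super-bosonisation A # L, on the vector space A ⊗ L *)
Section Bosonisation.
Context {k : fieldType} {A : hopfAlgType k}.
Variable L : bsHopfData A.

Definition boson_mul (x y : A ⊗ L) : A ⊗ L :=
  \sw_(a, l <- x) (\sw_(b, m <- y) (\sw_(b1, b2 <- hcop b)
    (a * b1) ⊗ bs_mul (bs_act l b2) m)).

Definition boson_cop (x : A ⊗ L) : (A ⊗ L) ⊗ (A ⊗ L) :=
  \sw_(a, l <- x) (\sw_(a1, a2 <- hcop a) (\sw_(l1, l2 <- bs_cop l)
    (\sw_(l10, l11 <- bs_coact l1) (a1 ⊗ l10) ⊗ ((a2 * l11) ⊗ l2)))).

Definition boson_deg (n : nat) (x : A ⊗ L) : A ⊗ L :=
  \sw_(a, l <- x) a ⊗ bs_deg n l.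

Definition boson_eps (x : A ⊗ L) : k^o :=
  \sw_(a, l <- x) heps a *: bs_eps l.

Definition bosonisation : superHopfData k := @SuperHopfData k (tens A L)
  boson_deg (1 ⊗ bs_one L) boson_mul boson_cop boson_eps.

Definition boson_base (a : A) : bosonisation := a ⊗ bs_one L.

(* the differential given by (omega, delta); omega is only evaluated on A^+ *)
Definition boson_diff (omega : A -> L) (delta : L -> L) (x : A ⊗ L) : A ⊗ L :=
  \sw_(a, l <- x) ((\sw_(a1, a2 <- hcop a) a1 ⊗ bs_mul (omega (hpi a2)) l)
                   + a ⊗ delta l).

End Bosonisation.

(* The operations of T_-V evaluate on words as their definitions say: each of
   the lifts defining them is applied to a multilinear map. *)
Section WellDefined.
Context {k : fieldType}.
Implicit Types V W U : lmodType k.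
Definition bilin V W U (f : V -> W -> U) :=
  (forall w, linear (f^~ w)) /\ (forall v, linear (f v)).

Lemma tlift_lin V W U c (f g h : V -> W -> U) x : bilin f -> bilin g ->
  (forall v w, h v w = c *: f v w + g v w) ->
  tlift h x = c *: tlift f x + tlift g x.
Proof.
move=> [f1 f2] [g1 g2] e.
have hb : bilin h.
  split=> [w|v] a u u' /=; rewrite !e ?f1 ?f2 ?g1 ?g2 !scalerDr !scalerA;
  rewrite (mulrC c) -!addrA; congr +%R; rewrite addrCA; congr +%R; done.
have : tlift h =1 (c \*: tlift f \+ tlift g).
  case: hb => h1 h2.
  by apply: tens_ext => v w /=; rewrite !tlift_pure.
exact.
Qed.

Lemma bilin_tpure V W : bilin (@tpure k V W).
Proof. split; [exact: tpure_linear_l|exact: tpure_linear_r]. Qed.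

Section Words.
Variable V : lmodType k.
Definition multilin U (f : seq V -> U) := forall c s t u v,
  f (s ++ (c *: u + v) :: t) = c *: f (s ++ u :: t) + f (s ++ v :: t).

Lemma wlift_word U (f : seq V -> U) s : multilin f -> wlift f (tword s) = f s.
Proof.
move=> h; rewrite /wlift plift_gen // => _ [c s' t u v].
rewrite /fsum !big_cons big_nil /= h.
by rewrite scale1r scaleNr scaleN1r addr0 addrACA !subrr addr0.
Qed.

Lemma tword_multilin : multilin (@tword k V).
Proof.
move=> c s t u v; have := pgen_respects (WordLin c s t u v).
rewrite /fsum !big_cons big_nil /= scale1r scaleNr scaleN1r addr0.
by rewrite -opprD => /eqP; rewrite subr_eq0 => /eqP.
Qed.

Lemma talg_ext U (f g : {linear talg V -> U}) :
  (forall s, f (tword s) = g (tword s)) -> f =1 g.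
Proof. by move=> h; apply: pres_ext. Qed.

Lemma wlift_lin U c (f g h : seq V -> U) x : multilin f -> multilin g ->
  (forall s, h s = c *: f s + g s) -> wlift h x = c *: wlift f x + wlift g x.
Proof.
move=> hf hg e.
have hh : multilin h.
  move=> a s t u v; rewrite !e hf hg !scalerDr !scalerA (mulrC c) -!addrA.
  by congr +%R; rewrite addrCA; congr +%R.
have : wlift h =1 (c \*: wlift f \+ wlift g).
  by apply: talg_ext => s /=; rewrite !wlift_word.
exact.
Qed.

Lemma cat_multilin s : multilin (fun t => tword (s ++ t) : talg V).
Proof. by move=> c s' t u v; rewrite !catA tword_multilin. Qed.

Lemma mul_multilin y : multilin (fun s => wlift (fun t => tword (s ++ t) : talg V) y).
Proof.
move=> c s t u v; apply: wlift_lin => [||w]; [exact: cat_multilin..|].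
by rewrite -!catA /= tword_multilin.
Qed.

Lemma talg_mul_word s t : talg_mul (tword s) (tword t) = tword (s ++ t) :> talg V.
Proof. by rewrite /talg_mul wlift_word ?wlift_word //; [exact: cat_multilin|exact: mul_multilin]. Qed.

Lemma talg_mul_bilin : bilin (@talg_mul k V).
Proof.
split=> [y|x] a u v; first by rewrite /talg_mul linearP.
rewrite /talg_mul.
apply: wlift_lin => [||s]; [exact: mul_multilin..|].
by rewrite linearP.
Qed.

Lemma talg_deg_word n s : talg_deg n (tword s) = (if size s == n then tword s else 0 : talg V).
Proof.
apply: wlift_word => c {}s t u v; rewrite !size_cat /=.
by case: eqP => _; [exact: tword_multilin|rewrite scaler0 addr0].
Qed.

Lemma parity_bound N b (z : talg V) : (forall n, (N <= n)%N -> talg_deg n z = 0) ->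
  parity_part (@talg_deg k V) b z = \sum_(n < N | odd n == b) talg_deg n z.
Proof.
move=> hz; rewrite /parity_part -(big_mkord (fun n => odd n == b) (fun n => talg_deg n z)) -big_filter.
rewrite [RHS]fsbig_seq; last exact/filter_uniq/iota_uniq.
apply/esym/fsbig_widen.
- by move=> n /=; rewrite mem_filter => /andP[/eqP].
move=> n [/= h1 h2]; apply: hz; rewrite leqNgt; apply/negP => h.
by apply: h2; rewrite /= mem_filter mem_index_iota h1 eqxx.
Qed.

Lemma parity_word s (b : bool) : parity_part talg_deg b (tword s) = (if odd (size s) == b then tword s else 0 : talg V).
Proof.
rewrite (@parity_bound (size s).+1); last first.
  by move=> n hn; rewrite talg_deg_word; case: eqP => // h; rewrite h ltnn in hn.
rewrite big_mkcond big_ord_recr /= big1 ?add0r ?talg_deg_word ?eqxx // => i _.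
by rewrite talg_deg_word gtn_eqF // if_same.
Qed.

Lemma talg_sum (x : talg V) :
  exists s : seq (k * seq V), x = \sum_(p <- s) p.1 *: tword p.2.
Proof.
apply: (@pclassW _ _ word_rel (fun x => exists s, x = _)) => s; exists s.
exact: pres_piE.
Qed.

Lemma talg_fin (x : talg V) : exists N, forall n, (N <= n)%N -> talg_deg n x = 0.
Proof.
have [s ->] := talg_sum x.
exists (\max_(p <- s) (size p.2).+1) => n hn.
rewrite linear_sum big_seq big1 // => p ps.
rewrite linearZ /= talg_deg_word.
have : (size p.2 < n)%N.
  apply: leq_trans hn; rewrite (big_rem p) //=; exact: leq_maxl.
by case: eqP => [->|]; rewrite ?ltnn ?scaler0.
Qed.

Lemma parity_linear b : linear (parity_part (@talg_deg k V) b).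
Proof.
move=> c x y.
have [N hx] := talg_fin x. have [M hy] := talg_fin y.
have hx' n : (maxn N M <= n)%N -> talg_deg n x = 0.
  by rewrite geq_max => /andP[/hx].
have hy' n : (maxn N M <= n)%N -> talg_deg n y = 0.
  by rewrite geq_max => /andP[_ /hy].
rewrite (parity_bound _ hx') (parity_bound _ hy') (@parity_bound (maxn N M)).
  by rewrite scaler_sumr -big_split; apply: eq_bigr => n _; rewrite linearP.
by move=> n hn; rewrite linearP /= hx' ?hy' // scaler0 addr0.
Qed.

Lemma bilin_comp (V1 V2 W1 W2 U : lmodType k) (f : V1 -> W1 -> U) (g : V2 -> V1) (h : W2 -> W1) :
  bilin f -> linear g -> linear h -> bilin (fun v w => f (g v) (h w)).
Proof. by move=> [f1 f2] hg hh; split=> [w|v] a u u'; rewrite ?hg ?hh ?f1 ?f2. Qed.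

Lemma word_at_bilin s t : bilin (fun x y => tword (s ++ [:: x, y & t]) : talg V).
Proof.
split=> [w|v] a x y; first by rewrite tword_multilin.
by have := tword_multilin a (s ++ [:: v]) t x y; rewrite -!catA.
Qed.

Lemma braid_at_word psi i (s : seq V) : linear psi -> 
  braid_at psi i (tword s) = if drop i.-1 s is v :: w :: t then
    \sw_(x, y <- psi (v ⊗ w)) tword (take i.-1 s ++ [:: x, y & t]) else 0.
Proof.
move=> hp.
apply: wlift_word; move: i.-1 => {}i c {}s t u v.
have WB x r : bilin (fun y z => tword (take i (s ++ x :: t) ++ [:: y, z & r]) : talg V).
  exact: word_at_bilin.
move: (WB (c *: u + v)) (WB u) (WB v) => {WB}.
rewrite !drop_cat !take_cat; case: ltnP => hi.
  have -> : drop i s = nth u s i :: drop i.+1 s by rewrite (drop_nth u).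
  case: (drop i.+1 s) => [|w r] /= _ W1 W2.
    by rewrite tpure_linear_r hp linearP.
  apply: tlift_lin => [||x y]; [exact: W1|exact: W1|].
  have := tword_multilin c (take i s ++ [:: x, y & r]) t u v.
  by rewrite -!catA.
case: (i - size s)%N => [|j] /= _ W1 W2.
  case: t W1 W2 => [|w t] _ _; first by rewrite scaler0 addr0.
  by rewrite tpure_linear_l hp linearP.
case: (ltnP j (size t)) => hj; last first.
  by rewrite drop_oversize // scaler0 addr0.
rewrite (drop_nth u) //; case: (drop j.+1 t) => [|w r] /=.
  by rewrite scaler0 addr0.
apply: tlift_lin => [||x y]; [exact: W1|exact: W2|].
by rewrite -!catA /= tword_multilin.
Qed.

Lemma id_tens_word f (v : V) t : linear f ->
  id_tens f (tword (v :: t)) = talg_mul (tword [:: v]) (f (tword t)).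
Proof.
move=> hf; rewrite /id_tens wlift_word // => c [|w s] r u x /=.
  rewrite -talg_mul_bilin.1; congr talg_mul.
  by have := tword_multilin c [::] [::] u x.
by rewrite tword_multilin hf talg_mul_bilin.2.
Qed.
End Words.

Section CrossedWords.
Variables (A : hopfAlgType k) (V : crossedModType A).

Lemma lin_tw : linear (fun v : V => tword [:: v]).
Proof. by move=> c u v; exact: (tword_multilin c [::] [::]). Qed.

Lemma word_act_linear (s : seq V) : linear (word_act s).
Proof.
case: s => [|v s] c a b /=; first by rewrite heps_linear scalerDl scalerA.
by rewrite hcop_linear linearP.
Qed.

Lemma wact_bilin v (s : seq V) :
  bilin (fun a1 a2 : A => talg_mul (tword [:: cact v a1]) (word_act s a2)).
Proof.
apply: (bilin_comp (f := @talg_mul k V) (g := fun a => tword [:: cact v a])).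
- exact: talg_mul_bilin.
- by move=> c a b; rewrite cact_linear_r lin_tw.
- exact: word_act_linear.
Qed.

Lemma talg_act_word (s : seq V) a : talg_act (tword s) a = word_act s a.
Proof.
apply: wlift_word => c {}s; elim: s a => [|w s IH] a t u v /=.
  apply: tlift_lin => [||a1 a2]; [exact: wact_bilin..|].
  by rewrite cact_linear_l lin_tw (talg_mul_bilin _).1.
apply: tlift_lin => [||a1 a2]; [exact: wact_bilin..|].
by rewrite IH (talg_mul_bilin _).2.
Qed.

Lemma wcoact_bilin2 (x : talg V) (y : A) :
  bilin (fun (t0 : talg V) (t1 : A) => talg_mul x t0 ⊗ (y * t1)).
Proof.
apply: (bilin_comp (@bilin_tpure _ _)); first exact: (talg_mul_bilin _).2.
by move=> c a b; rewrite mulrDr scalerAr.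
Qed.

Lemma wcoact_bilin (z : talg V ⊗ A) :
  bilin (fun (v0 : V) v1 => \sw_(t0, t1 <- z) talg_mul (tword [:: v0]) t0 ⊗ (v1 * t1)).
Proof.
split=> [a|v] c x y; apply: tlift_lin => [||t0 t1]; try exact: wcoact_bilin2.
  by rewrite lin_tw (talg_mul_bilin _).1 tpure_linear_l.
by rewrite mulrDl -scalerAl tpure_linear_r.
Qed.

Lemma talg_coact_word (s : seq V) : talg_coact (tword s) = word_coact s.
Proof.
apply: wlift_word => c {}s; elim: s => [|w s IH] t u v /=.
  by rewrite ccoact_linear linearP.
apply: tlift_lin => [||v0 v1]; [exact: wcoact_bilin..|].
by rewrite IH linearP.
Qed.

Lemma Psi_pure (v w : V) :
  Psi (v ⊗ w) = \sw_(w0, w1 <- ccoact w) w0 ⊗ cact v w1.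
Proof.
have B v' : bilin (fun (w0 : V) (w1 : A) => w0 ⊗ cact v' w1).
  apply: (bilin_comp (@bilin_tpure _ _)) => //; exact: cact_linear_r.
apply: tlift_pure => [x|x] c y z.
  apply: tlift_lin => // a b; by rewrite cact_linear_l tpure_linear_r.
by rewrite ccoact_linear linearP.
Qed.

Lemma talg_tmul_linear_l q : linear ((@talg_tmul k A V)^~ q).
Proof. by move=> c x y; rewrite /talg_tmul linearP. Qed.

Lemma talg_act_linear_l a : linear (fun x : talg V => talg_act x a).
Proof. by move=> c x y; rewrite /talg_act linearP. Qed.

Lemma talg_act_linear_r (x : talg V) : linear (talg_act x).
Proof.
move=> c a b; rewrite /talg_act; apply: wlift_lin => [d s *|d s *|s].
- by rewrite -!talg_act_word tword_multilin talg_act_linear_l.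
- by rewrite -!talg_act_word tword_multilin talg_act_linear_l.
by rewrite word_act_linear.
Qed.

Definition tmul_term (b c : bool) (x y z w : talg V) : talg V ⊗ talg V :=
  \sw_(z0, z1 <- talg_coact (parity_part (@talg_deg k V) c z))
    talg_mul x z0 ⊗ talg_mul (talg_act (parity_part (@talg_deg k V) b y) z1) w.

Lemma tmul_inner_bilin (s t w : talg V) :
  bilin (fun (z0 : talg V) (z1 : A) => talg_mul s z0 ⊗ talg_mul (talg_act t z1) w).
Proof.
apply: (bilin_comp (@bilin_tpure _ _)); first exact: (talg_mul_bilin _).2.
by move=> d a b; rewrite talg_act_linear_r (talg_mul_bilin _).1.
Qed.

Lemma tmul_term_1 b c y z w : linear (fun x => tmul_term b c x y z w).
Proof.
move=> d u v; apply: tlift_lin => [||z0 z1]; try exact: tmul_inner_bilin.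
by rewrite (talg_mul_bilin _).1 tpure_linear_l.
Qed.
Lemma tmul_term_2 b c x z w : linear (fun y => tmul_term b c x y z w).
Proof.
move=> d u v; apply: tlift_lin => [||z0 z1]; try exact: tmul_inner_bilin.
by rewrite parity_linear talg_act_linear_l (talg_mul_bilin _).1 tpure_linear_r.
Qed.
Lemma tmul_term_3 b c x y w : linear (fun z => tmul_term b c x y z w).
Proof. by move=> d u v; rewrite /tmul_term parity_linear /talg_coact !linearP. Qed.
Lemma tmul_term_4 b c x y z : linear (fun w => tmul_term b c x y z w).
Proof.
move=> d u v; apply: tlift_lin => [||z0 z1]; try exact: tmul_inner_bilin.
by rewrite (talg_mul_bilin _).2 tpure_linear_r.
Qed.

Definition tmul4 (x y z w : talg V) := \sum_(b : bool) \sum_(c : bool)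
    (-1 : k) ^+ (b && c) *: tmul_term b c x y z w.

Lemma lin_sum2 (W U : lmodType k) (F : bool -> bool -> W -> U) :
  (forall b c, linear (F b c)) ->
  linear (fun x => \sum_(b : bool) \sum_(c : bool) (-1 : k) ^+ (b && c) *: F b c x).
Proof.
move=> hF d u v; rewrite scaler_sumr -big_split; apply: eq_bigr => b _;
  rewrite scaler_sumr -big_split; apply: eq_bigr => b' _ /=.
by rewrite hF scalerDr !scalerA mulrC.
Qed.

Lemma tmul4_34 x y : bilin (tmul4 x y).
Proof.
split=> [w|z]; apply: lin_sum2 => b c; [exact: tmul_term_3|exact: tmul_term_4].
Qed.

Lemma tmul4_12 q : bilin (fun x y => tlift (tmul4 x y) q).
Proof.
split=> [y|x] d u v; apply: tlift_lin => [||z w]; try exact: tmul4_34.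
  by apply: (lin_sum2 (F := fun b c x => tmul_term b c x y z w)) => b c; exact: tmul_term_1.
by apply: (lin_sum2 (F := fun b c y => tmul_term b c x y z w)) => b c; exact: tmul_term_2.
Qed.

Lemma talg_tmul_linear_r p : linear (@talg_tmul k A V p).
Proof.
move=> c x y; apply: tlift_lin => [||s t]; try exact: tmul4_12.
by rewrite -/(tmul4 _ _) linearP.
Qed.

Lemma talg_tmul_pure x y z w :
  talg_tmul (x ⊗ y) (z ⊗ w) = tmul4 x y z w.
Proof.
rewrite /talg_tmul tlift_pure; [|exact: (tmul4_12 _).1|exact: (tmul4_12 _).2].
by rewrite tlift_pure //; [exact: (tmul4_34 _ _).1|exact: (tmul4_34 _ _).2].
Qed.

Lemma talg_cop_word (s : seq V) : talg_cop (tword s) = word_cop s.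
Proof.
apply: wlift_word => c {}s; elim: s => [|w s IH] t u v /=.
  rewrite -talg_tmul_linear_l; congr talg_tmul.
  rewrite lin_tw tpure_linear_l tpure_linear_r scalerDr -!addrA; congr +%R.
  by rewrite addrCA.
by rewrite IH talg_tmul_linear_r.
Qed.

Lemma talg_eps_word (s : seq V) : talg_eps (tword s) = (size s == 0%N)%:R.
Proof.
apply: wlift_word => c {}s t u v; rewrite !size_cat /= !addnS.
by rewrite scaler0 addr0.
Qed.
End CrossedWords.
End WellDefined.

(* Main.v *)
(* The super-bosonisation A # L of a braided-super Hopf algebra L generated in
   degree one is generated by A and the generators v in V, and all its axioms
   are checked by induction on multiplication by these on the left. Its antipode
   exists because the identity is convolution invertible in degree 0, and a
   convolution inverse then extends degree by degree through a geometric series.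

   For the quotient B_-(V), write D : T -> V ⊗ T for the component of the braided
   coproduct of the tensor algebra T with one letter on the left. Then
   [n, -Psi] is D followed by multiplication, so the total braided factorial phi
   satisfies phi x = eps x + u phi(y) for D x = u ⊗ y. Since D is a skew
   derivation and a map of crossed modules, ker phi is an ideal stable under the
   action and the coaction, and (phi ⊗ phi) cop = deconcatenation o phi shows
   that it is a coideal.

   Finally the differential is [theta, } in A # B_-(V) where theta^2 = 0 by
   the hypothesis on Psi at eta = theta. Put X = Delta_R theta - theta ⊗ 1. From
   Delta theta = X + theta ⊗ 1 + 1 ⊗ theta, the coderivation property at x says
   that X and Delta x commute in the graded sense. This is clear for x = 1 and
   propagates along x -> a x by the cotensor condition, and along x -> v x by the
   anticommutation of X with Delta_R v and the hypothesis on Psi. *)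
From HB Require Import structures.
Require Import Defs.
From mathcomp Require Import all_boot all_order all_algebra.
From mathcomp Require Import boolp classical_sets fsbigop.
Set Implicit Arguments.
Unset Strict Implicit.
Unset Printing Implicit Defensive.
Import GRing.Theory.
Local Open Scope ring_scope.

(** Tensor products are given by generators and relations, so exactness of W ⊗ - has to be earned,
    while each operation of B_-(V) is a lift that is meaningful only once the corresponding map on T
    kills ker phi. The remedy is a linear map [r] on T such that [r (phi x)] is the class of x:
    applied inside tensor factors, it turns Σ phi(x_0) ⊗ x_1 or Σ phi(y) ⊗ phi(z) into the same sum
    of classes.

    The factorial [n]! = (id ⊗ [n-1]!)[n] sets one letter aside on the left, which is why D, the
    extraction of a first letter, governs phi. The sign in -Psi is that of two odd letters crossing.

    In A # L the braiding turns into commutation: moving v past the factor of A that carries the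
    coaction of y produces v ◁ y_1. Products in (A # L) ⊗ (A # L) therefore involve signs only, and
    Δ(v) = v_0 ⊗ v_1 + 1 ⊗ v. The two halves of Δ(v) explain the shape of the hypotheses on theta:
    commuting X past v_0 ⊗ v_1 is the anticommutator condition, and commuting it past 1 ⊗ v is the
    condition on Psi. *)

(** * Closure properties of linear and bilinear maps *)

Section LinearClosure.
Context {k : fieldType}.
Implicit Types U V W X Y : lmodType k.

Lemma lin0 V W (f : V -> W) : linear f -> f 0 = 0.
Proof. by move=> h; have := h (-1) 0 0; rewrite scaler0 addr0 scaleN1r addNr. Qed.

Lemma linZ V W (f : V -> W) c x : linear f -> f (c *: x) = c *: f x.
Proof. by move=> h; rewrite -[c *: x]addr0 h lin0 ?addr0. Qed.

Lemma linD V W (f : V -> W) x y : linear f -> f (x + y) = f x + f y.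
Proof. by move=> h; rewrite -[x]scale1r h !scale1r. Qed.

Lemma linN V W (f : V -> W) x : linear f -> f (- x) = - f x.
Proof. by move=> h; rewrite -scaleN1r linZ // scaleN1r. Qed.

Lemma linB V W (f : V -> W) x y : linear f -> f (x - y) = f x - f y.
Proof. by move=> h; rewrite linD // linN. Qed.

Lemma linS V W (f : V -> W) (I : Type) (r : seq I) (P : pred I) (x : I -> V) :
  linear f -> f (\sum_(i <- r | P i) x i) = \sum_(i <- r | P i) f (x i).
Proof. by move=> h; apply: (big_morph f) => [? ?|]; [exact: linD|exact: lin0]. Qed.

Lemma lin_id V : linear (fun x : V => x). Proof. by []. Qed.

Lemma lin_comp V W U (f : W -> U) (g : V -> W) :
  linear f -> linear g -> linear (fun x => f (g x)).
Proof. by move=> hf hg c x y; rewrite hg hf. Qed.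

Lemma lin_canon V W (f : {linear V -> W}) : linear f.
Proof. by move=> c x y; rewrite linearP. Qed.

Lemma lin_opl V W X U (op : V -> W -> U) (f : X -> V) w :
  bilin op -> linear f -> linear (fun x => op (f x) w).
Proof. by move=> [h _] hf c x y; rewrite hf h. Qed.

Lemma lin_opr V W X U (op : V -> W -> U) (f : X -> W) v :
  bilin op -> linear f -> linear (fun x => op v (f x)).
Proof. by move=> [_ h] hf c x y; rewrite hf h. Qed.

Lemma lin_tlift_body V W X U (F : X -> V -> W -> U) t :
  (forall x, bilin (F x)) -> (forall v w, linear (fun x => F x v w)) ->
  linear (fun x => tlift (F x) t).
Proof.
by move=> hb hl c x y; apply: tlift_lin => [||v w]; [exact: hb|exact: hb|exact: hl].
Qed.

Lemma lin_tlift V W X U (F : V -> W -> U) (t : X -> V ⊗ W) :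
  linear t -> linear (fun x => tlift F (t x)).
Proof. by move=> ht c x y; rewrite ht linearP. Qed.

Lemma lin_add V W (f g : V -> W) :
  linear f -> linear g -> linear (fun x => f x + g x).
Proof. by move=> hf hg c x y; rewrite hf hg scalerDr addrACA. Qed.

Lemma lin_opp V W (f : V -> W) : linear f -> linear (fun x => - f x).
Proof. by move=> hf c x y; rewrite hf opprD scalerN. Qed.

Lemma lin_scale V W c (f : V -> W) : linear f -> linear (fun x => c *: f x).
Proof.
by move=> hf d x y; rewrite hf scalerDr !scalerA mulrC.
Qed.

Lemma lin_scalel V W (f : V -> k) (w : W) :
  linear (f : V -> k^o) -> linear (fun x => f x *: w).
Proof. by move=> hf d x y; rewrite hf scalerDl -scalerA. Qed.

Lemma lin_sum V W (I : Type) (r : seq I) (P : pred I) (f : I -> V -> W) :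
  (forall i, linear (f i)) -> linear (fun x => \sum_(i <- r | P i) f i x).
Proof.
move=> hf d x y; rewrite scaler_sumr -big_split; apply: eq_bigr => i _.
by rewrite hf.
Qed.

Lemma lin_zero V W : linear (fun _ : V => 0 : W).
Proof. by move=> c x y; rewrite scaler0 addr0. Qed.

Definition trilin V W X U (F : V -> W -> X -> U) :=
  (forall x, bilin (fun v w => F v w x)) /\ (forall v, bilin (F v)).

Lemma bilin_mul (R : algType k) : bilin (@GRing.mul R).
Proof.
split=> [w|v] c x y; first by rewrite mulrDl scalerAl.
by rewrite mulrDr scalerAr.
Qed.

Lemma bilin_tlift_body V W X Y U (F : X -> Y -> V -> W -> U) t :
  (forall x y, bilin (F x y)) -> (forall v w, bilin (fun x y => F x y v w)) ->
  bilin (fun x y => tlift (F x y) t).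
Proof.
move=> hb hl; split=> [y|x]; apply: lin_tlift_body => // v w.
  exact: (hl v w).1.
exact: (hl v w).2.
Qed.

Lemma bilinI V W U (f : V -> W -> U) :
  (forall w, linear (fun v => f v w)) -> (forall v, linear (fun w => f v w)) ->
  bilin f.
Proof. by []. Qed.

End LinearClosure.

Lemma bilin_cact (k : fieldType) (A : hopfAlgType k) (V : crossedModType A) :
  bilin (@cact k A V).
Proof. by split; [exact: cact_linear_l|exact: cact_linear_r]. Qed.

Lemma lin_hcop (k : fieldType) (A : hopfAlgType k) : linear (@hcop k A).
Proof. exact: hcop_linear. Qed.
Lemma lin_heps (k : fieldType) (A : hopfAlgType k) :
  linear (@heps k A : A -> k^o).
Proof. exact: heps_linear. Qed.
Lemma lin_hS (k : fieldType) (A : hopfAlgType k) : linear (@hS k A).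
Proof. exact: hS_linear. Qed.
Lemma lin_ccoact (k : fieldType) (A : hopfAlgType k) (V : crossedModType A) :
  linear (@ccoact k A V).
Proof. exact: ccoact_linear. Qed.

Lemma lin_letter (k : fieldType) (V : lmodType k) :
  linear (fun v : V => tword [:: v]).
Proof. by move=> c u v; exact: (tword_multilin c [::] [::]). Qed.

Create HintDb lin.
#[global] Hint Extern 0 (bilin (@tpure _ _ _)) => exact (@bilin_tpure _ _ _) : lin.
#[global] Hint Extern 0 (bilin (@GRing.mul _)) => refine (@bilin_mul _ _) : lin.
#[global] Hint Extern 0 (bilin (@cact _ _ _)) => refine (@bilin_cact _ _ _) : lin.
#[global] Hint Extern 0 (bilin (@talg_mul _ _)) => refine (@talg_mul_bilin _ _) : lin.
#[global] Hint Extern 0 (GRing.linear_for _ (@hcop _ _)) => refine (@lin_hcop _ _) : lin.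
#[global] Hint Extern 0 (GRing.linear_for _ (@heps _ _)) => refine (@lin_heps _ _) : lin.
#[global] Hint Extern 0 (GRing.linear_for _ (@hS _ _)) => refine (@lin_hS _ _) : lin.
#[global] Hint Extern 0 (GRing.linear_for _ (@ccoact _ _ _)) => refine (@lin_ccoact _ _ _) : lin.

Ltac lin_db := solve [auto with lin nocore | eassumption].

Ltac lin_nested :=
  match goal with
  | |- bilin (fun x y => tlift (@?F x y) ?t) =>
      refine (@bilin_tlift_body _ _ _ _ _ _ F t _ _)
  end.

(* Proves linearity of a function of one variable, or bilinearity of a function
   of two, from the syntactic shape of its body. *)
Ltac lin :=
  cbv beta;
  lazymatch goal with
  | |- bilin _ =>
      tryif lin_nested then lin
      else first [lin_db | refine (bilinI _ _); intro; lin]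
  | |- trilin _ => split; intro; lin
  | |- GRing.linear_for _ _ => lin_core
  | |- forall _, _ => intro; lin
  end
with lin_core :=
  match goal with
  | |- GRing.linear_for _ (fun x => x) => exact (@lin_id _ _)
  | |- GRing.linear_for _ (fun x => ?c) => exact (@lin_zero _ _ _)
  | |- GRing.linear_for _ (fun x => tlift ?F (@?t x)) =>
      refine (@lin_tlift _ _ _ _ _ F t _); lin
  | |- GRing.linear_for _ (fun x => tlift (@?F x) ?t) =>
      refine (@lin_tlift_body _ _ _ _ _ F t _ _); lin
  | |- GRing.linear_for _ (fun x => @?f x + @?g x) =>
      refine (@lin_add _ _ _ f g _ _); lin
  | |- GRing.linear_for _ (fun x => - (@?f x)) =>
      refine (@lin_opp _ _ _ f _); lin
  | |- GRing.linear_for _ (fun x => ?c *: @?f x) =>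
      refine (@lin_scale _ _ _ c f _); lin
  | |- GRing.linear_for _ (fun x => @?f x *: ?c) =>
      refine (@lin_scalel _ _ _ f c _); lin
  | |- GRing.linear_for _ (fun x => bigop _ _ _) =>
      apply: lin_sum => ? /=; lin
  | |- GRing.linear_for _ (fun x => tword [:: @?f x]) =>
      refine (lin_comp (@lin_letter _ _) (g := f) _); lin
  | |- GRing.linear_for _ (fun x => @heps _ ?A (@?f x)) =>
      refine (lin_comp (@lin_heps _ A) (g := f) _); lin
  | |- GRing.linear_for _ (fun x => ?op (@?f x) ?c) =>
      refine (@lin_opl _ _ _ _ _ op f c _ _); [lin_db | lin]
  | |- GRing.linear_for _ (fun x => ?op ?c (@?f x)) =>
      refine (@lin_opr _ _ _ _ _ op f c _ _); [lin_db | lin]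
  | |- GRing.linear_for _ (fun x => ?g (@?f x)) =>
      refine (@lin_comp _ _ _ _ g f _ _); [first [lin_db | exact (lin_canon _)] | lin]
  | |- GRing.linear_for _ ?f => first [lin_db | exact (lin_canon _) |
       match f with fun _ => _ => fail 1 | _ => 
        change (GRing.linear_for *:%R (fun x => f x)); lin end]
  end.
#[global] Hint Extern 0 (bilin _) => solve [lin] : core.
#[global] Hint Extern 0 (trilin _) => solve [lin] : core.
#[global] Hint Extern 0 (GRing.linear_for _ _) => solve [lin] : core.

(** * Calculus of Sweedler sums *)

Section Sweedler.
Context {k : fieldType}.
Implicit Types U V W X Y : lmodType k.

Definition linear_of V W (f : V -> W) of linear f := f.
HB.instance Definition _ V W (f : V -> W) (hf : linear f) :=
  GRing.isLinear.Build k V W *:%R (linear_of hf) hf.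

Lemma eq_sw V W U (f g : V -> W -> U) x :
  (forall v w, f v w = g v w) -> tlift f x = tlift g x.
Proof. by move=> h; congr (tlift _ x); apply/funext => v; apply/funext => w. Qed.

Lemma swE V W U (f : V -> W -> U) v w : bilin f -> tlift f (v ⊗ w) = f v w.
Proof. by move=> [h1 h2]; exact: tlift_pure. Qed.

Lemma sw_ext V W U (f g : V ⊗ W -> U) : linear f -> linear g ->
  (forall v w, f (v ⊗ w) = g (v ⊗ w)) -> forall x, f x = g x.
Proof.
move=> hf hg h.
exact: (@tens_ext _ _ _ _ (linear_of hf) (linear_of hg)).
Qed.

Lemma sw_push V W U X (f : U -> X) (E : V -> W -> U) x : linear f -> bilin E ->
  f (tlift E x) = tlift (fun v w => f (E v w)) x.
Proof.
by move=> hf [h1 h2]; move: x; apply: sw_ext => // v w; rewrite !swE.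
Qed.

Lemma sw_id V W (x : V ⊗ W) : \sw_(v, w <- x) v ⊗ w = x.
Proof. by move: x; apply: sw_ext => // v w; rewrite swE. Qed.

Lemma sw_opl V W U X Y (op : U -> X -> Y) (E : V -> W -> U) t y :
  bilin op -> bilin E -> op (tlift E t) y = \sw_(v, w <- t) op (E v w) y.
Proof. by move=> [h _]; apply: (sw_push (f := op^~ y)). Qed.

Lemma sw_opr V W U X Y (op : X -> U -> Y) (E : V -> W -> U) t y :
  bilin op -> bilin E -> op y (tlift E t) = \sw_(v, w <- t) op y (E v w).
Proof. by move=> [_ h]; apply: (sw_push (f := op y)). Qed.

Lemma sw_sw V W X Y U (E : V -> W -> X ⊗ Y) (F : X -> Y -> U) t : bilin E ->
  \sw_(x, y <- tlift E t) F x y = \sw_(v, w <- t) (\sw_(x, y <- E v w) F x y).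
Proof. by move=> hE; rewrite (sw_push (f := tlift F)). Qed.

Lemma sw_add V W U (E F : V -> W -> U) t : bilin E -> bilin F ->
  \sw_(v, w <- t) (E v w + F v w) = tlift E t + tlift F t.
Proof.
by move=> hE hF; move: t; apply: sw_ext => // v w; rewrite !swE.
Qed.

Lemma sw_opp V W U (E : V -> W -> U) t : bilin E ->
  \sw_(v, w <- t) (- E v w) = - tlift E t.
Proof. by move=> hE; rewrite (sw_push (f := @GRing.opp U)). Qed.

Lemma sw_scale V W U c (E : V -> W -> U) t : bilin E ->
  \sw_(v, w <- t) (c *: E v w) = c *: tlift E t.
Proof. by move=> hE; rewrite (sw_push (f := *:%R c)). Qed.

Lemma sw_sum V W U (I : Type) (r : seq I) (P : pred I) (E : I -> V -> W -> U) t :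
  (forall i, bilin (E i)) ->
  \sw_(v, w <- t) (\sum_(i <- r | P i) E i v w) =
  \sum_(i <- r | P i) tlift (E i) t.
Proof.
move=> hE; move: t; apply: sw_ext => // v w.
rewrite swE; last by split=> ?; apply: lin_sum => i; case: (hE i).
by apply: eq_bigr => i _; rewrite swE.
Qed.

Lemma sw_swap V W X Y U (E : V -> W -> X -> Y -> U) s t :
  (forall v w, bilin (E v w)) -> (forall x y, bilin (fun v w => E v w x y)) ->
  \sw_(v, w <- s) (\sw_(x, y <- t) E v w x y) =
  \sw_(x, y <- t) (\sw_(v, w <- s) E v w x y).
Proof.
move=> h1 h2.
have L v w : linear (tlift (E v w)) by [].
have B : bilin (fun v w => \sw_(x, y <- t) E v w x y).
  by split=> [w|v]; apply: lin_tlift_body => // x y; case: (h2 x y) => h3 h4;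
    [exact: h3|exact: h4].
move: s; apply: sw_ext => // v w.
rewrite swE //; apply: eq_sw => x y.
by rewrite (swE (f := fun v w => E v w x y)).
Qed.

(* The function used to test a coassociativity identity is arbitrary
   trilinear, so that the identity can be applied inside any expression. *)
Lemma sw_coassoc V W X Y W' U (s : V ⊗ W) (f : V -> X ⊗ Y)
    (s' : X ⊗ W') (g : W' -> Y ⊗ W) (F : X -> Y -> W -> U) :
  linear f -> linear g ->
  \sw_(v, w <- s) (\sw_(x, y <- f v) x ⊗ (y ⊗ w)) =
  \sw_(x, w' <- s') x ⊗ g w' ->
  trilin F ->
  \sw_(v, w <- s) (\sw_(x, y <- f v) F x y w) =
  \sw_(x, w' <- s') (\sw_(y, w <- g w') F x y w).
Proof.
move=> hf hg e [h1 h2].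
have L x : linear (fun t => tlift (F x) t) by [].
have B : bilin (fun x t => tlift (F x) t).
  split=> [t|x]; last exact: L.
  by apply: lin_tlift_body => // y w; case: (h1 w) => h3 _; exact: h3.
have := congr1 (tlift (fun x t => tlift (F x) t)) e.
rewrite !sw_sw //.
move=> e2; etransitivity; [|etransitivity; [exact: e2|]].
  apply: eq_sw => v w; rewrite sw_sw //; apply: eq_sw => x y.
  by rewrite (swE (f := fun x t => tlift (F x) t)) ?swE.
by apply: eq_sw => x w'; rewrite (swE (f := fun x t => tlift (F x) t)).
Qed.
End Sweedler.

(* [sw_rule] solves [e = ?y] by one expansion of the head of [e]; it is extended
   as operations acquire expansion lemmas. *)
Ltac sw_rule := fail.

Ltac sw_split :=
  match goal with
  | |- tlift (fun v w => @?a v w + @?b v w) ?s = _ =>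
      etransitivity; [apply: (@sw_add _ _ _ _ a b); lin | apply: congr2; sw_split]
  | |- tlift (fun v w => - @?a v w) ?s = _ =>
      etransitivity; [apply: (@sw_opp _ _ _ _ a); lin | apply: congr1; sw_split]
  | |- tlift (fun v w => ?c *: @?a v w) ?s = _ =>
      etransitivity; [apply: (@sw_scale _ _ _ _ c a); lin | apply: congr1; sw_split]
  | |- _ => reflexivity
  end.

(* Rewrites the left-hand side of [e = ?y] as a combination of nested Sweedler
   sums of pure terms, by multilinearity. *)
Ltac swn :=
  cbv beta;
  first [ etransitivity; [sw_rule | swn] |
  lazymatch goal with
  | |- tlift ?F ?t = _ =>
      etransitivity; [apply: (congr1 (tlift F)); swn | sw_head]
  | |- ?a + ?b = _ => apply: congr2; swn
  | |- - ?a = _ => apply: congr1; swn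
  | |- ?c *: ?a = _ => 
      etransitivity; [apply: congr1; swn | first [sw_un | reflexivity]]
  | |- ?op ?a ?b = _ =>
      first [ assert_succeeds (have : bilin op by lin_db);
              etransitivity; [apply: (congr2 op); swn | sw_bin]
            | assert_succeeds (have : GRing.linear_for *:%R (op a) by lin);
              etransitivity; [apply: (congr1 (op a)); swn | sw_un]
            | reflexivity ]
  | |- ?f ?a = _ =>
      first [ assert_succeeds (have : GRing.linear_for *:%R f by lin);
              etransitivity; [apply: (congr1 f); swn | sw_un]
            | reflexivity ]
  | |- _ => reflexivity
  end]
with sw_head :=
  lazymatch goal with
  | |- tlift ?F (tlift ?E ?s) = _ =>
      etransitivity; [apply: sw_sw; lin | sw_body]
  | |- tlift ?F (?v ⊗ ?w) = _ =>
      etransitivity; [apply: swE; lin | swn]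
  | |- tlift ?F (?a + ?b) = _ =>
      etransitivity; [apply: (@linD _ _ _ (tlift F)); lin | apply: congr2; sw_head]
  | |- tlift ?F (- ?a) = _ =>
      etransitivity; [apply: (@linN _ _ _ (tlift F)); lin | apply: congr1; sw_head]
  | |- tlift ?F (?c *: ?a) = _ =>
      etransitivity; [apply: (@linZ _ _ _ (tlift F)); lin | apply: congr1; sw_head]
  | |- _ => sw_body
  end
with sw_body :=
  etransitivity; [apply: eq_sw => ? ?; swn | sw_split]
with sw_un :=
  lazymatch goal with
  | |- ?f (tlift ?E ?s) = _ =>
      etransitivity; [apply: (@sw_push _ _ _ _ _ f); lin | etransitivity; [apply: eq_sw => ? ?; cbv beta; sw_un | sw_split]]
  | |- ?f (?a + ?b) = _ =>
      etransitivity; [apply: (@linD _ _ _ f); lin | apply: congr2; sw_un]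
  | |- ?f (- ?a) = _ =>
      etransitivity; [apply: (@linN _ _ _ f); lin | apply: congr1; sw_un]
  | |- ?f (?c *: ?a) = _ =>
      etransitivity; [apply: (@linZ _ _ _ f); lin | apply: congr1; sw_un]
  | |- _ => first [ etransitivity; [sw_rule | swn] | reflexivity ]
  end
with sw_bin :=
  lazymatch goal with
  | |- ?op (tlift ?E ?s) ?y = _ =>
      etransitivity; [apply: (@sw_opl _ _ _ _ _ _ op); lin | etransitivity; [apply: eq_sw => ? ?; cbv beta; sw_bin | sw_split]]
  | |- ?op ?y (tlift ?E ?s) = _ =>
      etransitivity; [apply: (@sw_opr _ _ _ _ _ _ op); lin | etransitivity; [apply: eq_sw => ? ?; cbv beta; sw_bin | sw_split]]
  | |- ?op (?a + ?b) ?y = _ =>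
      etransitivity; [apply: (@linD _ _ _ (fun x => op x y)); lin | apply: congr2; sw_bin]
  | |- ?op (- ?a) ?y = _ =>
      etransitivity; [apply: (@linN _ _ _ (fun x => op x y)); lin | apply: congr1; sw_bin]
  | |- ?op (?c *: ?a) ?y = _ =>
      etransitivity; [apply: (@linZ _ _ _ (fun x => op x y)); lin | apply: congr1; sw_bin]
  | |- ?op ?y (?a + ?b) = _ =>
      etransitivity; [apply: (@linD _ _ _ (op y)); lin | apply: congr2; sw_bin]
  | |- ?op ?y (- ?a) = _ =>
      etransitivity; [apply: (@linN _ _ _ (op y)); lin | apply: congr1; sw_bin]
  | |- ?op ?y (?c *: ?a) = _ =>
      etransitivity; [apply: (@linZ _ _ _ (op y)); lin | apply: congr1; sw_bin]
  | |- _ => first [ etransitivity; [sw_rule | swn] | reflexivity ]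
  end.

Ltac swl := etransitivity; [swn | ].
Ltac swr := symmetry; etransitivity; [swn | ]; symmetry.

Section Tpure.
Context {k : fieldType} {V W : lmodType k}.
Implicit Types (v : V) (w : W).
Lemma tpureDl v v' w : (v + v') ⊗ w = v ⊗ w + v' ⊗ w.
Proof. exact: (linD _ _ (tpure_linear_l w)). Qed.
Lemma tpureDr v w w' : v ⊗ (w + w') = v ⊗ w + v ⊗ w'.
Proof. exact: (linD _ _ (tpure_linear_r v)). Qed.
Lemma tpureNl v w : (- v) ⊗ w = - (v ⊗ w).
Proof. exact: (linN _ (tpure_linear_l w)). Qed.
Lemma tpureNr v w : v ⊗ (- w) = - (v ⊗ w).
Proof. exact: (linN _ (tpure_linear_r v)). Qed.
Lemma tpureZl c v w : (c *: v) ⊗ w = c *: (v ⊗ w).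
Proof. exact: (linZ _ _ (tpure_linear_l w)). Qed.
Lemma tpureZr c v w : v ⊗ (c *: w) = c *: (v ⊗ w).
Proof. exact: (linZ _ _ (tpure_linear_r v)). Qed.
Lemma tpure0l w : (0 : V) ⊗ w = 0.
Proof. exact: (lin0 (tpure_linear_l w)). Qed.
Lemma tpure0r v : v ⊗ (0 : W) = 0.
Proof. exact: (lin0 (tpure_linear_r v)). Qed.
End Tpure.

Lemma tens_ind (k : fieldType) (V W : lmodType k) (P : V ⊗ W -> Prop) :
  (forall c x y, P x -> P y -> P (c *: x + y)) ->
  (forall v w, P (v ⊗ w)) -> forall x, P x.
Proof.
move=> hlin h; apply: pclassW => s; rewrite pres_piE.
elim: s => [|[c [v w]] s IH]; rewrite /fsum ?big_nil ?big_cons.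
  (* The empty sum is the pure tensor [0 ⊗ 0], so [P] needs no separate hypothesis at 0. *)
  by rewrite -(tpure0l (V := V) (0 : W)).
by apply: hlin => //; exact: h.
Qed.

Lemma sw_eq0 (k : fieldType) (V W U : lmodType k) (f : V -> W -> U) x :
  (forall v w, f v w = 0) -> tlift f x = 0.
Proof.
move=> h; rewrite (eq_sw (g := fun _ _ => 0)) //.
by move: x; apply: sw_ext => // v w; rewrite swE.
Qed.

Lemma sw_argD (k : fieldType) (V W U : lmodType k) (F : V -> W -> U) x y :
  tlift F (x + y) = tlift F x + tlift F y.
Proof. exact: linearD. Qed.

Lemma sw_arg_sum (k : fieldType) (V W U : lmodType k) (F : V -> W -> U)
    (I : Type) (r : seq I) (P : pred I) (x : I -> V ⊗ W) :
  tlift F (\sum_(i <- r | P i) x i) = \sum_(i <- r | P i) tlift F (x i).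
Proof. exact: linear_sum. Qed.

Section Tlift3.
Context {k : fieldType} {V W X U : lmodType k}.
(** An identity between threefold tensors can be substituted as a whole only if the expression
    around it is one function of that tensor; this provides the function. *)
Definition tlift3 (F : V -> W -> X -> U) (t : V ⊗ (W ⊗ X)) : U :=
  \sw_(v, t' <- t) (\sw_(w, x <- t') F v w x).

Lemma lin_tlift3 F : linear (tlift3 F).
Proof. by rewrite /tlift3. Qed.

Lemma tlift3E (F : V -> W -> X -> U) v t :
  trilin F -> tlift3 F (v ⊗ t) = tlift (F v) t.
Proof.
move=> [h1 h2]; rewrite /tlift3 swE //.
split=> [t'|u]; last by move=> c y z; rewrite linearP.
by apply: lin_tlift_body => // y z; case: (h1 z) => h _; exact: h.
Qed.
End Tlift3.
#[global] Hint Extern 0 (GRing.linear_for _ (tlift3 _)) => refine (lin_tlift3 _) : lin.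

(* [hcop] and [ccoact], with a type mentioning the canonical structures of A and
   V instead of the unfolded records of their mixins: unification is
   considerably faster on these. *)
Definition hcp (k : fieldType) (A : hopfAlgType k) : A -> A ⊗ A := @hcop k A.
Definition cco (k : fieldType) (A : hopfAlgType k) (V : crossedModType A) :
  V -> V ⊗ A := @ccoact k A V.

(** * Hopf algebra and crossed module identities in Sweedler form *)

Section HopfSweedler.
Context {k : fieldType} {A : hopfAlgType k}.
Implicit Types (U : lmodType k) (V : crossedModType A).

Lemma lin_hcp : linear (@hcp k A). Proof. exact: hcop_linear. Qed.
Lemma lin_cco V : linear (@cco k A V). Proof. exact: ccoact_linear. Qed.

Lemma hcpM (a b : A) : hcp (a * b) =
  \sw_(a1, a2 <- hcp a) (\sw_(b1, b2 <- hcp b) (a1 * b1) ⊗ (a2 * b2)).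
Proof. exact: hcopM. Qed.
Lemma hcp1 : hcp (1 : A) = 1 ⊗ 1. Proof. exact: hcop1. Qed.
Lemma cco_act V (v : V) a : cco (cact v a) =
  \sw_(v0, v1 <- cco v) (\sw_(a1, a' <- hcp a) (\sw_(a2, a3 <- hcp a')
      cact v0 a2 ⊗ (hS a1 * v1 * a3))).
Proof. exact: ccoact_act. Qed.

End HopfSweedler.
#[global] Hint Extern 0 (GRing.linear_for _ (@hcp _ _)) => refine (@lin_hcp _ _) : lin.
#[global] Hint Extern 0 (GRing.linear_for _ (@cco _ _ _)) => refine (@lin_cco _ _ _) : lin.

Ltac sw_rule_A :=
  lazymatch goal with
  | |- hcp (_ * _) = _ => refine (hcpM _ _)
  | |- hcp 1 = _ => refine hcp1
  end.
Ltac sw_rule_V :=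
  lazymatch goal with
  | |- cco (cact _ _) = _ => refine (cco_act _ _)
  end.
Ltac sw_rule ::= first [sw_rule_A | sw_rule_V].

Section HopfSweedler.
Context {k : fieldType} {A : hopfAlgType k}.
Implicit Types (U : lmodType k) (V : crossedModType A).

Lemma hcp_assoc U (F : A -> A -> A -> U) a : trilin F ->
  \sw_(b, c <- hcp a) (\sw_(b1, b2 <- hcp b) F b1 b2 c) =
  \sw_(b, c <- hcp a) (\sw_(c1, c2 <- hcp c) F b c1 c2).
Proof. by apply: sw_coassoc => //; exact: hcopA. Qed.

Lemma cco_assoc U V (F : V -> A -> A -> U) v : trilin F ->
  \sw_(v', c <- cco v) (\sw_(v0, v1 <- cco v') F v0 v1 c) =
  \sw_(v0, c <- cco v) (\sw_(c1, c2 <- hcp c) F v0 c1 c2).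
Proof. by apply: sw_coassoc => //; exact: ccoactA. Qed.

Lemma sw_hepsl U (F : A -> U) a : linear F ->
  \sw_(b, c <- hcp a) heps b *: F c = F a.
Proof.
move=> hF; have e : \sw_(b, c <- hcp a) heps b *: c = a := hepsl a.
by rewrite -[in RHS]e (sw_push (f := F)) //; apply: eq_sw => b c; rewrite linZ.
Qed.

Lemma sw_hepsr U (F : A -> U) a : linear F ->
  \sw_(b, c <- hcp a) heps c *: F b = F a.
Proof.
move=> hF; have e : \sw_(b, c <- hcp a) heps c *: b = a := hepsr a.
by rewrite -[in RHS]e (sw_push (f := F)) //; apply: eq_sw => b c; rewrite linZ.
Qed.

Lemma sw_ceps V U (F : V -> U) v : linear F ->
  \sw_(v0, v1 <- cco v) heps v1 *: F v0 = F v.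
Proof.
move=> hF; have e : \sw_(v0, v1 <- cco v) heps v1 *: v0 = v := ccoact_eps v.
by rewrite -[in RHS]e (sw_push (f := F)) //; apply: eq_sw => b c; rewrite linZ.
Qed.

Lemma sw_hSl U (F : A -> U) a : linear F ->
  \sw_(b, c <- hcp a) F (hS b * c) = heps a *: F 1.
Proof.
move=> hF; have e : \sw_(b, c <- hcp a) hS b * c = (heps a)%:A := hSl a.
by rewrite -linZ // -e (sw_push (f := F)).
Qed.

Lemma sw_hSr U (F : A -> U) a : linear F ->
  \sw_(b, c <- hcp a) F (b * hS c) = heps a *: F 1.
Proof.
move=> hF; have e : \sw_(b, c <- hcp a) b * hS c = (heps a)%:A := hSr a.
by rewrite -linZ // -e (sw_push (f := F)).
Qed.

(* The compatibility of action and coaction, in the equivalent form that does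
   not mention the antipode. *)
Lemma yetter_drinfeld V U (F : V -> A -> U) v b : bilin F ->
  \sw_(b1, b2 <- hcp b) (\sw_(w0, w1 <- cco (cact v b2)) F w0 (b1 * w1)) =
  \sw_(v0, v1 <- cco v) (\sw_(b1, b2 <- hcp b) F (cact v0 b1) (v1 * b2)).
Proof.
move=> hF; swl.
transitivity (\sw_(v0, v1 <- cco v) \sw_(b1, b2 <- hcp b) \sw_(a1, a' <- hcp b2)
  \sw_(a2, a3 <- hcp a') F (cact v0 a2) (b1 * (hS a1 * v1 * a3))).
  by rewrite sw_swap.
apply: eq_sw => v0 v1.
(* Coassociativity makes [b1] and [hS a1] the two legs of one element. Their product collapses to
   the counit, once [v1] is written as [1 * v1] to receive it. *)
rewrite -(hcp_assoc (F := fun b1 a1 a' =>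
  \sw_(a2, a3 <- hcp a') F (cact v0 a2) (b1 * (hS a1 * v1 * a3)))) //.
rewrite -[RHS](sw_hepsl (F := fun a =>
  \sw_(a2, a3 <- hcp a) F (cact v0 a2) (v1 * a3))) //.
apply: eq_sw => b0 c; rewrite sw_swap // -sw_scale //; apply: eq_sw => a2 a3.
rewrite -[v1 in RHS]mul1r -(sw_hSr (F := fun x => F _ (x * _ * _))) //.
by apply: eq_sw => ? ?; rewrite !mulrA.
Qed.

End HopfSweedler.

(** * Gradings and parity *)

Lemma sum_stable (V : zmodType) (f : nat -> V) M N :
  (forall n, (M <= n)%N -> f n = 0) -> (forall n, (N <= n)%N -> f n = 0) ->
  \sum_(n < M) f n = \sum_(n < N) f n.
Proof.
wlog hMN : M N / (M <= N)%N => [th h1 h2|h _].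
  by case: (leqP M N) => [/th|/ltnW/th e]; [apply|rewrite e].
rewrite -!(big_mkord xpredT f) [RHS](big_cat_nat (leq0n M) hMN) /=.
rewrite [X in _ = _ + X]big_nat [X in _ = _ + X]big1 ?addr0 // => i /andP[hi _].
exact: h.
Qed.

Section Grading.
Context {k : fieldType} {H : lmodType k}.
Variable deg : nat -> H -> H.
Hypothesis hdeg : is_grading deg.

Lemma deg_linear n : linear (deg n). Proof. by case: hdeg. Qed.
Hint Resolve deg_linear : lin.

Lemma degK m n x : deg m (deg n x) = if m == n then deg n x else 0.
Proof. by case: hdeg. Qed.

Lemma deg_fin x : exists N, forall n, (N <= n)%N -> deg n x = 0.
Proof.
have [_ _ /(_ x) [N e]] := hdeg; exists N => n hn; rewrite e linS //.
rewrite big1 // => i _; rewrite degK gtn_eqF //; exact: leq_trans hn.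
Qed.

Lemma deg_sum x N : (forall n, (N <= n)%N -> deg n x = 0) ->
  x = \sum_(n < N) deg n x.
Proof.
move=> hN; have [_ _ /(_ x) [M e]] := hdeg.
have hM n : (M <= n)%N -> deg n x = 0.
  move=> hn; rewrite e linS // big1 // => i _.
  rewrite degK gtn_eqF //; exact: leq_trans hn.
rewrite {1}e; exact: (sum_stable (f := fun n => deg n x)).
Qed.

Lemma deg_ext (U : lmodType k) (f g : H -> U) : linear f -> linear g ->
  (forall n x, f (deg n x) = g (deg n x)) -> forall x, f x = g x.
Proof.
move=> hf hg e x; have [N hN] := deg_fin x.
by rewrite (deg_sum hN) !linS //; apply: eq_bigr.
Qed.

(** The value at x is a sum cut at a chosen bound on the degrees of x. Since it does not depend on
    the bound, a common bound for x and y gives linearity. *)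
Lemma deg_glue (U : lmodType k) (F : nat -> H -> U) : (forall n, linear (F n)) ->
  exists2 f : H -> U, linear f & forall n x, f (deg n x) = F n (deg n x).
Proof.
move=> hF; pose N x := projT1 (cid (deg_fin x)).
have hN x n : (N x <= n)%N -> deg n x = 0 by apply: (projT2 (cid (deg_fin x))).
pose f x := \sum_(n < N x) F n (deg n x).
have fE x M : (forall n, (M <= n)%N -> deg n x = 0) -> f x = \sum_(n < M) F n (deg n x).
  move=> h0; apply: (sum_stable (f := fun n => F n (deg n x))) => n.
    by move/hN => ->; rewrite lin0.
  by move/h0 => ->; rewrite lin0.
exists f => [c x y|n x].
  pose M := maxn (N x) (N y).
  have hx n : (M <= n)%N -> deg n x = 0 by rewrite geq_max => /andP[/hN].
  have hy n : (M <= n)%N -> deg n y = 0 by rewrite geq_max => /andP[_ /hN].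
  rewrite (fE _ M hx) (fE _ M hy) (fE _ M); last first.
    by move=> n hn; rewrite deg_linear hx ?hy // scaler0 addr0.
  rewrite scaler_sumr -big_split; apply: eq_bigr => n _ /=.
  by rewrite deg_linear hF.
rewrite (fE _ n.+1); last first.
  by move=> m hm; rewrite degK gtn_eqF.
rewrite big_ord_recr /= degK eqxx big1 ?add0r // => i _.
by rewrite degK ltn_eqF // lin0.
Qed.

(** A sum over an infinite set has its intended value only when its support is finite, the default
    being 0 otherwise; the bound on the degrees of x guarantees finiteness. *)
Lemma parity_bounded N b x : (forall n, (N <= n)%N -> deg n x = 0) ->
  parity_part deg b x = \sum_(n < N | odd n == b) deg n x.
Proof.
move=> hx; rewrite /parity_part -(big_mkord (fun n => odd n == b) (fun n => deg n x)).
rewrite -big_filter [RHS]fsbig_seq; last exact/filter_uniq/iota_uniq.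
apply/esym/fsbig_widen => n /=; first by rewrite mem_filter => /andP[/eqP].
move=> [h1 h2]; apply: hx; rewrite leqNgt; apply/negP => h.
by apply: h2; rewrite mem_filter mem_index_iota h1 eqxx.
Qed.

Lemma parity_part_linear b : linear (parity_part deg b).
Proof.
move=> c x y; have [N hx] := deg_fin x; have [M hy] := deg_fin y.
have hx' n : (maxn N M <= n)%N -> deg n x = 0 by rewrite geq_max => /andP[/hx].
have hy' n : (maxn N M <= n)%N -> deg n y = 0 by rewrite geq_max => /andP[_ /hy].
rewrite (parity_bounded _ hx') (parity_bounded _ hy') (@parity_bounded (maxn N M)).
  by rewrite scaler_sumr -big_split; apply: eq_bigr => n _; rewrite deg_linear.
by move=> n hn; rewrite deg_linear hx' ?hy' // scaler0 addr0.
Qed.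

Lemma parity_part_deg b n x :
  parity_part deg b (deg n x) = if odd n == b then deg n x else 0.
Proof.
rewrite (@parity_bounded n.+1); last by move=> m hm; rewrite degK gtn_eqF.
rewrite big_mkcond big_ord_recr /= degK eqxx big1 ?add0r // => i _.
by rewrite degK ltn_eqF // if_same.
Qed.

Lemma parity_inv_linear : linear (parity_inv deg).
Proof.
by move=> c x y; rewrite /parity_inv !parity_part_linear opprD addrACA scalerDr scalerN.
Qed.

Lemma parity_inv_deg n x : parity_inv deg (deg n x) = (-1) ^+ odd n *: deg n x.
Proof.
rewrite /parity_inv !parity_part_deg; case: (odd n).
  by rewrite sub0r expr1 scaleN1r.
by rewrite subr0 expr0 scale1r.
Qed.
End Grading.

Section ParityShift.
Context {k : fieldType} {H : lmodType k}.
Variable deg : nat -> H -> H.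
Hypothesis hdeg : is_grading deg.

Lemma parity_inv_even (f : H -> H) : linear f ->
  (forall n x, deg n (f x) = f (deg n x)) ->
  forall x, parity_inv deg (f x) = f (parity_inv deg x).
Proof.
move=> hf e; have hp := parity_inv_linear hdeg.
apply: (deg_ext hdeg) => // n x.
by rewrite -e parity_inv_deg // parity_inv_deg // linZ // e.
Qed.

Lemma parity_inv_odd (f : H -> H) : linear f ->
  (forall n x, deg n.+1 (f x) = f (deg n x)) ->
  forall x, parity_inv deg (f x) = - f (parity_inv deg x).
Proof.
move=> hf e; have hp := parity_inv_linear hdeg.
apply: (deg_ext hdeg) => // n x.
rewrite -e parity_inv_deg // parity_inv_deg // linZ // e /=.
by case: (odd n); rewrite ?expr1 ?expr0 ?scaleN1r ?scale1r ?opprK.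
Qed.

Lemma parity_invK x : parity_inv deg (parity_inv deg x) = x.
Proof.
have hp := parity_inv_linear hdeg; move: x; apply: (deg_ext hdeg) => // n x.
by rewrite parity_inv_deg // linZ // parity_inv_deg // scalerA -expr2 sqrr_sign scale1r.
Qed.

Lemma deg_parity_inv n x : deg n (parity_inv deg x) = parity_inv deg (deg n x).
Proof.
have hp := parity_inv_linear hdeg; have hd := deg_linear hdeg.
move: x; apply: (deg_ext hdeg) => // m x.
rewrite parity_inv_deg // linZ // (degK hdeg); case: eqP => _.
  by rewrite parity_inv_deg.
by rewrite scaler0 lin0.
Qed.

Lemma parity_partD x : parity_part deg false x + parity_part deg true x = x.
Proof.
have hp := parity_part_linear hdeg.
move: x; apply: (deg_ext hdeg) => // n x.
by rewrite !parity_part_deg //; case: odd; rewrite ?add0r ?addr0.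
Qed.

Lemma parity_inv_part b x :
  parity_inv deg (parity_part deg b x) = (-1) ^+ b *: parity_part deg b x.
Proof.
have hp := parity_part_linear hdeg; have hi := parity_inv_linear hdeg.
move: x; apply: (deg_ext hdeg) => // n x.
rewrite parity_part_deg //; case: eqP => [<-|_]; first by rewrite parity_inv_deg.
by rewrite lin0 // scaler0.
Qed.
End ParityShift.

(* The part of the axioms of a braided-super Hopf algebra that can be read off
   the generators: operations are prescribed on 1 and on products g v * x only,
   and everything else is derived by the induction [bg_ind]. *)
Record bs_generated (k : fieldType) (A : hopfAlgType k) (V : crossedModType A)
    (L : bsHopfData A) (g : V -> L) : Prop := BsGenerated {
  bg_gen : linear g;
  bg_deg : forall n, linear (@bs_deg k A L n);
  bg_mul : bilin (@bs_mul k A L);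
  bg_act : bilin (@bs_act k A L);
  bg_coact : linear (@bs_coact k A L);
  bg_cop : linear (@bs_cop k A L);
  bg_eps : linear (@bs_eps k A L);
  bg_mulA : associative (@bs_mul k A L);
  bg_mul1x : left_id (bs_one L) (@bs_mul k A L);
  bg_mulx1 : right_id (bs_one L) (@bs_mul k A L);
  bg_deg1 : forall n, bs_deg n (bs_one L) = if n is 0%N then bs_one L else 0;
  bg_degM : forall n v x, bs_deg n (bs_mul (g v) x) =
    if n is m.+1 then bs_mul (g v) (bs_deg m x) else 0;
  bg_act1 : forall a, bs_act (bs_one L) a = heps a *: bs_one L;
  bg_actM : forall v x a, bs_act (bs_mul (g v) x) a =
    \sw_(a1, a2 <- hcp a) bs_mul (g (cact v a1)) (bs_act x a2);
  bg_coact1 : bs_coact (bs_one L) = bs_one L ⊗ 1;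
  bg_coactM : forall v x, bs_coact (bs_mul (g v) x) =
    \sw_(v0, v1 <- cco v) (\sw_(x0, x1 <- bs_coact x)
      bs_mul (g v0) x0 ⊗ (v1 * x1));
  bg_cop1 : bs_cop (bs_one L) = bs_one L ⊗ bs_one L;
  bg_copM : forall v x, bs_cop (bs_mul (g v) x) =
    \sw_(y, z <- bs_cop x) (bs_mul (g v) y ⊗ z +
      \sw_(y0, y1 <- bs_coact (parity_inv (@bs_deg k A L) y))
        y0 ⊗ bs_mul (g (cact v y1)) z);
  bg_eps1 : bs_eps (bs_one L) = 1;
  bg_epsM : forall v x, bs_eps (bs_mul (g v) x) = 0;
  bg_ind : forall P : L -> Prop,
    (forall c x y, P x -> P y -> P (c *: x + y)) -> P (bs_one L) ->
    (forall v x, P x -> P (bs_mul (g v) x)) -> forall x, P x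
}.

Ltac bsg t := match goal with h : bs_generated _ |- _ => refine (t _ _ _ _ _ h) end.
Ltac bsg1 t := match goal with h : bs_generated _ |- _ => refine (t _ _ _ _ _ h _) end.
#[global] Hint Extern 0 (GRing.linear_for _ (@bs_deg _ _ _ _)) => bsg1 @bg_deg : lin.
#[global] Hint Extern 0 (bilin (@bs_mul _ _ _)) => bsg @bg_mul : lin.
#[global] Hint Extern 0 (bilin (@bs_act _ _ _)) => bsg @bg_act : lin.
#[global] Hint Extern 0 (GRing.linear_for _ (@bs_coact _ _ _)) => bsg @bg_coact : lin.
#[global] Hint Extern 0 (GRing.linear_for _ (@bs_cop _ _ _)) => bsg @bg_cop : lin.
#[global] Hint Extern 0 (GRing.linear_for _ (@bs_eps _ _ _)) => bsg @bg_eps : lin.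
#[global] Hint Extern 1 (GRing.linear_for _ ?g) =>
  match goal with h : @bs_generated _ _ _ _ g |- _ => refine (bg_gen h) end : lin.

Ltac sw_rule_L :=
  match goal with h : bs_generated _ |- _ =>
    lazymatch goal with
    | |- bs_act (bs_mul _ _) _ = _ => refine (bg_actM h _ _ _)
    | |- bs_act (bs_one _) _ = _ => refine (bg_act1 h _)
    | |- bs_coact (bs_mul _ _) = _ => refine (bg_coactM h _ _)
    | |- bs_coact (bs_one _) = _ => refine (bg_coact1 h)
    | |- bs_cop (bs_mul _ _) = _ => refine (bg_copM h _ _)
    | |- bs_cop (bs_one _) = _ => refine (bg_cop1 h)
    end end.
Ltac sw_rule ::= first [sw_rule_A | sw_rule_V | sw_rule_L].

(** * Consequences of generation in degree one *)

Section Generated.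
Context {k : fieldType} {A : hopfAlgType k} {V : crossedModType A}.
Variables (L : bsHopfData A) (g : V -> L).
Hypothesis hL : bs_generated g.
Local Notation deg := (@bs_deg k A L).
Local Notation one := (bs_one L).
Local Notation mul := (@bs_mul k A L).
Local Notation sgn := (parity_inv deg).

Lemma bg_ext (U : lmodType k) (f h : L -> U) : linear f -> linear h ->
  f one = h one ->
  (forall v x, f x = h x -> f (mul (g v) x) = h (mul (g v) x)) ->
  forall x, f x = h x.
Proof.
by move=> hf hh h1 hM; apply: (bg_ind hL) => // c x y ex ey; rewrite hf hh ex ey.
Qed.

Lemma bg_grading : is_grading deg.
Proof.
split; first exact: bg_deg hL.
  move=> m n x; move: m n; elim/(bg_ind hL): x => [c x y hx hy|| v x hx] m n.
  - rewrite !(bg_deg hL) hx hy; case: eqP => //; by rewrite scaler0 addr0.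
  - rewrite (bg_deg1 hL); case: n => [|n]; first by rewrite (bg_deg1 hL); case: m.
    by rewrite (lin0 (bg_deg hL _)) if_same.
  - rewrite !(bg_degM hL); case: n => [|n]; first by rewrite (lin0 (bg_deg hL _)) if_same.
    rewrite (bg_degM hL); case: m => [//|m]; rewrite hx eqSS.
    by case: eqP => // _; rewrite (lin0 ((bg_mul hL).2 _)).
(* Asking for every [M] beyond [N] allows the bounds of two summands to be merged. *)
move=> x; suff [N hN] : exists N, forall M, (N <= M)%N -> x = \sum_(n < M) deg n x.
  by exists N; apply: hN.
elim/(bg_ind hL): x => [c x y [N hN] [M hM]||v x [N hN]].
- exists (maxn N M) => P; rewrite geq_max => /andP[h1 h2].
  rewrite {1}(hN _ h1) {1}(hM _ h2) scaler_sumr -big_split; apply: eq_bigr => n _.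
  by rewrite (bg_deg hL).
- exists 1%N => -[//|M] _; rewrite big_ord_recl big1 ?addr0 ?(bg_deg1 hL) // => i _.
  by rewrite (bg_deg1 hL).
exists N.+1 => -[//|M] hM; rewrite big_ord_recl /= (bg_degM hL) add0r.
rewrite {1}(hN M) // (linS _ _ _ ((bg_mul hL).2 _)); apply: eq_bigr => i _.
by rewrite (bg_degM hL).
Qed.

Lemma sgn_lin : linear sgn. Proof. exact: parity_inv_linear bg_grading. Qed.

Lemma sgn_one : sgn one = one.
Proof.
by have := parity_inv_deg bg_grading 0 one; rewrite (bg_deg1 hL) scale1r.
Qed.

Lemma sgnM v x : sgn (mul (g v) x) = - mul (g v) (sgn x).
Proof.
apply: (parity_inv_odd bg_grading (f := mul (g v))); first exact: (bg_mul hL).2.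
by move=> n y; rewrite (bg_degM hL).
Qed.
End Generated.
#[global] Hint Extern 0 (GRing.linear_for _ (parity_inv (@bs_deg _ _ _))) => bsg @sgn_lin : lin.

Section Generated.
Context {k : fieldType} {A : hopfAlgType k} {V : crossedModType A}.
Variables (L : bsHopfData A) (g : V -> L).
Hypothesis hL : bs_generated g.
Local Notation deg := (@bs_deg k A L).
Local Notation one := (bs_one L).
Local Notation mul := (@bs_mul k A L).
Local Notation sgn := (parity_inv deg).
Local Notation act := (@bs_act k A L).
Local Notation coact := (@bs_coact k A L).

Lemma bact_gen v a : act (g v) a = g (cact v a).
Proof.
rewrite -[g v](bg_mulx1 hL) (bg_actM hL).
under eq_sw => a1 a2 do rewrite (bg_act1 hL) (linZ _ _ ((bg_mul hL).2 _)) (bg_mulx1 hL).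
by rewrite (sw_hepsr (F := fun a => g (cact v a))).
Qed.

Lemma bact1 x : act x 1 = x.
Proof.
move: x; apply: (bg_ext hL) => //; first by rewrite (bg_act1 hL) heps1 scale1r.
move=> v x e; swl; by rewrite cact1 e.
Qed.

Lemma bcoact_sgn x : coact (sgn x) = \sw_(x0, x1 <- coact x) sgn x0 ⊗ x1.
Proof.
move: x; apply: (bg_ext hL) => //.
  by rewrite (sgn_one hL) (bg_coact1 hL) swE // (sgn_one hL).
move=> v x e; rewrite (sgnM hL) linN // (bg_coactM hL) e.
swl; swr; rewrite -sw_opp //.
apply: eq_sw => v0 v1; rewrite -sw_opp //; apply: eq_sw => x0 x1.
by rewrite (sgnM hL) tpureNl.
Qed.

(** The coaction of a product with a generator is the product of the coactions, so coassociativity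
    spreads from V to all of L by induction; multiplicativity of [hcp] matches the A-factors. *)
Lemma bcoact_assoc (U : lmodType k) (F : L -> A -> A -> U) x : trilin F ->
  \sw_(y, c <- bs_coact x) (\sw_(x0, x1 <- bs_coact y) F x0 x1 c) =
  \sw_(x0, c <- bs_coact x) (\sw_(c1, c2 <- hcp c) F x0 c1 c2).
Proof.
move=> hF; apply: sw_coassoc => // {F hF}.
move: x; apply: (bg_ext hL) => //; first by rewrite !(bg_coact1 hL, swE, hcp1) //.
move=> v x e.
have eF (U' : lmodType k) F : trilin F -> _ := sw_coassoc (U := U') (F := F) _ _ e.
swl; swr.
transitivity (\sw_(v', c <- cco v) \sw_(v0, v1 <- cco v') \sw_(y, d <- coact x)
    \sw_(x0, x1 <- coact y) mul (g v0) x0 ⊗ (v1 * x1 ⊗ (c * d))).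
  by apply: eq_sw => ? ?; exact: sw_swap.
rewrite cco_assoc //; apply: eq_sw => v0 c.
rewrite [RHS]sw_swap //; apply: eq_sw => c1 c2.
by rewrite eF.
Qed.
End Generated.

(** * The super-bosonisation A # L: algebra, coalgebra and their compatibility *)

Section BosonLinear.
Context {k : fieldType} {A : hopfAlgType k} {V : crossedModType A}.
Variables (L : bsHopfData A) (g : V -> L).
Hypothesis hL : bs_generated g.

Lemma boson_mul_def (x y : A ⊗ L) : boson_mul x y =
  \sw_(a, l <- x) (\sw_(b, m <- y) (\sw_(b1, b2 <- hcp b)
    (a * b1) ⊗ bs_mul (bs_act l b2) m)).
Proof. by []. Qed.

Lemma boson_cop_def (x : A ⊗ L) : boson_cop x =
  \sw_(a, l <- x) (\sw_(a1, a2 <- hcp a) (\sw_(l1, l2 <- bs_cop l)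
    (\sw_(l10, l11 <- bs_coact l1) (a1 ⊗ l10) ⊗ ((a2 * l11) ⊗ l2)))).
Proof. by []. Qed.

Lemma bilin_boson_mul : bilin (@boson_mul k A L).
Proof.
have h : bilin (fun x y : A ⊗ L => \sw_(a, l <- x) (\sw_(b, m <- y)
  (\sw_(b1, b2 <- hcp b) (a * b1) ⊗ bs_mul (bs_act l b2) m))) by [].
exact: h.
Qed.
Lemma lin_boson_cop : linear (@boson_cop k A L).
Proof. by move=> c x y; rewrite /boson_cop linearP. Qed.
Lemma lin_boson_deg : forall n, linear (@boson_deg k A L n).
Proof. by move=> n c x y; rewrite /boson_deg linearP. Qed.
Lemma lin_boson_eps : linear (@boson_eps k A L).
Proof. by move=> c x y; rewrite /boson_eps linearP. Qed.

Lemma boson_mulE a l b m : @boson_mul k A L (a ⊗ l) (b ⊗ m) =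
  \sw_(b1, b2 <- hcp b) (a * b1) ⊗ bs_mul (bs_act l b2) m.
Proof. by rewrite boson_mul_def swE // swE. Qed.

Lemma boson_copE a l : @boson_cop k A L (a ⊗ l) =
  \sw_(a1, a2 <- hcp a) (\sw_(l1, l2 <- bs_cop l)
    (\sw_(l10, l11 <- bs_coact l1) (a1 ⊗ l10) ⊗ ((a2 * l11) ⊗ l2))).
Proof. by rewrite boson_cop_def swE. Qed.

Lemma boson_degE n a l : @boson_deg k A L n (a ⊗ l) = a ⊗ bs_deg n l.
Proof. by rewrite /boson_deg swE. Qed.

Lemma boson_epsE a l : @boson_eps k A L (a ⊗ l) = heps a *: bs_eps l.
Proof. by rewrite /boson_eps swE. Qed.

Lemma boson_mul_base a b m :
  @boson_mul k A L (a ⊗ bs_one L) (b ⊗ m) = (a * b) ⊗ m.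
Proof.
rewrite boson_mulE.
under eq_sw => b1 b2 do rewrite (bg_act1 hL) (linZ _ _ ((bg_mul hL).1 _)) tpureZr (bg_mul1x hL).
by rewrite (sw_hepsr (F := fun b => (a * b) ⊗ m)).
Qed.

Lemma boson_mul_gen a v b m :
  @boson_mul k A L (a ⊗ g v) (b ⊗ m) =
  \sw_(b1, b2 <- hcp b) (a * b1) ⊗ bs_mul (g (cact v b2)) m.
Proof. by rewrite boson_mulE; apply: eq_sw => ? ?; rewrite (bact_gen hL). Qed.
End BosonLinear.
#[global] Hint Extern 0 (bilin (@boson_mul _ _ _)) => bsg @bilin_boson_mul : lin.
#[global] Hint Extern 0 (GRing.linear_for _ (@boson_cop _ _ _)) => refine (@lin_boson_cop _ _ _) : lin.
#[global] Hint Extern 0 (GRing.linear_for _ (@boson_deg _ _ _ _)) => refine (@lin_boson_deg _ _ _ _) : lin.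
#[global] Hint Extern 0 (GRing.linear_for _ (@boson_eps _ _ _)) => refine (@lin_boson_eps _ _ _) : lin.

Ltac sw_rule_B :=
  match goal with h : bs_generated _ |- _ =>
    lazymatch goal with
    | |- boson_mul (_ ⊗ bs_one _) (_ ⊗ _) = _ => refine (boson_mul_base h _ _ _)
    | |- boson_mul (_ ⊗ _) (_ ⊗ _) = _ =>
        first [refine (boson_mul_gen h _ _ _ _) | refine (boson_mulE h _ _ _ _)]
    | |- boson_cop (_ ⊗ _) = _ => refine (boson_copE h _ _)
    | |- boson_deg _ (_ ⊗ _) = _ => refine (boson_degE h _ _ _)
    | |- boson_eps (_ ⊗ _) = _ => refine (boson_epsE h _ _)
    end end.
Ltac sw_rule ::= first [sw_rule_A | sw_rule_V | sw_rule_L | sw_rule_B].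

Section Boson.
Context {k : fieldType} {A : hopfAlgType k} {V : crossedModType A}.
Variables (L : bsHopfData A) (g : V -> L).
Hypothesis hL : bs_generated g.
Local Notation O := (tens A L).
Local Notation one := (bs_one L).
Local Notation "x '·' y" := (@boson_mul k A L x y) (at level 40, left associativity).
Local Notation ia a := (a ⊗ one : O).
Local Notation iv v := ((1 : A) ⊗ g v : O).

(** Since a ⊗ l = (a ⊗ 1)(1 ⊗ l), iterated left multiplications by A and V reach everything.
    Associativity is not presupposed: [boson_mulA] is itself proved by this induction. *)
Lemma boson_ind (P : O -> Prop) :
  (forall c x y, P x -> P y -> P (c *: x + y)) -> P (1 ⊗ one) ->
  (forall a x, P x -> P (ia a · x)) -> (forall v x, P x -> P (iv v · x)) ->
  forall x, P x.
Proof.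
move=> hlin h1 ha hv.
have hl l : P (1 ⊗ l).
  elim/(bg_ind hL): l => [c x y hx hy||v x hx] //.
    by rewrite tpure_linear_r; apply: hlin.
  have := hv v _ hx; rewrite (boson_mul_gen hL) (_ : hcp 1 = 1 ⊗ 1); last exact: hcp1.
  by rewrite swE // mulr1 cact1.
have hal a l : P (a ⊗ l).
  by have := ha a _ (hl l); rewrite (boson_mul_base hL) mulr1.
exact: tens_ind.
Qed.

Lemma boson_ext (U : lmodType k) (f h : O -> U) : linear f -> linear h ->
  f (1 ⊗ one) = h (1 ⊗ one) ->
  (forall a x, f x = h x -> f (ia a · x) = h (ia a · x)) ->
  (forall v x, f x = h x -> f (iv v · x) = h (iv v · x)) ->
  forall x, f x = h x.
Proof.
by move=> hf hh h1 ha hv; apply: boson_ind => // c x y ex ey; rewrite hf hh ex ey.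
Qed.

Lemma boson_mul1x x : ia 1 · x = x.
Proof. by move: x; apply: sw_ext => // b m; rewrite (boson_mul_base hL) mul1r. Qed.

Lemma boson_mulx1 x : x · ia 1 = x.
Proof.
move: x; apply: sw_ext => // b m; swl.
by rewrite mulr1 (bact1 hL) (bg_mulx1 hL).
Qed.

Lemma base_mulA a x y : ia a · x · y = ia a · (x · y).
Proof.
move: x; apply: sw_ext => // b l; move: y; apply: sw_ext => // c m.
by swl; swr; apply: eq_sw => ? ?; rewrite mulrA.
Qed.

(** Crossing b and then c acts on v by a leg of b followed by a leg of c, whereas crossing the
    product acts by the leg of bc; [hcpM] and [cactM] identify the two. *)
Lemma gen_mulA v x y : iv v · x · y = iv v · (x · y).
Proof.
move: x; apply: sw_ext => // b l; move: y; apply: sw_ext => // c m.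
swl; swr; rewrite [RHS]sw_swap //; apply: eq_sw => b1 b2.
rewrite [RHS]hcp_assoc //; apply: eq_sw => c1 c'; apply: eq_sw => c2 c3.
by rewrite -(bg_mulA hL) cactM mulrA.
Qed.

End Boson.

Section Boson.
Context {k : fieldType} {A : hopfAlgType k} {V : crossedModType A}.
Variables (L : bsHopfData A) (g : V -> L).
Hypothesis hL : bs_generated g.
Local Notation O := (tens A L).
Local Notation one := (bs_one L).
Local Notation "x '·' y" := (@boson_mul k A L x y) (at level 40, left associativity).
Local Notation ia a := (a ⊗ one : O).
Local Notation iv v := ((1 : A) ⊗ g v : O).
Local Notation cop := (@boson_cop k A L).
Local Notation deg := (@boson_deg k A L).
Local Notation sgn := (parity_inv deg).

Lemma boson_mulA : associative (@boson_mul k A L).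
Proof.
elim/(boson_ind hL) => [c x x' h h'||a x h|v x h] y z.
- have hl := bilin_boson_mul hL; by rewrite !hl.1 h h'.
- by rewrite !(boson_mul1x hL).
- by rewrite !(base_mulA hL) h.
- by rewrite !(gen_mulA hL) h.
Qed.

Lemma boson_deg1 n : deg n (ia 1) = if n is 0%N then ia 1 else 0.
Proof. by rewrite (boson_degE hL) (bg_deg1 hL); case: n => // n; rewrite tpure0r. Qed.

Lemma boson_deg_base n a x : deg n (ia a · x) = ia a · deg n x.
Proof. by move: x; apply: sw_ext => // b m; swl; swr. Qed.

Lemma boson_deg_gen n v x :
  deg n (iv v · x) = if n is m.+1 then iv v · deg m x else 0.
Proof.
case: n => [|n].
  move: x; apply: sw_ext => // b m; swl; apply: sw_eq0 => *.
  by rewrite (bg_degM hL) tpure0r.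
move: x; apply: sw_ext => // b m; swl; swr; apply: eq_sw => *.
by rewrite (bg_degM hL).
Qed.

Lemma boson_grading : is_grading deg.
Proof.
have hgr := bg_grading hL.
split; first exact: lin_boson_deg.
  move=> m n; apply: sw_ext => [//||a l]; first by case: eqP.
  rewrite !(boson_degE hL) (degK hgr); case: eqP => // _; exact: tpure0r.
move=> x; suff [N hN] : exists N, forall M, (N <= M)%N -> x = \sum_(n < M) deg n x.
  by exists N; apply: hN.
move: x; apply: tens_ind => [c x y [N hN] [M hM]|a l].
  exists (maxn N M) => P; rewrite geq_max => /andP[h1 h2].
  rewrite {1}(hN _ h1) {1}(hM _ h2) scaler_sumr -big_split; apply: eq_bigr => n _.
  by rewrite (@lin_boson_deg _ _ L).
have [N hN] := deg_fin hgr l; exists N => M hM.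
rewrite {1}(deg_sum hgr (x := l) (N := M)) => [|n hn]; last by apply: hN; apply: leq_trans hn.
rewrite (linS _ _ _ (tpure_linear_r a)); apply: eq_bigr => i _.
by rewrite (boson_degE hL).
Qed.

Lemma boson_degM m n x y : deg (m + n) (deg m x · deg n y) = deg m x · deg n y.
Proof.
elim/(boson_ind hL): x m n y => [c x x' h h'||a x h|v x h] m n y.
- by rewrite (@lin_boson_deg _ _ L) (bilin_boson_mul hL).1 (@lin_boson_deg _ _ L) h h'.
- rewrite boson_deg1; case: m => [|m]; first by rewrite (boson_mul1x hL) (degK boson_grading) eqxx.
  by rewrite (lin0 ((bilin_boson_mul hL).1 _)) (lin0 (@lin_boson_deg _ _ L _)).
- by rewrite boson_deg_base !(base_mulA hL) boson_deg_base h.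
rewrite boson_deg_gen; case: m => [|m].
  by rewrite (lin0 ((bilin_boson_mul hL).1 _)) (lin0 (@lin_boson_deg _ _ L _)).
by rewrite !(gen_mulA hL) addSn boson_deg_gen h.
Qed.

Lemma lin_boson_sgn : linear sgn. Proof. exact: parity_inv_linear boson_grading. Qed.

Lemma boson_sgn1 : sgn (ia 1) = ia 1.
Proof.
by have := parity_inv_deg boson_grading 0 (ia 1); rewrite boson_deg1 scale1r.
Qed.

Lemma boson_sgn_base a x : sgn (ia a · x) = ia a · sgn x.
Proof.
apply: (parity_inv_even boson_grading (f := @boson_mul k A L (ia a))).
  exact: (bilin_boson_mul hL).2.
by move=> n y; rewrite boson_deg_base.
Qed.

Lemma boson_sgn_gen v x : sgn (iv v · x) = - (iv v · sgn x).
Proof.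
apply: (parity_inv_odd boson_grading (f := @boson_mul k A L (iv v))).
  exact: (bilin_boson_mul hL).2.
by move=> n y; rewrite boson_deg_gen.
Qed.

Lemma boson_sgnE a l : sgn (a ⊗ l) = a ⊗ parity_inv (@bs_deg k A L) l.
Proof.
have hl := lin_boson_sgn; have hg := bg_grading hL.
move: l; apply: (deg_ext hg) => // n l.
rewrite parity_inv_deg // -(boson_degE hL) (parity_inv_deg boson_grading).
by rewrite (boson_degE hL) tpureZr.
Qed.

Lemma boson_sgnM x y : sgn (x · y) = sgn x · sgn y.
Proof.
have hl := lin_boson_sgn; move: x; apply: (boson_ext hL) => //.
- by rewrite boson_sgn1 !(boson_mul1x hL).
- by move=> a x h; rewrite (base_mulA hL) !boson_sgn_base (base_mulA hL) h.
- move=> v x h; rewrite (gen_mulA hL) !boson_sgn_gen h.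
  by rewrite (linN _ ((bilin_boson_mul hL).1 _)) (gen_mulA hL).
Qed.

Lemma boson_cop1 : cop (ia 1) = ia 1 ⊗ ia 1.
Proof. by swl; rewrite mulr1. Qed.

Lemma boson_cop_base a x : cop (ia a · x) =
  \sw_(a1, a2 <- hcp a) (\sw_(x1, x2 <- cop x) (ia a1 · x1) ⊗ (ia a2 · x2)).
Proof.
move: x; apply: sw_ext => // b m; swl; swr.
by do 4!apply: eq_sw => ? ?; rewrite mulrA.
Qed.
End Boson.
#[global] Hint Extern 0 (GRing.linear_for _ (parity_inv (@boson_deg _ _ _))) => bsg @lin_boson_sgn : lin.

Ltac sw_rule_sgn :=
  match goal with h : bs_generated _ |- _ =>
    lazymatch goal with
    | |- parity_inv (@boson_deg _ _ _) (_ ⊗ _) = _ => refine (boson_sgnE h _ _)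
    | |- bs_coact (parity_inv (@bs_deg _ _ _) _) = _ => refine (bcoact_sgn h _)
    end end.
Ltac sw_rule ::= first [sw_rule_A | sw_rule_L | sw_rule_B | sw_rule_sgn].

Section Boson.
Context {k : fieldType} {A : hopfAlgType k} {V : crossedModType A}.
Variables (L : bsHopfData A) (g : V -> L).
Hypothesis hL : bs_generated g.
Local Notation O := (tens A L).
Local Notation one := (bs_one L).
Local Notation "x '·' y" := (@boson_mul k A L x y) (at level 40, left associativity).
Local Notation ia a := (a ⊗ one : O).
Local Notation iv v := ((1 : A) ⊗ g v : O).
Local Notation cop := (@boson_cop k A L).
Local Notation deg := (@boson_deg k A L).
Local Notation sgn := (parity_inv deg).

(** This is Δ(v)Δ(x) with Δ(v) = v_0 ⊗ v_1 + 1 ⊗ v. The crossed module compatibility settles the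
    first half, and coassociativity of the coaction of L the second. *)
Lemma boson_cop_gen v x : cop (iv v · x) =
  \sw_(x1, x2 <- cop x) (\sw_(v0, v1 <- cco v) (iv v0 · x1) ⊗ (ia v1 · x2)) +
  \sw_(x1, x2 <- cop x) sgn x1 ⊗ (iv v · x2).
Proof.
move: x; apply: sw_ext => // b m; swl; swr.
congr +%R.
  transitivity (\sw_(b', b3 <- hcp b) \sw_(b1, b2 <- hcp b') \sw_(w0, w1 <- cco (cact v b3))
      \sw_(m1, m2 <- bs_cop m) \sw_(n0, n1 <- bs_coact m1)
         (b1 ⊗ bs_mul (g w0) n0) ⊗ ((b2 * w1 * n1) ⊗ m2)).
    apply: eq_sw => ? ?; apply: eq_sw => ? ?; rewrite sw_swap //.
    by do 3!apply: eq_sw => ? ?; rewrite !mul1r mulrA.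
  rewrite hcp_assoc //.
  (* Crossing b replaces v by v ◁ b_3, whose coaction is traded for that of v. *)
  under eq_sw => b1 b2 do rewrite (yetter_drinfeld (F := fun w0 b => \sw_(m1, m2 <- bs_cop m)
     \sw_(n0, n1 <- bs_coact m1) (b1 ⊗ bs_mul (g w0) n0) ⊗ ((b * n1) ⊗ m2))) //.
  rewrite [LHS]sw_swap //; transitivity (\sw_(v0, v1 <- cco v) \sw_(c, b3 <- hcp b)
      \sw_(b1, b2 <- hcp c) \sw_(m1, m2 <- bs_cop m) \sw_(n0, n1 <- bs_coact m1)
      (b1 ⊗ bs_mul (g (cact v0 b2)) n0) ⊗ ((v1 * b3 * n1) ⊗ m2)).
    by apply: eq_sw => v0 v1; rewrite [RHS]hcp_assoc.
  rewrite [LHS]sw_swap //; apply: eq_sw => c b3; symmetry.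
  under eq_sw => m1 m2 do rewrite sw_swap //.
  rewrite sw_swap //; apply: eq_sw => v0 v1.
  under eq_sw => m1 m2 do rewrite sw_swap //.
  rewrite sw_swap //; do 3!apply: eq_sw => ? ?.
  by rewrite mul1r mulrA.
(* In the half 1 ⊗ v, the braiding of v past [m1] has to become the action produced when v crosses
   the factor b_2 m_11 of A. Splitting that factor calls for coassociativity of the coaction on
   [m1]. *)
rewrite hcp_assoc //; apply: eq_sw => b1 b'.
rewrite sw_swap //; apply: eq_sw => m1 m2.
under eq_sw => b2 b3 do rewrite (bcoact_assoc hL) //.
rewrite sw_swap //; do 3!apply: eq_sw => ? ?.
by rewrite !mul1r cactM.
Qed.
End Boson.

Ltac sw_rule_BG :=
  match goal with h : bs_generated _ |- _ =>
    lazymatch goal with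
    | |- boson_cop (boson_mul (_ ⊗ bs_one _) _) = _ => refine (boson_cop_base h _ _)
    | |- boson_cop (boson_mul (1 ⊗ _) _) = _ => refine (boson_cop_gen h _ _)
    | |- parity_inv (@boson_deg _ _ _) (boson_mul (_ ⊗ bs_one _) _) = _ =>
        refine (boson_sgn_base h _ _)
    | |- parity_inv (@boson_deg _ _ _) (boson_mul (1 ⊗ _) _) = _ => refine (boson_sgn_gen h _ _)
    end end.
Ltac sw_rule ::= first [sw_rule_A | sw_rule_BG].

Section Boson.
Context {k : fieldType} {A : hopfAlgType k} {V : crossedModType A}.
Variables (L : bsHopfData A) (g : V -> L).
Hypothesis hL : bs_generated g.
Local Notation O := (tens A L).
Local Notation one := (bs_one L).
Local Notation "x '·' y" := (@boson_mul k A L x y) (at level 40, left associativity).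
Local Notation ia a := (a ⊗ one : O).
Local Notation iv v := ((1 : A) ⊗ g v : O).
Local Notation cop := (@boson_cop k A L).
Local Notation deg := (@boson_deg k A L).
Local Notation eps := (@boson_eps k A L).
Local Notation sgn := (parity_inv deg).

Lemma boson_cop_sgn x : cop (sgn x) = \sw_(x1, x2 <- cop x) sgn x1 ⊗ sgn x2.
Proof.
move: x; apply: (boson_ext hL) => //.
- by rewrite (boson_sgn1 hL) (boson_cop1 hL) swE // (boson_sgn1 hL).
- move=> a x h; rewrite (boson_sgn_base hL) (boson_cop_base hL) h; swl; swr.
  by [].
move=> v x h; rewrite (boson_sgn_gen hL) linN // (boson_cop_gen hL) h; swl; swr.
by rewrite opprD.
Qed.

Lemma boson_copA x :
  \sw_(y, z <- cop x) (\sw_(y1, y2 <- cop y) y1 ⊗ (y2 ⊗ z)) =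
  \sw_(y, z <- cop x) y ⊗ cop z.
Proof.
move: x; apply: (boson_ext hL) => //.
- by rewrite (boson_cop1 hL) !swE // (boson_cop1 hL) !swE.
- move=> a x h; have hF U' F : trilin F -> _ := sw_coassoc (U := U') (F := F) _ _ h.
  swl; swr; under eq_sw => ? ? do rewrite sw_swap //.
  rewrite hcp_assoc //; apply: eq_sw => a1 a'; rewrite [RHS]sw_swap //.
  by apply: eq_sw => ? ?; rewrite hF.
move=> v x h; have hF U' F : trilin F -> _ := sw_coassoc (U := U') (F := F) _ _ h.
(* The three summands have the generator in the first, second and third tensor factor
   respectively. *)
swl; swr; rewrite -addrA; congr (_ + (_ + _)).
- under eq_sw => ? ? do (rewrite sw_swap //; under eq_sw => ? ? do rewrite cco_assoc //).
  rewrite hF //; apply: eq_sw => ? ?; rewrite sw_swap //.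
  by apply: eq_sw => ? ?; rewrite sw_swap.
- under eq_sw => ? ? do rewrite sw_swap //.
  by rewrite hF.
- under eq_sw => ? ? do rewrite boson_cop_sgn sw_sw //.
  rewrite -hF //; do 2!(apply: eq_sw => ? ?).
  by rewrite swE.
Qed.

Lemma scaler_regular (U : lmodType k) (a : k) (b : k^o) (u : U) : (a *: b) *: u = a *: (b *: u).
Proof. by rewrite scalerA. Qed.

Lemma boson_eps1 : eps (ia 1) = 1.
Proof. by rewrite (boson_epsE hL) heps1 (bg_eps1 hL) scale1r. Qed.

Lemma boson_eps_base a x : eps (ia a · x) = heps a *: eps x.
Proof.
move: x; apply: sw_ext => // b m.
by rewrite (boson_mul_base hL) !(boson_epsE hL) hepsM scalerA.
Qed.

Lemma boson_eps_gen v x : eps (iv v · x) = 0.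
Proof.
move: x; apply: sw_ext => // b m; rewrite (boson_mul_gen hL) (sw_push (f := eps)) //.
by apply: sw_eq0 => *; rewrite (boson_epsE hL) (bg_epsM hL) scaler0.
Qed.

Lemma boson_eps_sgn x : eps (sgn x) = eps x.
Proof.
move: x; apply: (boson_ext hL) => //.
- by rewrite (boson_sgn1 hL).
- by move=> a x h; rewrite (boson_sgn_base hL) !boson_eps_base h.
by move=> v x h; rewrite (boson_sgn_gen hL) linN // !boson_eps_gen oppr0.
Qed.

Lemma boson_hepsl (a : A) (x : O) : \sw_(a1, a2 <- hcp a) heps a1 *: (ia a2 · x) = ia a · x.
Proof. by rewrite (sw_hepsl (F := fun a => ia a · x)). Qed.

Lemma boson_counitl x : \sw_(y, z <- cop x) eps y *: z = x.
Proof.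
move: x; apply: (boson_ext hL) => //.
- by rewrite (boson_cop1 hL) swE // boson_eps1 scale1r.
- move=> a x h; swl.
  transitivity (\sw_(a1, a2 <- hcp a) heps a1 *: (ia a2 · \sw_(y, z <- cop x) eps y *: z)).
    apply: eq_sw => a1 a2; rewrite (sw_opr (op := @boson_mul k A L)) // -sw_scale //.
    apply: eq_sw => y z; rewrite boson_eps_base scaler_regular.
    by rewrite (linZ _ _ ((bilin_boson_mul hL).2 _)).
  by rewrite h boson_hepsl.
move=> v x h; swl; rewrite [X in X + _]sw_eq0 => [|y z]; last first.
  by apply: sw_eq0 => *; rewrite boson_eps_gen scale0r.
rewrite add0r -[in RHS]h (sw_opr (op := @boson_mul k A L)) //.
apply: eq_sw => y z; rewrite boson_eps_sgn.
by rewrite (linZ _ _ ((bilin_boson_mul hL).2 _)).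
Qed.

Lemma boson_counitr x : \sw_(y, z <- cop x) eps z *: y = x.
Proof.
have hm := bilin_boson_mul hL.
move: x; apply: (boson_ext hL) => //.
- by rewrite (boson_cop1 hL) swE // boson_eps1 scale1r.
- move=> a x h; swl.
  transitivity (\sw_(a1, a2 <- hcp a) heps a2 *: (ia a1 · \sw_(y, z <- cop x) eps z *: y)).
    apply: eq_sw => a1 a2; rewrite (sw_opr (op := @boson_mul k A L)) // -sw_scale //.
    apply: eq_sw => y z; rewrite boson_eps_base scaler_regular.
    by rewrite (linZ _ _ (hm.2 _)).
  by rewrite h (sw_hepsr (F := fun a => ia a · x)).
move=> v x h; swl; rewrite [X in _ + X]sw_eq0 => [|y z]; last first.
  by rewrite boson_eps_gen scale0r.
rewrite addr0 -[in RHS]h (sw_opr (op := @boson_mul k A L)) //.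
apply: eq_sw => y z; rewrite (linZ _ _ (hm.2 _)).
rewrite -(sw_ceps (F := fun v => iv v · y)) // -sw_scale //.
apply: eq_sw => v0 v1; rewrite boson_eps_base scaler_regular !scalerA.
by rewrite mulrC.
Qed.

Lemma boson_cop_deg n x : cop (deg n x) =
  \sum_(i < n.+1) \sw_(y, z <- cop x) deg i y ⊗ deg (n - i)%N z.
Proof.
elim/(boson_ind hL): x n => [c x x' h h'||a x h|v x h] n.
- rewrite (@lin_boson_deg _ _ L) !(@lin_boson_cop _ _ L) h h' scaler_sumr -big_split.
  by apply: eq_bigr => i _; rewrite linearP.
- rewrite (boson_deg1 hL) (boson_cop1 hL); case: n => [|n].
    by rewrite big_ord1 (boson_cop1 hL) swE // !(boson_deg1 hL).
  rewrite lin0 // big1 // => i _; rewrite swE // !(boson_deg1 hL).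
  case: (nat_of_ord i) => [|j]; last by rewrite tpure0l.
  by rewrite subn0 tpure0r.
- rewrite (boson_deg_base hL) !(boson_cop_base hL) h.
  transitivity (\sum_(i < n.+1) \sw_(a1, a2 <- hcp a) \sw_(x1, x2 <-
      \sw_(y, z <- cop x) deg i y ⊗ deg (n - i)%N z) (ia a1 · x1) ⊗ (ia a2 · x2)).
    by rewrite -[RHS]sw_sum //; apply: eq_sw => a1 a2; rewrite sw_arg_sum.
  apply: eq_bigr => i _; swl; swr.
  by do 2!apply: eq_sw => ? ?; rewrite !(boson_deg_base hL).
rewrite (boson_deg_gen hL); case: n => [|n].
  rewrite lin0 // big_ord1; swr; rewrite !sw_eq0 ?addr0 // => y z.
    by rewrite !(boson_deg_gen hL) tpure0r.
  by apply: sw_eq0 => *; rewrite !(boson_deg_gen hL) tpure0l.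
rewrite !(boson_cop_gen hL) h.
transitivity (\sum_(i < n.+1) \sw_(y, z <- cop x) \sw_(v0, v1 <- cco v)
    (iv v0 · deg i y) ⊗ (ia v1 · deg (n - i)%N z) +
  \sum_(i < n.+1) \sw_(y, z <- cop x) sgn (deg i y) ⊗ (iv v · deg (n - i)%N z)).
  rewrite !sw_arg_sum; congr +%R; apply: eq_bigr => i _; by swl.
under [RHS]eq_bigr => i _ do rewrite sw_argD.
(* In the first sum the generator raises the degree of the left factor, so the term of index 0
   vanishes and the index shifts. In the second it raises the right factor, so the last term
   vanishes. *)
rewrite big_split /=; congr +%R.
  rewrite [RHS]big_ord_recl [X in _ = X + _]sw_sw //= [X in _ = X + _]sw_eq0 => [|y z]; last first.
    rewrite sw_sw //; apply: sw_eq0 => *; rewrite swE //.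
    by rewrite (boson_deg_gen hL) tpure0l.
  rewrite add0r; apply: eq_bigr => i _; swr; do 2!apply: eq_sw => ? ?.
  by rewrite (boson_deg_gen hL) (boson_deg_base hL) subSS.
rewrite [RHS]big_ord_recr /= [X in _ = _ + X]sw_sw // [X in _ = _ + X]sw_eq0 => [|y z]; last first.
  by rewrite swE // subnn (boson_deg_gen hL) tpure0r.
rewrite addr0; apply: eq_bigr => i _; swr; apply: eq_sw => ? ?.
by rewrite (boson_deg_gen hL) (deg_parity_inv (boson_grading hL)) subSn // -ltnS.
Qed.
End Boson.

Section Boson.
Context {k : fieldType} {A : hopfAlgType k} {V : crossedModType A}.
Variables (L : bsHopfData A) (g : V -> L).
Hypothesis hL : bs_generated g.
Local Notation O := (tens A L).
Local Notation one := (bs_one L).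
Local Notation "x '·' y" := (@boson_mul k A L x y) (at level 40, left associativity).
Local Notation ia a := (a ⊗ one : O).
Local Notation iv v := ((1 : A) ⊗ g v : O).
Local Notation cop := (@boson_cop k A L).
Local Notation deg := (@boson_deg k A L).
Local Notation eps := (@boson_eps k A L).
Local Notation pp := (parity_part deg).
Local Notation sgn := (parity_inv deg).

Lemma lin_boson_parity b : linear (pp b).
Proof. by have h := boson_grading hL; exact: (parity_part_linear h). Qed.
Hint Resolve lin_boson_parity : lin.

Local Notation tm := (@super_tmul k (bosonisation L)).

Lemma bilin_super_tmul : bilin tm.
Proof. by rewrite /super_tmul. Qed.

(** Grouping the four signed terms by the parity of z leaves the sum of the two parts of y when z is
    even and their difference, which is [sgn y], when z is odd. *)
Lemma super_tmulE x y z w : tm (x ⊗ y) (z ⊗ w) =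
  (x · pp false z) ⊗ (y · w) + (x · pp true z) ⊗ (sgn y · w).
Proof.
rewrite /super_tmul swE // swE //.
have hm := bilin_boson_mul hL.
rewrite !big_bool /= !expr0 !scale1r !expr1 !scaleN1r.
have -> : y · w = pp false y · w + pp true y · w.
  by rewrite -(linD _ _ (hm.1 w)) (parity_partD (boson_grading hL)).
have -> : sgn y · w = pp false y · w - pp true y · w.
  by rewrite -(linB _ _ (hm.1 w)).
rewrite !tpureDr !tpureNr addrC (addrC (- _)) addrACA (addrC (_ ⊗ _) (_ ⊗ _)).
by rewrite addrACA [X in X + _ = _]addrC.
Qed.

Lemma boson_copM x y : cop (x · y) = tm (cop x) (cop y).
Proof.
have ht := bilin_super_tmul; have hm := bilin_boson_mul hL.
have gr := boson_grading hL; have hp := lin_boson_parity.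
(* [LA], [LV] and [LS] state that the three left multiplications occurring in the recursion for
   [cop] commute with right multiplication by [q]. Multiplicativity then follows by induction on
   x. *)
have LA a : forall p q, tm (\sw_(x1, x2 <- p) (ia a.1 · x1) ⊗ (ia a.2 · x2)) q =
    \sw_(x1, x2 <- tm p q) (ia a.1 · x1) ⊗ (ia a.2 · x2).
  move=> p q; move: p; apply: sw_ext => // x1 x2; move: q; apply: sw_ext => // z w.
  rewrite swE // !super_tmulE sw_argD !swE //.
  by rewrite !(base_mulA hL) (boson_sgn_base hL) (base_mulA hL).
have LV u a : forall p q, tm (\sw_(x1, x2 <- p) (iv u · x1) ⊗ (ia a · x2)) q =
    \sw_(x1, x2 <- tm p q) (iv u · x1) ⊗ (ia a · x2).
  move=> p q; move: p; apply: sw_ext => // x1 x2; move: q; apply: sw_ext => // z w.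
  rewrite swE // !super_tmulE sw_argD !swE //.
  by rewrite !(base_mulA hL) !(gen_mulA hL) (boson_sgn_base hL) (base_mulA hL).
have LS u : forall p q, tm (\sw_(x1, x2 <- p) sgn x1 ⊗ (iv u · x2)) q =
    \sw_(x1, x2 <- tm p q) sgn x1 ⊗ (iv u · x2).
  move=> p q; move: p; apply: sw_ext => // x1 x2; move: q; apply: sw_ext => // z w.
  rewrite swE // !super_tmulE sw_argD !swE //.
  (* The sign of [iv u] passing the odd part of z is exactly the one that [sgn] puts on that
     part. *)
  rewrite (boson_sgn_gen hL) !(boson_sgnM hL) !parity_inv_part //= expr0 expr1 scale1r scaleN1r.
  rewrite (linN _ (hm.1 _)) (linN _ (hm.2 _)) tpureNl tpureNr.
  by rewrite !(gen_mulA hL).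
move: x; apply: (boson_ext hL) => //.
- rewrite (boson_mul1x hL) (boson_cop1 hL); move: (cop y); apply: sw_ext => // z w.
  rewrite super_tmulE !(boson_mul1x hL) (boson_sgn1 hL) !(boson_mul1x hL).
  by rewrite -tpureDl parity_partD.
- move=> a x h; rewrite (base_mulA hL) !(boson_cop_base hL) h.
  rewrite [RHS](sw_opl (op := tm)) //; apply: eq_sw => a1 a2; by rewrite (LA (a1, a2)).
move=> v x h; rewrite (gen_mulA hL) !(boson_cop_gen hL) h (linD _ _ (ht.1 _)) -LS.
congr +%R.
have -> : \sw_(x1, x2 <- cop x) \sw_(v0, v1 <- cco v) (iv v0 · x1) ⊗ (ia v1 · x2) =
    \sw_(v0, v1 <- cco v) \sw_(x1, x2 <- cop x) (iv v0 · x1) ⊗ (ia v1 · x2).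
  by rewrite sw_swap.
rewrite sw_swap // [RHS](sw_opl (op := tm)) //.
by apply: eq_sw => v0 v1; rewrite LV.
Qed.

Lemma boson_epsM x y : eps (x · y) = eps x * eps y.
Proof.
elim/(boson_ind hL): x => [c x x' h h'||a x h|v x h].
- by rewrite (bilin_boson_mul hL).1 !(@lin_boson_eps _ _ L) h h' mulrDl scalerAl.
- by rewrite (boson_mul1x hL) (boson_eps1 hL) mul1r.
- by rewrite (base_mulA hL) !(boson_eps_base hL) h scalerAl.
by rewrite (gen_mulA hL) !(boson_eps_gen hL) mul0r.
Qed.
End Boson.

(** * Convolution inverses on a graded bialgebra *)

Section Convolution.
Context {k : fieldType} {H : lmodType k}.
Variables (deg : nat -> H -> H) (one : H) (mul : H -> H -> H) (cop : H -> H ⊗ H)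
  (eps : H -> k^o).
Hypotheses (hdeg : is_grading deg) (hmul : bilin mul) (hmulA : associative mul)
  (hmul1 : left_id one mul) (hmulr1 : right_id one mul).
Hypotheses (hcop : linear cop) (heps : linear eps)
  (hcopA : forall x, \sw_(y, z <- cop x) (\sw_(y1, y2 <- cop y) y1 ⊗ (y2 ⊗ z)) =
                \sw_(y, z <- cop x) y ⊗ cop z)
  (hcounitl : forall x, \sw_(y, z <- cop x) eps y *: z = x)
  (hcounitr : forall x, \sw_(y, z <- cop x) eps z *: y = x)
  (hcopdeg : forall n x, cop (deg n x) =
     \sum_(i < n.+1) \sw_(y, z <- cop x) deg i y ⊗ deg (n - i)%N z)
  (hepsdeg : forall n x, eps (deg n.+1 x) = 0)
  (hdeg1 : deg 0%N one = one)
  (hmuldeg : forall m n x y, deg (m + n)%N (mul (deg m x) (deg n y)) =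
                   mul (deg m x) (deg n y)).
Implicit Types f g h : H -> H.
Let hd := deg_linear hdeg.

Definition conv f g x := \sw_(y, z <- cop x) mul (f y) (g z).
Definition conv1 x := eps x *: one.

Lemma conv_linear f g : linear (conv f g).
Proof. by rewrite /conv. Qed.
Lemma conv1_linear : linear conv1.
Proof. by rewrite /conv1. Qed.
Hint Resolve conv_linear conv1_linear : lin.

Lemma conv1f f : linear f -> forall x, conv conv1 f x = f x.
Proof.
move=> hf x; rewrite -[in RHS](hcounitl x) (sw_push (f := f)) //.
apply: eq_sw => y z; rewrite /conv1 (linZ _ _ (hmul.1 _)) hmul1.
by rewrite [RHS]linZ.
Qed.

Lemma convf1 f : linear f -> forall x, conv f conv1 x = f x.
Proof.
move=> hf x; rewrite -[in RHS](hcounitr x) (sw_push (f := f)) //.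
apply: eq_sw => y z; rewrite /conv1 (linZ _ _ (hmul.2 _)) hmulr1.
by rewrite [RHS]linZ.
Qed.

Lemma convA f g h : linear f -> linear g -> linear h ->
  forall x, conv (conv f g) h x = conv f (conv g h) x.
Proof.
move=> hf hg hh x; rewrite /conv.
transitivity (\sw_(y, z <- cop x) \sw_(y1, y2 <- cop y) mul (f y1) (mul (g y2) (h z))).
  apply: eq_sw => y z; rewrite (sw_opl (op := mul)) //; apply: eq_sw => *.
  by rewrite hmulA.
rewrite (sw_coassoc (F := fun y1 y2 z => mul (f y1) (mul (g y2) (h z))) hcop hcop (hcopA x)) //.
by apply: eq_sw => y z; rewrite (sw_opr (op := mul)).
Qed.

Lemma eq_conv f f' g g' : (forall x, f x = f' x) -> (forall x, g x = g' x) ->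
  forall x, conv f g x = conv f' g' x.
Proof. by move=> hf hg x; apply: eq_sw => y z; rewrite hf hg. Qed.

Lemma conv_deg f g n x : linear f -> linear g -> conv f g (deg n x) =
  \sum_(i < n.+1) \sw_(y, z <- cop x) mul (f (deg i y)) (g (deg (n - i)%N z)).
Proof.
move=> hf hg; rewrite /conv hcopdeg sw_arg_sum; apply: eq_bigr => i _.
by rewrite sw_sw //; apply: eq_sw => y z; rewrite swE.
Qed.

Definition deg_preserving f := forall n x, deg n (f (deg n x)) = f (deg n x).

Lemma conv_preserving f g : linear f -> linear g ->
  deg_preserving f -> deg_preserving g -> deg_preserving (conv f g).
Proof.
move=> hf hg pf pg n x; rewrite conv_deg // linS //; apply: eq_bigr => i _.
rewrite (sw_push (f := deg n)) //; apply: eq_sw => y z.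
rewrite -pf -pg; have e : (i + (n - i) = n)%N by rewrite subnKC // -ltnS.
by rewrite -{1}e hmuldeg.
Qed.

Lemma conv1_preserving : deg_preserving conv1.
Proof.
move=> [|n] x; first by rewrite /conv1 linZ // hdeg1.
by rewrite /conv1 hepsdeg scale0r lin0.
Qed.

Section Inverse.
Variable f : H -> H.
Hypotheses (hf : linear f) (pf : deg_preserving f)
  (f0 : forall x, f (deg 0%N x) = conv1 (deg 0%N x)).
Let p x := conv1 x - f x.
Let hp : linear p. Proof. by rewrite /p. Qed.
Let pw n := iter n (conv p) conv1.
Let hpw n : linear (pw n). Proof. by case: n => [|n]; rewrite /pw /=. Qed.

(** [p] vanishes in degree 0, so each of the n convolution factors must consume at least one
    degree. *)
Let pw_small n m x : (m < n)%N -> pw n (deg m x) = 0.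
Proof.
elim: n m x => [//|n IH] m x hm; rewrite /pw iterS -/(pw n) conv_deg //.
rewrite big_ord_recl /= sw_eq0 ?add0r => [|y z]; last first.
  by rewrite /p f0 subrr (lin0 (hmul.1 _)).
apply: big1 => i _; apply: sw_eq0 => y z.
rewrite IH ?(lin0 (hmul.2 _)) //.
case: m hm i => [_ []//|m hm i].
by rewrite /bump /= add1n subSS; exact: leq_ltn_trans (leq_subr _ _) (hm : (m < n)%N).
Qed.

Let pwSr n x : pw n.+1 x = conv (pw n) p x.
Proof.
elim: n x => [|n IH] x; first by rewrite /pw /= conv1f // convf1.
rewrite {1}/pw iterS -/(pw n.+1) (eq_conv (f' := p) (g' := conv (pw n) p)) //.
by rewrite -convA.
Qed.

Let G n x := \sum_(j < n) pw j x.
Let hG n : linear (G n).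
Proof. by apply: lin_sum => j; exact: hpw. Qed.

Let G_deg n M x : (n < M)%N -> G M (deg n x) = G n.+1 (deg n x).
Proof.
move=> hn; rewrite /G -!(big_mkord xpredT (fun j => pw j (deg n x))).
rewrite (big_cat_nat (leq0n n.+1) hn) /= [X in _ + X]big_nat [X in _ + X]big1 ?addr0 //.
by move=> j /andP[hj _]; rewrite pw_small.
Qed.

Let fE x : f x = conv1 x - p x.
Proof. by rewrite /p opprB addrC subrK. Qed.

Let conv_Gf n x : conv (G n) f x = conv1 x - pw n x.
Proof.
transitivity (\sum_(j < n) (pw j x - pw j.+1 x)).
  transitivity (\sum_(j < n) conv (pw j) f x).
    rewrite /conv -sw_sum //; apply: eq_sw => y z.
    by rewrite (linS _ _ _ (hmul.1 _)).
  apply: eq_bigr => j _; rewrite -[in RHS](convf1 (f := pw j)) // pwSr /conv -sw_opp // -sw_add //.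
  by apply: eq_sw => y z; rewrite fE (linB _ _ (hmul.2 _)).
by elim: n => [|n IH]; rewrite ?big_ord0 ?big_ord_recr /= ?subrr // IH addrA subrK.
Qed.

Let conv_fG n x : conv f (G n) x = conv1 x - pw n x.
Proof.
transitivity (\sum_(j < n) (pw j x - pw j.+1 x)).
  transitivity (\sum_(j < n) conv f (pw j) x).
    rewrite /conv -sw_sum //; apply: eq_sw => y z.
    by rewrite (linS _ _ _ (hmul.2 _)).
  apply: eq_bigr => j _; rewrite -[in RHS](conv1f (f := pw j)) // /pw iterS -/(pw j) /conv -sw_opp // -sw_add //.
  by apply: eq_sw => y z; rewrite fE (linB _ _ (hmul.1 _)).
by elim: n => [|n IH]; rewrite ?big_ord0 ?big_ord_recr /= ?subrr // IH addrA subrK.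
Qed.

Lemma conv_inverse : exists h, [/\ linear h, deg_preserving h,
  forall x, conv h f x = conv1 x & forall x, conv f h x = conv1 x].
Proof.
(* On degree n the geometric series in [p] stops after the power n, hence the n.+1 terms. *)
have [h hh hE] := deg_glue hdeg (F := fun n => G n.+1) (fun n => hG n.+1).
have hM n M x : (n < M)%N -> h (deg n x) = G M (deg n x).
  by move=> hn; rewrite hE G_deg.
have pwp n : deg_preserving (pw n).
  elim: n => [|n IH]; first exact: conv1_preserving.
  rewrite /pw iterS -/(pw n); apply: conv_preserving => // m x.
  by rewrite /p (linB _ _ (hd m)) pf conv1_preserving.
exists h; split=> //.
- move=> n x; rewrite hE (linS _ _ _ (hd n)); apply: eq_bigr => j _; exact: pwp.
- apply: (deg_ext hdeg) => // n x; transitivity (conv (G n.+1) f (deg n x)).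
    rewrite !conv_deg //; apply: eq_bigr => i _; apply: eq_sw => y z.
    by rewrite (hM _ n.+1).
  by rewrite conv_Gf pw_small // subr0.
- apply: (deg_ext hdeg) => // n x; transitivity (conv f (G n.+1) (deg n x)).
    rewrite !conv_deg //; apply: eq_bigr => i _; apply: eq_sw => y z.
    by rewrite (hM _ n.+1) // ltnS leq_subr.
  by rewrite conv_fG pw_small // subr0.
Qed.
End Inverse.

(* Degree 0 invertibility suffices, since a left and a right inverse of the
   identity coincide. *)
Lemma conv_antipode s : linear s -> deg_preserving s ->
  (forall x, conv s id (deg 0%N x) = conv1 (deg 0%N x)) ->
  (forall x, conv id s (deg 0%N x) = conv1 (deg 0%N x)) ->
  exists S, [/\ linear S, deg_preserving S,
    forall x, conv S id x = conv1 x & forall x, conv id S x = conv1 x].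
Proof.
move=> hs ps sl sr; have hi : linear (fun x : H => x) by [].
have pi : deg_preserving id by move=> n x; rewrite degK // eqxx.
have [h [hh ph hl _]] := conv_inverse (conv_linear s id) (conv_preserving hs hi ps pi) sl.
have [g [hg pg _ gr]] := conv_inverse (conv_linear id s) (conv_preserving hi hs pi ps) sr.
have Sl x : conv (conv h s) id x = conv1 x by rewrite convA.
have Sr x : conv id (conv s g) x = conv1 x by rewrite -convA.
have e x : conv h s x = conv s g x.
  rewrite -(convf1 (f := conv h s)) // -(eq_conv (f := conv h s) (fun _ => erefl) Sr).
  by rewrite -convA // (eq_conv Sl (fun _ => erefl)) conv1f.
exists (conv h s); split=> //; first exact: conv_preserving.
by move=> x; rewrite -Sr; apply: eq_conv.
Qed.
End Convolution.

Ltac sw_rule ::= first [sw_rule_A | sw_rule_L | sw_rule_B | sw_rule_sgn].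

(** * Degree 0 part, antipode and the super-Hopf structure of A # L *)

Section Boson.
Context {k : fieldType} {A : hopfAlgType k} {V : crossedModType A}.
Variables (L : bsHopfData A) (g : V -> L).
Hypothesis hL : bs_generated g.
Local Notation O := (tens A L).
Local Notation one := (bs_one L).
Local Notation "x '·' y" := (@boson_mul k A L x y) (at level 40, left associativity).
Local Notation ia a := (a ⊗ one : O).
Local Notation cop := (@boson_cop k A L).
Local Notation deg := (@boson_deg k A L).
Local Notation eps := (@boson_eps k A L).

Let hm := bilin_boson_mul hL.

Lemma bg_eps_deg n l : bs_eps (@bs_deg k A L n.+1 l) = 0.
Proof.
move: n; elim/(bg_ind hL): l => [c x y hx hy||v x hx] n.
- by rewrite (bg_deg hL) (bg_eps hL) hx hy scaler0 addr0.
- by rewrite (bg_deg1 hL) lin0.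
by rewrite (bg_degM hL) (bg_epsM hL).
Qed.

(** L is connected, which identifies the degree 0 part of A # L with A. *)
Lemma bg_deg0 l : @bs_deg k A L 0 l = bs_eps l *: one.
Proof.
move: l; apply: (bg_ext hL) => //.
  by rewrite (bg_deg1 hL) (bg_eps1 hL) scale1r.
by move=> v x _; rewrite (bg_degM hL) (bg_epsM hL) scale0r.
Qed.

(** The projection id ⊗ eps onto A. It retracts the embedding of A, from which injectivity of the
    embedding is read off. *)
Definition boson_coef0 (x : O) : A := tlift (fun (a : A) (l : L) => (bs_eps l : k) *: a) x.

Lemma lin_boson_coef0 : linear boson_coef0.
Proof. by rewrite /boson_coef0. Qed.
Hint Resolve lin_boson_coef0 : lin.

Lemma boson_deg0 x : deg 0%N x = ia (boson_coef0 x).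
Proof.
move: x; apply: sw_ext => // a l.
by rewrite (boson_degE hL) bg_deg0 /boson_coef0 swE // tpureZl tpureZr.
Qed.

Lemma boson_eps_deg n x : eps (deg n.+1 x) = 0.
Proof.
move: x; apply: sw_ext => // a l.
by rewrite (boson_degE hL) (boson_epsE hL) bg_eps_deg scaler0.
Qed.

Lemma boson_baseM a b : ia (a * b) = ia a · ia b.
Proof. by rewrite (boson_mul_base hL). Qed.

Lemma boson_cop_ia a : cop (ia a) = \sw_(a1, a2 <- hcp a) ia a1 ⊗ ia a2.
Proof.
rewrite -{1}[a]mulr1 -(boson_mul_base hL) (boson_cop_base hL); apply: eq_sw => a1 a2.
by rewrite (boson_cop1 hL) swE // !(boson_mulx1 hL).
Qed.

Lemma boson_degree0_embedding : is_degree0_embedding (@boson_base k A L : A -> bosonisation L).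
Proof.
split.
- by move=> c a b; rewrite /boson_base tpure_linear_l.
- move=> a b /(congr1 boson_coef0).
  by rewrite /boson_coef0 !swE // (bg_eps1 hL) !scale1r.
- move=> x; split=> [<-|[a ->]]; first by eexists; exact: boson_deg0.
  by rewrite /= boson_deg0 /boson_coef0 swE // (bg_eps1 hL) scale1r.
- split; first by [].
  by move=> a b; exact: boson_baseM.
split=> a; first exact: boson_cop_ia.
by rewrite /= (boson_epsE hL) (bg_eps1 hL) -[RHS]mulr1.
Qed.

Lemma boson_antipode : exists S, @is_super_antipode k (bosonisation L) S.
Proof.
(* The antipode of A extended by 0 to positive degrees: an inverse of the identity in degree 0, to
   be corrected by [conv_antipode]. *)
pose s (x : O) : O := tlift (fun (a : A) (l : L) => (bs_eps l : k) *: ia (hS a)) x.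
have hs : linear s by rewrite /s.
have s0 a : s (ia a) = ia (hS a) by rewrite /s swE // (bg_eps1 hL) scale1r.
have ds x : deg 0%N (s x) = s x.
  move: x; apply: sw_ext => // a l; rewrite /s swE // boson_deg0 /boson_coef0 linZ //.
  by rewrite swE // (bg_eps1 hL) scale1r tpureZl.
have sd n x : s (deg n.+1 x) = 0.
  move: x; apply: sw_ext => // a l.
  by rewrite (boson_degE hL) /s swE // bg_eps_deg scale0r.
have deg1 : deg 0%N (ia 1) = ia 1 by rewrite (boson_deg1 hL).
have [|x|x|S [hS1 hS2 hS3 hS4]] := conv_antipode (boson_grading hL) hm
  (boson_mulA hL) (boson_mul1x hL) (boson_mulx1 hL) (@lin_boson_cop _ _ L)
  (@lin_boson_eps _ _ L) (boson_copA hL) (boson_counitl hL) (boson_counitr hL)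
  (boson_cop_deg hL) boson_eps_deg deg1 (boson_degM hL) hs.
- by move=> [|n] x; [rewrite ds | rewrite sd lin0].
- rewrite boson_deg0; move: (boson_coef0 x) => a.
  rewrite /conv boson_cop_ia sw_sw // /conv1 (boson_epsE hL) (bg_eps1 hL).
  transitivity (\sw_(a1, a2 <- hcp a) ia (hS a1 * a2)).
    by apply: eq_sw => a1 a2; rewrite swE // s0 -boson_baseM.
  by rewrite (sw_hSl (F := fun a => ia a)) // scaler_regular scale1r.
- rewrite boson_deg0; move: (boson_coef0 x) => a.
  rewrite /conv boson_cop_ia sw_sw // /conv1 (boson_epsE hL) (bg_eps1 hL).
  transitivity (\sw_(a1, a2 <- hcp a) ia (a1 * hS a2)).
    by apply: eq_sw => a1 a2; rewrite swE // s0 -boson_baseM.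
  by rewrite (sw_hSr (F := fun a => ia a)) // scaler_regular scale1r.
by exists S.
Qed.

Lemma boson_graded_super_hopf : @is_graded_super_hopf k (bosonisation L).
Proof.
split; last exact: boson_antipode.
- split; first exact: boson_grading hL.
  split; first split.
  + exact: hm.2.
  + exact: hm.1.
  + exact: boson_mulA hL.
  + exact: boson_mul1x hL.
  + exact: boson_mulx1 hL.
  split; first by rewrite /= (boson_deg1 hL).
  exact: boson_degM hL.
- split; first split.
  + exact: lin_boson_cop.
  + exact: lin_boson_eps.
  + exact: boson_copA hL.
  + exact: boson_counitl hL.
  + exact: boson_counitr hL.
  split=> [n x|[//|n] x _]; last exact: boson_eps_deg.
  have := boson_cop_deg hL n (deg n x).
  by rewrite (degK (boson_grading hL)) eqxx.
split.
- exact: boson_cop1 hL.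
- exact: boson_copM hL.
- exact: boson_eps1 hL.
- exact: boson_epsM hL.
Qed.
End Boson.

Ltac sw_rule ::= first [sw_rule_A | sw_rule_BG].

(** * The inner differential [theta, } on A # L *)

Section Boson.
Context {k : fieldType} {A : hopfAlgType k} {V : crossedModType A}.
Variables (L : bsHopfData A) (g : V -> L).
Hypothesis hL : bs_generated g.
Local Notation O := (tens A L).
Local Notation one := (bs_one L).
Local Notation "x '·' y" := (@boson_mul k A L x y) (at level 40, left associativity).
Local Notation ia a := (a ⊗ one : O).
Local Notation iv v := ((1 : A) ⊗ g v : O).
Local Notation cop := (@boson_cop k A L).
Local Notation deg := (@boson_deg k A L).
Local Notation pp := (parity_part deg).
Local Notation sgn := (parity_inv deg).

Let hm := bilin_boson_mul hL.
Let hgr := boson_grading hL.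
Let hs := lin_boson_sgn hL.

Lemma boson_gen_base v a x : iv v · (ia a · x) =
  \sw_(a1, a2 <- hcp a) ia a1 · (iv (cact v a2) · x).
Proof.
rewrite (boson_mulA hL) (boson_mul_gen hL) (sw_opl (op := @boson_mul k A L)) //.
apply: eq_sw => a1 a2; rewrite [RHS](boson_mulA hL) (boson_mul_base hL) mul1r mulr1.
by rewrite (bg_mulx1 hL).
Qed.

Lemma boson_sgn_iv v : sgn (iv v) = - iv v.
Proof. by rewrite -[iv v](boson_mulx1 hL) (boson_sgn_gen hL) (boson_sgn1 hL). Qed.

Lemma boson_mul_fiber l m : ((1 : A) ⊗ l : O) · (1 ⊗ m) = 1 ⊗ bs_mul l m.
Proof.
by rewrite (boson_mulE hL) (_ : hcp 1 = 1 ⊗ 1) ?swE // ?mulr1 ?(bact1 hL) //; exact: hcp1.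
Qed.

Variable theta : V.
Hypothesis theta_cotensor : cotensor (ccoact theta - theta ⊗ (1 : A)).
Hypothesis Psi_theta : forall eta : V, Psi (eta ⊗ theta) = theta ⊗ eta.
Hypothesis anticomm_theta : forall eta : V,
  anticommutator (\sw_(v, a <- ccoact theta - theta ⊗ (1 : A)) g v ⊗ a)
                 (\sw_(v, a <- ccoact eta) g v ⊗ a) = 0.
Hypothesis theta_sq : bs_mul (g theta) (g theta) = 0.

Let X : V ⊗ A := cco theta - theta ⊗ (1 : A).
Local Notation Th := (iv theta).

(** Multiplying a_(1) w S(a_(2)) on the right by one more leg of a clears the antipode from the
    adjoint action. In A # L the result says that X commutes with Δ(a). *)
Lemma cotensor_mul (U : lmodType k) (F : V -> A -> U) a : bilin F ->
  \sw_(v, b <- X) (\sw_(a1, a2 <- hcp a) F (cact v a1) (b * a2)) =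
  \sw_(v, b <- X) F v (a * b).
Proof.
move=> hF; have hcot c : \sw_(v, w <- X) cact v c ⊗ w =
    \sw_(v, w <- X) v ⊗ (\sw_(c1, c2 <- hcp c) c1 * w * hS c2) := theta_cotensor c.
rewrite sw_swap //.
transitivity (\sw_(a1, a2 <- hcp a) \sw_(v, w <- \sw_(v, w <- X) cact v a1 ⊗ w) F v (w * a2)).
  by apply: eq_sw => a1 a2; swr.
under eq_sw => a1 a2 do rewrite hcot.
swl; rewrite [LHS](_ : _ = \sw_(v, b <- X) \sw_(a', a3 <- hcp a) \sw_(a1, a2 <- hcp a')
    F v (a1 * b * hS a2 * a3)); last by rewrite sw_swap.
apply: eq_sw => v b; rewrite hcp_assoc //.
rewrite -[RHS](sw_hepsr (F := fun a => F v (a * b))) //; apply: eq_sw => b0 c.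
rewrite -[b0 * b in RHS]mulr1 -(sw_hSl (F := fun x => F v (b0 * b * x))) //.
by apply: eq_sw => c1 c2; rewrite !mulrA.
Qed.

(** The hypothesis on Psi reads Σ θ_0 ⊗ η ◁ θ_1 = θ ⊗ η. Coacting on the first factor gives Σ θ_0 ⊗
    θ_1 ⊗ η ◁ θ_2 = Σ θ_0 ⊗ θ_1 ⊗ η, and for the subtracted term θ ⊗ 1 the action is by 1. So η
    commutes with the A-leg of X. *)
Lemma gen_commutes (U : lmodType k) (F : V -> A -> V -> U) eta :
  trilin F -> (forall b, bilin (fun v e => F v b e)) ->
  \sw_(v, b <- X) (\sw_(b1, b2 <- hcp b) F v b1 (cact eta b2)) =
  \sw_(v, b <- X) F v b eta.
Proof.
move=> [h1 h2] h3.
have hPsi : \sw_(t0, t1 <- cco theta) t0 ⊗ cact eta t1 = theta ⊗ eta.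
  by rewrite -Psi_theta [RHS]Psi_pure.
have L1 : bilin (fun v b => F v b eta) by exact: h1.
have L2 v b : linear (F v b) by exact: (h2 v).2.
have L3 b e : linear (fun v => F v b e) by exact: (h1 e).1.
have L4 v e : linear (fun b => F v b e) by exact: (h1 e).2.
have B1 v : bilin (fun b1 b2 => F v b1 (cact eta b2)).
  by apply: bilinI => ? //; exact: (lin_comp (L2 _ _) (bilin_cact.2 _)).
have B2 : bilin (fun v b => \sw_(b1, b2 <- hcp b) F v b1 (cact eta b2)).
  by apply: bilinI => b; [apply: lin_tlift_body => // *|apply: lin_tlift].
rewrite /X !(linB (f := tlift _)) //; congr (_ - _); last first.
  by rewrite !swE // (_ : hcp 1 = 1 ⊗ 1) ?swE // ?cact1 //; exact: hcp1.
have K : bilin (fun t e => \sw_(v, b <- cco t) F v b e).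
  apply: bilinI => e; first by apply: lin_tlift; apply: lin_cco.
  by apply: lin_tlift_body => // *; exact: h1.
have := congr1 (tlift (fun t e => \sw_(v, b <- cco t) F v b e)) hPsi.
rewrite [RHS]swE // => <-; rewrite sw_sw //.
rewrite -(cco_assoc (F := fun v b1 b2 => F v b1 (cact eta b2))).
  by apply: eq_sw => t0 t1; rewrite swE.
split=> [b2|//]; exact: h1.
Qed.

(** The hypothesis lives in L ⊗ A, and the linear map [M] carries it to A # L by multiplying into z
    and w. The A-legs have degree 0, so they contribute no further sign. *)
Lemma anticommute eta z w :
  \sw_(v, b <- X) (\sw_(e, c <- cco eta) (iv v · (iv e · z)) ⊗ (ia b · (ia c · w))) =
  - \sw_(e, c <- cco eta) (\sw_(v, b <- X) (iv e · (iv v · z)) ⊗ (ia c · (ia b · w))).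
Proof.
pose M (p : L ⊗ A) : O ⊗ O := \sw_(l, c <- p) (((1 : A) ⊗ l : O) · z) ⊗ (ia c · w).
have hM : linear M by rewrite /M.
have ME l c : M (l ⊗ c) = (((1 : A) ⊗ l : O) · z) ⊗ (ia c · w) by rewrite /M swE.
have h : \sw_(l, a <- \sw_(v, a <- X) g v ⊗ a) (\sw_(m, b <- \sw_(e, c <- cco eta) g e ⊗ c)
      bs_mul l m ⊗ (a * b)) +
    \sw_(l, a <- \sw_(e, c <- cco eta) g e ⊗ c) (\sw_(m, b <- \sw_(v, a <- X) g v ⊗ a)
      bs_mul l m ⊗ (a * b)) = 0 := anticomm_theta eta.
apply/eqP; rewrite -subr_eq0 opprK; apply/eqP.
rewrite -[RHS](lin0 hM) -h linD //; congr (_ + _).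
  swr; apply: eq_sw => v b; apply: eq_sw => e c.
  by rewrite ME -boson_mul_fiber !(boson_mulA hL) (boson_mul_base hL).
swr; apply: eq_sw => v b; apply: eq_sw => e c.
by rewrite ME -boson_mul_fiber !(boson_mulA hL) (boson_mul_base hL).
Qed.

(* d = [theta, } fails to be a coderivation at x by the difference between the two
   defects of the coproduct of x; both obey the same recursion along generators. *)
Definition left_defect (p : O ⊗ O) : O ⊗ O :=
  \sw_(z, w <- p) (\sw_(v, b <- X) (iv v · z) ⊗ (ia b · w)).
Definition right_defect (p : O ⊗ O) : O ⊗ O :=
  \sw_(z, w <- p) (\sw_(v, b <- X) (sgn z · iv v) ⊗ (w · ia b)).

Lemma lin_left_defect : linear left_defect.
Proof. by rewrite /left_defect. Qed.
Lemma lin_right_defect : linear right_defect.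
Proof. by rewrite /right_defect. Qed.
Hint Resolve lin_left_defect lin_right_defect : lin.

Lemma left_defectE z w :
  left_defect (z ⊗ w) = \sw_(v, b <- X) (iv v · z) ⊗ (ia b · w).
Proof. by rewrite /left_defect swE. Qed.
Lemma right_defectE z w :
  right_defect (z ⊗ w) = \sw_(v, b <- X) (sgn z · iv v) ⊗ (w · ia b).
Proof. by rewrite /right_defect swE. Qed.

(** Left multiplication by Δ(a) and, in the next two definitions, by the halves η_0 ⊗ η_1 and 1 ⊗ η
    of Δ(η); these are the operators in the recursion for [cop]. *)
Let mul_base a (p : O ⊗ O) : O ⊗ O :=
  \sw_(a1, a2 <- hcp a) (\sw_(z, w <- p) (ia a1 · z) ⊗ (ia a2 · w)).
Let mul_coact eta (p : O ⊗ O) : O ⊗ O :=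
  \sw_(z, w <- p) (\sw_(e, c <- cco eta) (iv e · z) ⊗ (ia c · w)).
Let mul_gen eta (p : O ⊗ O) : O ⊗ O := \sw_(z, w <- p) sgn z ⊗ (iv eta · w).
Let lin_mul_base a : linear (mul_base a). Proof. by rewrite /mul_base. Qed.
Let lin_mul_coact e : linear (mul_coact e). Proof. by rewrite /mul_coact. Qed.
Let lin_mul_gen e : linear (mul_gen e). Proof. by rewrite /mul_gen. Qed.

Let left_defect_base a p : left_defect (mul_base a p) = mul_base a (left_defect p).
Proof.
move: p; apply: sw_ext => // z w.
transitivity (\sw_(a1, a2 <- hcp a) \sw_(v, b <- X) \sw_(c1, c2 <- hcp a1)
    (ia c1 · (iv (cact v c2) · z)) ⊗ (ia (b * a2) · w)).
  rewrite /mul_base; swl; apply: eq_sw => a1 a2; rewrite left_defectE; apply: eq_sw => v b.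
  by rewrite boson_gen_base (sw_opl (op := @tpure k O O)) // (boson_baseM hL) (base_mulA hL).
under eq_sw => a1 a2 do rewrite sw_swap //.
rewrite hcp_assoc // /mul_base left_defectE; apply: eq_sw => c1 a'.
rewrite sw_swap // (cotensor_mul (F := fun v b => (ia c1 · (iv v · z)) ⊗ (ia b · w))) //.
swr; apply: eq_sw => v b.
by rewrite (boson_baseM hL) (base_mulA hL).
Qed.

Let right_defect_base a p : right_defect (mul_base a p) = mul_base a (right_defect p).
Proof.
move: p; apply: sw_ext => // z w; rewrite right_defectE /mul_base; swl; swr.
apply: eq_sw => a1 a2; rewrite right_defectE; apply: eq_sw => v b.
by rewrite (boson_sgn_base hL) !(base_mulA hL).
Qed.

Let left_defect_coact eta p : left_defect (mul_coact eta p) = - mul_coact eta (left_defect p).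
Proof.
move: p; apply: sw_ext => // z w; rewrite left_defectE /mul_coact; swl; swr.
rewrite sw_swap // -anticommute sw_swap //.
by apply: eq_sw => e c; rewrite left_defectE.
Qed.

Let right_defect_coact eta p : right_defect (mul_coact eta p) = - mul_coact eta (right_defect p).
Proof.
move: p; apply: sw_ext => // z w; rewrite right_defectE /mul_coact; swl; swr.
rewrite sw_swap // -sw_opp //; apply: eq_sw => e c; rewrite right_defectE -sw_opp //.
apply: eq_sw => v b.
by rewrite (boson_sgn_gen hL) (linN _ (hm.1 _)) tpureNl (gen_mulA hL) (base_mulA hL).
Qed.

Let left_defect_gen eta p : left_defect (mul_gen eta p) = - mul_gen eta (left_defect p).
Proof.
move: p; apply: sw_ext => // z w; rewrite left_defectE /mul_gen; swl; swr.
rewrite left_defectE.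
(* Moving [eta] past [b] turns it into [cact eta b2], which [gen_commutes] undoes. The sign comes
   from [sgn] applied to the product of [iv v] with z. *)
rewrite opprK -[LHS](gen_commutes (F := fun v b e => (iv v · sgn z) ⊗ (ia b · (iv e · w)))) //.
by apply: eq_sw => v b; rewrite boson_gen_base (sw_opr (op := @tpure k O O)).
Qed.

Let right_defect_gen eta p : right_defect (mul_gen eta p) = - mul_gen eta (right_defect p).
Proof.
move: p; apply: sw_ext => // z w; rewrite right_defectE /mul_gen; swl; swr.
rewrite right_defectE -sw_opp //; apply: eq_sw => v b.
by rewrite (boson_sgnM hL) (gen_mulA hL) boson_sgn_iv (linN _ (hm.2 _)) tpureNl opprK.
Qed.

Lemma defect_cop x : left_defect (cop x) = right_defect (cop x).
Proof.
move: x; apply: (boson_ext hL) => // [|a x h|eta x h].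
- rewrite (boson_cop1 hL) left_defectE right_defectE; apply: eq_sw => v b.
  by rewrite (boson_sgn1 hL) !(boson_mulx1 hL) !(boson_mul1x hL).
- by rewrite (boson_cop_base hL) left_defect_base h right_defect_base.
rewrite (boson_cop_gen hL) !linD // -/(mul_coact eta _) -/(mul_gen eta _).
by rewrite left_defect_coact right_defect_coact left_defect_gen right_defect_gen h.
Qed.

Local Notation tm := (@super_tmul k (bosonisation L)).
Local Notation d := (@scomm k O deg (@boson_mul k A L) Th).

Lemma lin_inner : linear d. Proof. by rewrite /scomm. Qed.
Hint Resolve lin_inner : lin.

Lemma boson_gen_sq : Th · Th = 0.
Proof. by rewrite boson_mul_fiber theta_sq tpure0r. Qed.

Lemma boson_deg_iv v : deg 1%N (iv v) = iv v.
Proof. by rewrite -[iv v](boson_mulx1 hL) (boson_deg_gen hL) (boson_deg1 hL). Qed.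

Lemma inner_deg n x : deg n.+1 (d (deg n x)) = d (deg n x).
Proof.
rewrite /scomm linB // (boson_deg_gen hL) (degK hgr) eqxx; congr (_ - _).
rewrite (parity_inv_deg hgr) (linZ _ _ (hm.1 _)) linZ //; congr (_ *: _).
by rewrite -addn1 -{1}boson_deg_iv (boson_degM hL) boson_deg_iv.
Qed.

(** [d] reverses parity, so the two mixed terms θ sgn(x) θ cancel and only terms containing θ²
    remain. *)
Lemma inner_sq x : d (d x) = 0.
Proof.
have e : sgn (d x) = x · Th - Th · sgn x.
  rewrite /scomm linB // (boson_sgn_gen hL) (boson_sgnM hL) boson_sgn_iv.
  by rewrite (parity_invK hgr) (linN _ (hm.2 _)) opprK addrC.
rewrite {1}/scomm e (linB _ _ (hm.1 _)) /scomm (linB _ _ (hm.2 _)).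
rewrite !(boson_mulA hL) boson_gen_sq (lin0 (hm.1 _)) -!(boson_mulA hL).
by rewrite boson_gen_sq (lin0 (hm.2 _)) !sub0r opprK addrC subrr.
Qed.

Lemma inner_derivation : @is_super_derivation k (bosonisation L) d.
Proof.
move=> x y; rewrite /= /scomm (boson_sgnM hL).
rewrite (linB (Th · x) _ (hm.1 y)) (linB (Th · y) _ (hm.2 _)).
by rewrite !(boson_mulA hL) addrA subrK.
Qed.

Lemma boson_cop_iv v : cop (iv v) = \sw_(v0, v1 <- cco v) iv v0 ⊗ ia v1 + ia 1 ⊗ iv v.
Proof.
rewrite -{1}[iv v](boson_mulx1 hL) (boson_cop_gen hL) (boson_cop1 hL) !swE //.
rewrite (boson_sgn1 hL) (boson_mulx1 hL); congr (_ + _); apply: eq_sw => *.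
by rewrite !(boson_mulx1 hL).
Qed.

Lemma parity_iv v b : pp b (iv v) = if b then iv v else 0.
Proof. by rewrite -boson_deg_iv (parity_part_deg hgr); case: b. Qed.

Lemma parity_ia1 b : pp b (ia 1) = if b then 0 else ia 1.
Proof.
have e : ia 1 = deg 0%N (ia 1) by rewrite (boson_deg1 hL).
by rewrite e (parity_part_deg hgr); case: b.
Qed.

Lemma inner_coderivation : @is_super_coderivation k (bosonisation L) d.
Proof.
move=> x; rewrite /=; have ht := bilin_super_tmul hL.
have eX : cco theta = X + theta ⊗ 1 by rewrite /X subrK.
have e1 : cop (Th · x) = left_defect (cop x) + \sw_(y, z <- cop x) (Th · y) ⊗ z +
    \sw_(y, z <- cop x) sgn y ⊗ (Th · z).
  rewrite (boson_cop_gen hL) /left_defect; congr (_ + _).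
  rewrite -[RHS]sw_add //; apply: eq_sw => y z.
  by rewrite eX linD // swE // (boson_mul1x hL).
have e2 : cop (sgn x · Th) = right_defect (cop x) + \sw_(y, z <- cop x) (sgn y · Th) ⊗ z +
    \sw_(y, z <- cop x) sgn y ⊗ (sgn z · Th).
  rewrite (boson_copM hL) (boson_cop_sgn hL) boson_cop_iv (sw_opl (op := tm)) //.
  rewrite /right_defect -!sw_add //; apply: eq_sw => y z.
  rewrite (linD _ _ (ht.2 _)) (sw_opr (op := tm)) // (super_tmulE hL) !parity_ia1.
  rewrite (boson_mulx1 hL) (lin0 (hm.2 _)) tpure0l addr0; congr (_ + _).
  rewrite eX linD // swE //; congr (_ + _); last first.
    rewrite (super_tmulE hL) !parity_iv (lin0 (hm.2 _)) tpure0l add0r.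
    by rewrite (parity_invK hgr) (boson_mulx1 hL).
  apply: eq_sw => v b.
  rewrite (super_tmulE hL) !parity_iv (lin0 (hm.2 _)) tpure0l add0r.
  by rewrite (parity_invK hgr).
rewrite {1}/scomm linB // e1 e2 defect_cop.
(* With the defects cancelled, the remaining terms pair up into commutators with θ in the first and
   in the second factor. *)
rewrite !opprD addrACA (addrACA (right_defect _)) subrr add0r -!sw_opp // -!sw_add //; apply: eq_sw => y z.
by rewrite /scomm tpureDl tpureNl tpureDr tpureNr.
Qed.

(** In A # L the product θa is Σ a_1 (θ ◁ a_2). Splitting a_2 into its projection to A^+ and its
    counit separates this into the term of omega and the term a ⊗ θl of delta. *)
Lemma boson_diff_inner (x : O) :
  boson_diff (fun a : A => g (cact theta a)) (scomm (@bs_deg k A L) (@bs_mul k A L) (g theta)) x = d x.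
Proof.
have hd : linear (scomm (@bs_deg k A L) (@bs_mul k A L) (g theta)) by rewrite /scomm.
have hpl : linear (fun a : A => hpi a).
  by move=> c a b; rewrite /hpi lin_heps scalerBr scalerDl -scalerA opprD addrACA.
have def : boson_diff (fun a : A => g (cact theta a)) (scomm (@bs_deg k A L) (@bs_mul k A L) (g theta)) x =
    \sw_(a, l <- x) ((\sw_(a1, a2 <- hcp a) a1 ⊗ bs_mul (g (cact theta (hpi a2))) l) +
       a ⊗ scomm (@bs_deg k A L) (@bs_mul k A L) (g theta) l) by [].
rewrite {}def; move: x; apply: sw_ext => // a l; rewrite swE //.
rewrite /scomm (boson_mul_gen hL) (boson_sgnE hL) (boson_mulE hL).
rewrite (_ : hcp 1 = 1 ⊗ 1) ?swE // ?mulr1 ?(bact1 hL); last exact: hcp1.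
rewrite tpureDr tpureNr addrA; congr (_ - _).
(* The term a ⊗ θl is spread over the coproduct of a with weight eps(a_2), which restores the part
   of a_2 removed by [hpi]. *)
rewrite -[X in _ + X](sw_hepsr (F := fun a => a ⊗ bs_mul (g theta) l)) // -sw_add //.
apply: eq_sw => a1 a2; rewrite mul1r -tpureZr -tpureDr; congr (_ ⊗ _).
rewrite -(linZ _ _ ((bg_mul hL).1 l)) -(linD _ _ ((bg_mul hL).1 l)); congr bs_mul.
rewrite -(linZ _ _ (bg_gen hL)) -(linD _ _ (bg_gen hL)); congr g.
rewrite /hpi (linB _ _ ((bilin_cact _).2 _)) (linZ _ _ ((bilin_cact _).2 _)) cact1.
by rewrite subrK.
Qed.
End Boson.

Ltac sw_rule ::= first [sw_rule_A | sw_rule_V].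

(** * The tensor algebra as generated data *)

Section TensorAlgebraInstance.
Context {k : fieldType} {A : hopfAlgType k} (V : crossedModType A).
Local Notation T := (talg V).
Local Notation g v := (tword [:: v] : T).
Local Notation one := (tword [::] : T).
Local Notation "x '·' y" := (@talg_mul k V x y) (at level 40, left associativity).
Local Notation act := (@talg_act k A V).
Local Notation coact := (@talg_coact k A V).
Local Notation cop := (@talg_cop k A V).
Local Notation deg := (@talg_deg k V).
Local Notation pp := (parity_part deg).
Local Notation sgn := (parity_inv deg).

Lemma lin_talg_act_l a : linear (fun x => act x a). Proof. exact: talg_act_linear_l. Qed.
Lemma bilin_talg_act : bilin act.
Proof. by split; [exact: talg_act_linear_l|exact: talg_act_linear_r]. Qed.
Lemma lin_talg_coact : linear coact. Proof. by move=> c x y; rewrite /talg_coact linearP. Qed.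
Lemma lin_talg_cop : linear cop. Proof. by move=> c x y; rewrite /talg_cop linearP. Qed.
Lemma lin_talg_deg n : linear (deg n). Proof. by move=> c x y; rewrite linearP. Qed.
Lemma lin_talg_eps : linear (@talg_eps k A V).
Proof. by move=> c x y; rewrite /talg_eps linearP. Qed.
Lemma lin_talg_gen : linear (fun v => g v). Proof. exact: lin_tw. Qed.
Lemma lin_talg_parity b : linear (pp b). Proof. exact: parity_linear. Qed.
Hint Resolve lin_talg_coact lin_talg_cop lin_talg_deg lin_talg_eps lin_talg_gen
  lin_talg_parity : lin.
Hint Extern 0 (bilin (@talg_act _ _ _)) => exact bilin_talg_act : lin.

Lemma talg_ind (P : T -> Prop) : (forall c x y, P x -> P y -> P (c *: x + y)) ->
  (forall s, P (tword s)) -> forall x, P x.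
Proof.
move=> hlin h; apply: pclassW => s; rewrite pres_piE.
elim: s => [|[c s] l IH]; rewrite /fsum ?big_nil ?big_cons.
  by rewrite -(addNr (tword [::])) -scaleN1r; apply: hlin.
by apply: hlin => //; exact: h.
Qed.

Lemma word_ext (U : lmodType k) (f h : T -> U) : linear f -> linear h ->
  (forall s, f (tword s) = h (tword s)) -> forall x, f x = h x.
Proof. by move=> hf hh e; apply: talg_ind => // c x y ex ey; rewrite hf hh ex ey. Qed.

Lemma talg_mulA : associative (@talg_mul k V).
Proof.
have hm := @talg_mul_bilin k V.
move=> x y z; move: x; apply: word_ext => // s; move: y; apply: word_ext => // t.
by move: z; apply: word_ext => // u; rewrite !talg_mul_word catA.
Qed.

Lemma talg_mul1x : left_id one (@talg_mul k V).
Proof. by apply: word_ext => // s; rewrite talg_mul_word. Qed.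

Lemma talg_mulx1 : right_id one (@talg_mul k V).
Proof. by apply: word_ext => // s; rewrite talg_mul_word cats0. Qed.

Lemma talg_consE v s : tword (v :: s) = g v · tword s.
Proof. by rewrite talg_mul_word. Qed.

Lemma talg_actM v x a : act (g v · x) a =
  \sw_(a1, a2 <- hcp a) g (cact v a1) · act x a2.
Proof.
move: x; apply: word_ext => // s.
rewrite talg_mul_word talg_act_word /=; apply: eq_sw => a1 a2.
by rewrite talg_act_word.
Qed.

Lemma talg_act1 a : act one a = heps a *: one.
Proof. by rewrite talg_act_word. Qed.

Lemma talg_coactM v x : coact (g v · x) =
  \sw_(v0, v1 <- cco v) (\sw_(x0, x1 <- coact x) g v0 · x0 ⊗ (v1 * x1)).
Proof.
move: x; apply: word_ext => // s.
by rewrite talg_mul_word !talg_coact_word.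
Qed.

Lemma talg_coact1 : coact one = one ⊗ 1.
Proof. by rewrite talg_coact_word. Qed.

Lemma talg_degM n v x : deg n (g v · x) = if n is m.+1 then g v · deg m x else 0.
Proof.
case: n => [|n]; move: x; apply: word_ext => // s; rewrite talg_mul_word !talg_deg_word //=.
by rewrite eqSS; case: eqP; rewrite ?talg_mul_word // (lin0 ((@talg_mul_bilin k V).2 _)).
Qed.

Lemma talg_act_gen v a : act (g v) a = g (cact v a).
Proof.
rewrite -[g v]talg_mulx1 talg_actM.
under eq_sw => a1 a2 do rewrite talg_act1 (linZ _ _ ((@talg_mul_bilin k V).2 _)) talg_mulx1.
by rewrite (sw_hepsr (F := fun a => g (cact v a))).
Qed.

Lemma talg_coact_eps x : \sw_(x0, x1 <- coact x) heps x1 *: x0 = x.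
Proof.
move: x; apply: word_ext => // s; elim: s => [|v s IH].
  by rewrite talg_coact1 swE // heps1 scale1r.
rewrite talg_consE talg_coactM; swl.
rewrite -{2}IH (sw_opr (op := @talg_mul k V)) // sw_swap //; apply: eq_sw => x0 x1.
rewrite (linZ _ _ ((@talg_mul_bilin k V).2 _)) -(sw_ceps (F := fun v => g v · x0)) // -sw_scale //.
by apply: eq_sw => v0 v1; rewrite hepsM scalerA mulrC.
Qed.

Lemma talg_parityD x : pp false x + pp true x = x.
Proof.
by move: x; apply: word_ext => // s; rewrite !parity_word; case: odd; rewrite ?add0r ?addr0.
Qed.

(** In the parity sums only the even part of [one] and the odd part of the letter survive. The first
    summand thus has no sign, and the second has that of y, absorbed in [sgn y]. *)
Lemma talg_tmul_gen v p : talg_tmul (g v ⊗ one + one ⊗ g v) p =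
  \sw_(y, z <- p) (g v · y ⊗ z +
      \sw_(y0, y1 <- coact (sgn y)) y0 ⊗ (g (cact v y1) · z)).
Proof.
have hs : linear sgn by rewrite /parity_inv.
have h := talg_tmul_linear_r (A := A) (V := V); move: p; apply: sw_ext => // y z.
rewrite swE // (linD _ _ (talg_tmul_linear_l _)) !talg_tmul_pure /tmul4 !big_bool /=.
rewrite /tmul_term !parity_word /= !expr0 !scale1r !expr1 !scaleN1r.
have z0 x b : \sw_(z0, z1 <- coact (pp b y)) x · z0 ⊗ (act 0 z1 · z) = 0.
  apply: sw_eq0 => u a.
  by rewrite (lin0 (lin_talg_act_l a)) (lin0 ((@talg_mul_bilin k V).1 z)) tpure0r.
rewrite !z0 !addr0 oppr0 !add0r; congr +%R.
  (* The action on [one] is the counit, so the coaction of y is undone by [talg_coact_eps]. *)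
  rewrite -sw_argD -linD // addrC talg_parityD.
  rewrite -[in RHS](talg_coact_eps y) (sw_opr (op := @talg_mul k V)) //.
  rewrite (sw_opl (op := @tpure k T T)) //; apply: eq_sw => y0 y1.
  rewrite talg_act1 (linZ _ _ ((@talg_mul_bilin k V).1 z)) (linZ _ _ ((@talg_mul_bilin k V).2 _)).
  by rewrite talg_mul1x tpureZl tpureZr.
rewrite /parity_inv linB // addrC linB //; congr (_ - _); apply: eq_sw => y0 y1;
by rewrite talg_mul1x talg_act_gen.
Qed.

Lemma talg_copM v x : cop (g v · x) =
  \sw_(y, z <- cop x) (g v · y ⊗ z +
      \sw_(y0, y1 <- coact (sgn y)) y0 ⊗ (g (cact v y1) · z)).
Proof.
have hs : linear sgn by rewrite /parity_inv.
move: x; apply: word_ext => // s.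
by rewrite talg_mul_word !talg_cop_word /= talg_tmul_gen.
Qed.

(** Besides preparing B_-(V), this gives T the facts on grading, counit and parity already proved
    for generated data. *)
Lemma talg_generated : @bs_generated k A V (Tminus V) (fun v => tword [:: v]).
Proof.
split=> //=.
- exact: talg_mulA.
- exact: talg_mul1x.
- exact: talg_mulx1.
- by move=> n; rewrite talg_deg_word; case: n.
- exact: talg_degM.
- exact: talg_act1.
- by move=> v x a; exact: talg_actM.
- exact: talg_coact1.
- exact: talg_coactM.
- by rewrite talg_cop_word.
- exact: talg_copM.
- by rewrite talg_eps_word.
- by move=> v x; move: x; apply: word_ext => // s; rewrite talg_mul_word talg_eps_word.
- move=> P hlin h1 hM; apply: talg_ind => // s; elim: s => // v s IH.
  by rewrite talg_consE; apply: hM.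
Qed.
End TensorAlgebraInstance.

Lemma lin_tsgn (k : fieldType) (V : lmodType k) : linear (parity_inv (@talg_deg k V)).
Proof.
by move=> c x y; rewrite /parity_inv !parity_linear opprD addrACA scalerBr.
Qed.
Lemma lin_tdeg (k : fieldType) (V : lmodType k) n : linear (@talg_deg k V n).
Proof. by move=> c x y; rewrite linearP. Qed.
#[global] Hint Extern 0 (bilin (@talg_act _ _ _)) => refine (@bilin_talg_act _ _ _) : lin.
#[global] Hint Extern 0 (GRing.linear_for _ (@talg_coact _ _ _)) => refine (@lin_talg_coact _ _ _) : lin.
#[global] Hint Extern 0 (GRing.linear_for _ (@talg_cop _ _ _)) => refine (@lin_talg_cop _ _ _) : lin.
#[global] Hint Extern 0 (GRing.linear_for _ (@talg_deg _ _ _)) => refine (@lin_tdeg _ _ _) : lin.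
#[global] Hint Extern 0 (GRing.linear_for _ (@talg_eps _ _ _)) => refine (@lin_talg_eps _ _ _) : lin.
#[global] Hint Extern 0 (GRing.linear_for _ (parity_inv (@talg_deg _ _))) =>
  refine (@lin_tsgn _ _) : lin.

(** * The one-letter component D of the braided coproduct *)

Section SkewDerivation.
Context {k : fieldType} {A : hopfAlgType k} {V : crossedModType A}.
Local Notation T := (talg V).
Local Notation g v := (tword [:: v] : T).
Local Notation one := (tword [::] : T).
Local Notation "x '·' y" := (@talg_mul k V x y) (at level 40, left associativity).

(** The map z ↦ (id ⊗ mul)(Psi ⊗ id)(v ⊗ z): v is braided past the first letter and absorbed into
    the rest. *)
Definition skew_left (v : V) (z : V ⊗ T) : V ⊗ T :=
  \sw_(u, y <- z) (\sw_(u0, u1 <- cco u) u0 ⊗ (g (cact v u1) · y)).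

Lemma skew_leftE v z : skew_left v z =
  \sw_(u, y <- z) (\sw_(u0, u1 <- cco u) u0 ⊗ (g (cact v u1) · y)).
Proof. by []. Qed.

Lemma bilin_skew_left : bilin skew_left.
Proof. by rewrite /skew_left. Qed.

(** The sign is that of the odd letter [v] passing the odd letter extracted from the remaining
    word. *)
Fixpoint word_left (s : seq V) : V ⊗ T :=
  if s is v :: t then v ⊗ tword t - skew_left v (word_left t) else 0.

(* The component of the braided coproduct in V ⊗ T. *)
Definition talg_left : T -> V ⊗ T := wlift word_left.

Lemma lin_talg_left : linear talg_left.
Proof. by move=> c x y; rewrite /talg_left linearP. Qed.
Hint Resolve lin_talg_left bilin_skew_left : lin.

Lemma word_left_multilin : multilin word_left.
Proof.
have [hl hr] := bilin_skew_left.
move=> c s; elim: s => [|w s IH] t u v /=.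
  by rewrite tpure_linear_l hl scalerBr opprD addrACA.
by rewrite IH tword_multilin tpure_linear_r hr scalerBr opprD addrACA.
Qed.

Lemma talg_left1 : talg_left one = 0.
Proof. by rewrite /talg_left wlift_word //; exact: word_left_multilin. Qed.

Lemma talg_left_gen v x : talg_left (g v · x) = v ⊗ x - skew_left v (talg_left x).
Proof.
move: x; apply: word_ext => // s.
by rewrite talg_mul_word /talg_left !wlift_word //; exact: word_left_multilin.
Qed.

Lemma talg_genE (P : T -> Prop) : (forall c x y, P x -> P y -> P (c *: x + y)) ->
  P one -> (forall v x, P x -> P (g v · x)) -> forall x, P x.
Proof. exact: (bg_ind (talg_generated V)). Qed.

Lemma talg_gen_ext (U : lmodType k) (f h : T -> U) : linear f -> linear h ->
  f one = h one -> (forall v x, f x = h x -> f (g v · x) = h (g v · x)) ->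
  forall x, f x = h x.
Proof. exact: (bg_ext (talg_generated V)). Qed.

Lemma talg_left_deg n x : talg_left (talg_deg n x) =
  if n is m.+1 then \sw_(u, y <- talg_left x) u ⊗ talg_deg m y else 0.
Proof.
elim/talg_genE: x n => [c x y hx hy||v x h] n.
- by rewrite lin_talg_deg [LHS]lin_talg_left hx hy; case: n => [|n];
    rewrite ?scaler0 ?addr0 // lin_talg_left linearP.
- rewrite talg_deg_word talg_left1; case: n => [|n] /=; rewrite ?talg_left1 ?lin0 //.
rewrite talg_degM; case: n => [|n]; first by rewrite lin0.
rewrite !talg_left_gen (linB (f := tlift _)) // swE //; congr (_ - _); rewrite h.
case: n {h} => [|n].
  rewrite (lin0 (bilin_skew_left.2 _)) /skew_left sw_sw //; symmetry.
  apply: sw_eq0 => u y; rewrite sw_sw //; apply: sw_eq0 => *.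
  by rewrite swE // talg_degM tpure0r.
rewrite /skew_left sw_sw // sw_sw //; apply: eq_sw => u y; rewrite swE // sw_sw //.
by apply: eq_sw => *; rewrite swE // talg_degM.
Qed.
End SkewDerivation.
#[global] Hint Extern 0 (GRing.linear_for _ (@talg_left _ _ _)) => refine (@lin_talg_left _ _ _) : lin.
#[global] Hint Extern 0 (bilin (@skew_left _ _ _)) => refine (@bilin_skew_left _ _ _) : lin.

Lemma talg_sgn1 (k : fieldType) (A : hopfAlgType k) (V : crossedModType A) :
  parity_inv (@talg_deg k V) (tword [::]) = tword [::].
Proof. exact: (sgn_one (talg_generated V)). Qed.

Lemma talg_sgnM (k : fieldType) (A : hopfAlgType k) (V : crossedModType A) (v : V) x :
  parity_inv (@talg_deg k V) (talg_mul (tword [:: v]) x) =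
  - talg_mul (tword [:: v]) (parity_inv (@talg_deg k V) x).
Proof. exact: (sgnM (talg_generated V)). Qed.

Ltac sw_rule_T :=
  lazymatch goal with
  | |- talg_act (talg_mul (tword [:: _]) _) _ = _ => refine (talg_actM _ _ _)
  | |- talg_act (tword [::]) _ = _ => refine (talg_act1 _ _)
  | |- talg_act (tword [:: _]) _ = _ => refine (talg_act_gen _ _)
  | |- talg_coact (talg_mul (tword [:: _]) _) = _ => refine (talg_coactM _ _)
  | |- talg_coact (tword [::]) = _ => refine (talg_coact1 _)
  | |- talg_cop (talg_mul (tword [:: _]) _) = _ => refine (talg_copM _ _)
  | |- talg_left (talg_mul (tword [:: _]) _) = _ => refine (talg_left_gen _ _)
  | |- skew_left _ _ = _ => refine (skew_leftE _ _)
  | |- tlift3 _ (_ ⊗ _) = _ => refine (tlift3E _ _ _); lin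
  | |- parity_inv (@talg_deg _ _) (talg_mul (tword [:: _]) _) = _ => refine (talg_sgnM _ _)
  end.
Ltac sw_rule ::= first [sw_rule_A | sw_rule_T].

Section SkewDerivation.
Context {k : fieldType} {A : hopfAlgType k} {V : crossedModType A}.
Local Notation T := (talg V).
Local Notation g v := (tword [:: v] : T).
Local Notation "x '·' y" := (@talg_mul k V x y) (at level 40, left associativity).
Local Notation D := (@talg_left k A V).
Local Notation act := (@talg_act k A V).
Local Notation coact := (@talg_coact k A V).
Local Notation cop := (@talg_cop k A V).
Local Notation sgn := (parity_inv (@talg_deg k V)).

(** D is a module map because the braiding is: the skew term contains the coaction of an acted
    letter u ◁ b, which [yetter_drinfeld] rewrites. *)
Lemma talg_left_act x a : D (act x a) =
  \sw_(a1, a2 <- hcp a) (\sw_(u, y <- D x) cact u a1 ⊗ act y a2).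
Proof.
elim/(@talg_genE k A V): x a => [c x y hx hy||v x h] a.
- rewrite (bilin_talg_act V).1 [LHS]lin_talg_left hx hy (@lin_talg_left k A V c x y).
  by rewrite -(lin_tlift_body (F := fun x a1 a2 => tlift (fun u y => cact u a1 ⊗ act y a2) x) (hcp a)).
- rewrite talg_act1 linZ // talg_left1 scaler0; symmetry; apply: sw_eq0 => *.
  exact: (linear0 (tlift _)).
rewrite talg_actM talg_left_gen; swl; swr.
congr (_ - _); rewrite /skew_left.
under eq_sw => a1 a' do rewrite h.
swl; swr.
transitivity (\sw_(c, b2 <- hcp a) \sw_(a1, b1 <- hcp c) \sw_(u, y <- D x)
    \sw_(w0, w1 <- cco (cact u b1)) w0 ⊗ (g (cact v (a1 * w1)) · act y b2)).
  rewrite hcp_assoc //; do 4!apply: eq_sw => ? ?; by rewrite cactM.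
transitivity (\sw_(c, b2 <- hcp a) \sw_(c1, c2 <- hcp c) \sw_(u, y <- D x)
    \sw_(u0, u1 <- cco u) cact u0 c1 ⊗ (g (cact (cact v u1) c2) · act y b2)).
  apply: eq_sw => c b2; rewrite sw_swap // [RHS]sw_swap //; apply: eq_sw => u y.
  rewrite (yetter_drinfeld (F := fun w0 w1 => w0 ⊗ (g (cact v w1) · act y b2))) //.
  by rewrite [RHS]sw_swap //; do 2!apply: eq_sw => ? ?; rewrite cactM.
rewrite hcp_assoc //; apply: eq_sw => c1 c'; rewrite sw_swap //; apply: eq_sw => u y.
by rewrite sw_swap.
Qed.

(** D is also a comodule map, for the same reason: here the coaction of v ◁ u_1 appears. *)
Lemma talg_left_coact x : \sw_(u, y <- D x) (\sw_(u0, u1 <- cco u)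
    (\sw_(y0, y1 <- coact y) u0 ⊗ (y0 ⊗ (u1 * y1)))) =
  \sw_(x0, x1 <- coact x) (\sw_(u, y <- D x0) u ⊗ (y ⊗ x1)).
Proof.
move: x; apply: talg_gen_ext => // [|v x h].
  by rewrite talg_coact1 swE // talg_left1 !(linear0 (tlift _)).
swl; swr; congr (_ - _).
transitivity (\sw_(u, y <- D x) \sw_(u0, c <- cco u) \sw_(v0, v1 <- cco v)
    \sw_(c1, c2 <- hcp c) \sw_(y0, y1 <- coact y)
      u0 ⊗ ((g (cact v0 c1) · y0) ⊗ (v1 * c2 * y1))).
  apply: eq_sw => u y.
  rewrite (cco_assoc (F := fun u0 c1 c2 => \sw_(w0, w1 <- cco (cact v c2))
    \sw_(y0, y1 <- coact y) u0 ⊗ ((g w0 · y0) ⊗ (c1 * (w1 * y1))))) //.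
  apply: eq_sw => u0 c.
  rewrite -(yetter_drinfeld (F := fun w0 b => \sw_(y0, y1 <- coact y)
    u0 ⊗ ((g w0 · y0) ⊗ (b * y1)))) //.
  by do 3!apply: eq_sw => ? ?; rewrite mulrA.
transitivity (\sw_(v0, v1 <- cco v) tlift3 (fun u y a => \sw_(u0, u1 <- cco u)
    u0 ⊗ ((g (cact v0 u1) · y) ⊗ (v1 * a))) (\sw_(x0, x1 <- coact x) (\sw_(u, y <- D x0) u ⊗ (y ⊗ x1)))); last first.
  by apply: eq_sw => v0 v1; swl.
rewrite -h; swr; rewrite [RHS]sw_swap //; apply: eq_sw => u y.
rewrite sw_swap //; apply: eq_sw => v0 v1; symmetry.
under eq_sw => ? ? do rewrite sw_swap //.
by rewrite cco_assoc //; do 3!apply: eq_sw => ? ?; rewrite mulrA.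
Qed.

(** The skew Leibniz rule: a letter extracted from y first crosses x by the braiding. It is the
    source of the ideal property of ker phi. *)
Lemma talg_left_mul x y : D (x · y) =
  \sw_(u, z <- D x) u ⊗ (z · y) +
  \sw_(v, z <- D y) (\sw_(v0, v1 <- cco v) v0 ⊗ (act (sgn x) v1 · z)).
Proof.
have hm := @talg_mul_bilin k V.
move: x; apply: talg_gen_ext => // [|v x h].
  rewrite talg_mul1x talg_left1 (linear0 (tlift _)) add0r -[LHS]sw_id; apply: eq_sw => v z.
  rewrite talg_sgn1 -(sw_ceps (F := fun v => v ⊗ z)) //; apply: eq_sw => v0 v1.
  by rewrite talg_act1 (linZ _ _ (hm.1 _)) talg_mul1x tpureZr.
rewrite -(talg_mulA) talg_left_gen h talg_sgnM; swl; swr.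
rewrite opprD addrA; congr (_ - _ - _).
  by do 2!apply: eq_sw => ? ?; rewrite talg_mulA.
apply: eq_sw => w z; rewrite cco_assoc //; do 2!apply: eq_sw => ? ?.
by rewrite talg_mulA.
Qed.

Lemma talg_left_sgn x : D (sgn x) = - \sw_(u, y <- D x) u ⊗ sgn y.
Proof.
move: x; apply: talg_gen_ext => // [|v x h].
  by rewrite talg_sgn1 talg_left1 (linear0 (tlift _)) oppr0.
rewrite talg_sgnM linN // !talg_left_gen h; swl; swr.
by rewrite !opprK opprD.
Qed.

(** Coassociativity of the braided coproduct, restricted to a single letter in the first factor. *)
Lemma talg_left_cop x :
  \sw_(y, z <- cop x) (\sw_(u, w <- D y) u ⊗ (w ⊗ z)) =
  \sw_(u, y <- D x) u ⊗ cop y.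
Proof.
move: x; apply: talg_gen_ext => // [|v x h].
  by rewrite talg_cop_word /= swE // talg_left1 !(linear0 (tlift _)).
swl; swr; rewrite opprD addrA; congr (_ + _ + _).
- by rewrite -[cop x in RHS]sw_id (sw_opr (op := @tpure k _ _)).
- congr (- _); transitivity (tlift3 (fun u w z => \sw_(u0, u1 <- cco u)
    u0 ⊗ ((g (cact v u1) · w) ⊗ z)) (\sw_(y, z <- cop x) (\sw_(u, w <- D y) u ⊗ (w ⊗ z)))).
    by swr.
  rewrite h; swl; apply: eq_sw => u y; rewrite sw_swap //.
(* In the term where v is braided past y, D is applied to the coacted element; the comodule property
   moves it inside the coaction, and extracting an odd letter from [sgn y] gives the minus sign. *)
transitivity (tlift3 (fun u w z => - \sw_(u0, u1 <- cco u) \sw_(w0, w1 <- coact (sgn w))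
    u0 ⊗ (w0 ⊗ (g (cact v (u1 * w1)) · z))) (\sw_(y, z <- cop x) (\sw_(u, w <- D y) u ⊗ (w ⊗ z)))).
  swr; rewrite -sw_opp //; apply: eq_sw => y z.
  transitivity (tlift3 (fun u w a => u ⊗ (w ⊗ (g (cact v a) · z)))
     (\sw_(x0, x1 <- coact (sgn y)) (\sw_(u, w <- D x0) u ⊗ (w ⊗ x1)))).
    by swr.
  rewrite -talg_left_coact talg_left_sgn; swl; by [].
rewrite h; swl; congr (- _); apply: eq_sw => u y.
by rewrite sw_swap //; do 3!apply: eq_sw => ? ?; rewrite cactM.
Qed.
End SkewDerivation.

(** * The total braided factorial phi and its recursion *)

Section BraidedFactorial.
Context {k : fieldType} {A : hopfAlgType k} {V : crossedModType A}.
Local Notation T := (talg V).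
Local Notation g v := (tword [:: v] : T).
Local Notation one := (tword [::] : T).
Local Notation "x '·' y" := (@talg_mul k V x y) (at level 40, left associativity).
Local Notation D := (@talg_left k A V).
Local Notation deg := (@talg_deg k V).
Local Notation eps := (@talg_eps k A V).
Local Notation nPsi := (fun z : V ⊗ V => - Psi z).
Let hm := @talg_mul_bilin k V.

Lemma lin_nPsi : linear nPsi.
Proof. by move=> c x y; rewrite linearP opprD scalerN. Qed.

Lemma lin_braided_int n : linear (braided_int nPsi n).
Proof.
rewrite /braided_int; apply: lin_sum => j.
elim: (iota _ _) => [|i s IH] //= c x y; by rewrite IH linearP.
Qed.

Lemma lin_braided_fact n : linear (braided_fact nPsi n).
Proof.
case: n => [|n] //.
exact: (lin_comp (lin_canon (id_tens (braided_fact nPsi n))) (lin_braided_int n.+1)).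
Qed.

(** Collecting the factorials of all lengths into one degree-preserving map replaces the family of
    conditions in [bminus_ker] by the single equation phi x = 0. *)
Definition braided_total : T -> T :=
  wlift (fun s => braided_fact nPsi (size s) (tword s)).
Local Notation phi := braided_total.

Lemma lin_braided_total : linear phi.
Proof. by move=> c x y; rewrite /phi linearP. Qed.
Hint Resolve lin_braided_total lin_braided_int lin_braided_fact : lin.

Lemma braided_total_word s : phi (tword s) = braided_fact nPsi (size s) (tword s).
Proof.
apply: wlift_word => c {}s t u v.
by rewrite tword_multilin lin_braided_fact !size_cat.
Qed.

Lemma braided_total_deg n x : phi (deg n x) = braided_fact nPsi n (deg n x).
Proof.
move: x; apply: word_ext => // s; rewrite talg_deg_word; case: eqP => [<-|_].
  exact: braided_total_word.
by rewrite !lin0.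
Qed.

Lemma braid_at_cons i v x : braid_at nPsi i.+2 (g v · x) = g v · braid_at nPsi i.+1 x.
Proof.
have hb j : linear (braid_at nPsi j) by move=> c y z; rewrite linearP.
move: x; apply: word_ext => // s.
rewrite talg_mul_word !braid_at_word; try exact: lin_nPsi.
rewrite /=; case: (drop i s) => [|u [|w t]]; rewrite ?(lin0 (hm.2 _)) //.
rewrite (sw_opr (op := @talg_mul k V)) //; last exact: word_at_bilin.
by apply: eq_sw => y z; rewrite talg_mul_word.
Qed.

Lemma Psi_pureE (v w : V) : Psi (v ⊗ w) = \sw_(w0, w1 <- cco w) w0 ⊗ cact v w1.
Proof. exact: Psi_pure. Qed.

Lemma braid_at_head v u x : braid_at nPsi 1 (g v · (g u · x)) =
  - \sw_(u0, u1 <- cco u) g u0 · (g (cact v u1) · x).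
Proof.
have hb j : linear (braid_at nPsi j) by move=> c y z; rewrite linearP.
move: x; apply: word_ext => // s.
rewrite !talg_mul_word braid_at_word /=; last exact: lin_nPsi.
have wb : bilin (fun x y : V => tword [:: x, y & s] : T) by exact: (word_at_bilin [::]).
rewrite Psi_pureE (linN (f := tlift _)) // sw_sw //; congr (- _); apply: eq_sw => u0 u1.
by rewrite swE // !talg_mul_word.
Qed.

Definition cons_left (z : V ⊗ T) : T := \sw_(u, y <- z) g u · y.
Lemma lin_cons_left : linear cons_left. Proof. by rewrite /cons_left. Qed.
Hint Resolve lin_cons_left : lin.

(* [braided_int] is Woronowicz's formula for this component of the coproduct. *)
Lemma braided_int_left s : braided_int nPsi (size s) (tword s) = cons_left (D (tword s)).
Proof.
have hb j : linear (braid_at nPsi j) by move=> c y z; rewrite linearP.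
elim: s => [|v s IH]; first by rewrite /braided_int big_ord0 talg_left1 lin0.
have cons_iota x j : foldr (braid_at nPsi) (g v · x) (iota 2 j) =
    g v · foldr (braid_at nPsi) x (iota 1 j).
  have h l : foldr (braid_at nPsi) (g v · x) (map (addn 2) l) =
      g v · foldr (braid_at nPsi) x (map (addn 1) l).
    by elim: l => //= i l ->; exact: braid_at_cons.
  by have := h (iota 0 j); rewrite -!iotaDl.
(* The terms beyond the first have the form Ψ_1 (id ⊗ Ψ_1...Ψ_j), so [n+1] = id + Ψ_1 (id ⊗ [n])
   with -Psi in place of Psi, which is the recursion of D. *)
rewrite /braided_int /= big_ord_recl /= talg_consE talg_left_gen linB //.
rewrite {1}/cons_left swE //; congr (_ + _).
under eq_bigr => j _ do rewrite /bump /= cons_iota.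
rewrite -(linS _ _ _ (hb 1%N)) -(linS _ _ _ (hm.2 _)) -/(braided_int _ _ _) IH.
rewrite /cons_left skew_leftE sw_sw // (sw_opr (op := @talg_mul k V)) // (sw_push (f := braid_at nPsi 1)) //.
rewrite -sw_opp //; apply: eq_sw => u y; rewrite braid_at_head sw_sw //; congr (- _).
by apply: eq_sw => *; rewrite swE.
Qed.

Lemma braided_total_rec x : phi x = (eps x : k) *: one + \sw_(u, y <- D x) g u · phi y.
Proof.
move: x; apply: word_ext => // -[|v s].
  by rewrite talg_left1 (linear0 (tlift _)) addr0 talg_eps_word scale1r braided_total_word.
rewrite talg_eps_word scale0r add0r braided_total_word.
set s' := v :: s; have es : size s' = (size s).+1 by [].
rewrite es [LHS]/= -es braided_int_left /cons_left.
(* D lowers the length by one, so every remainder has length [size s], where phi agrees with the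
   factorial occurring in [braided_fact]. *)
have -> : D (tword s') = \sw_(u, y <- D (tword s')) u ⊗ deg (size s) y.
  by rewrite -(talg_left_deg (size s).+1) talg_deg_word eqxx.
rewrite sw_sw // sw_sw // (sw_push (f := id_tens _)) //.
apply: eq_sw => u y; rewrite !swE //.
rewrite braided_total_deg; move: (deg _ y) => {}y.
move: y; apply: word_ext => // t.
by rewrite talg_mul_word id_tens_word.
Qed.
End BraidedFactorial.

#[global] Hint Extern 0 (GRing.linear_for _ (@braided_total _ _ _)) => refine (@lin_braided_total _ _ _) : lin.
#[global] Hint Extern 0 (GRing.linear_for _ (@cons_left _ _ _)) => refine (@lin_cons_left _ _ _) : lin.
Ltac sw_rule ::= first [sw_rule_A | sw_rule_T].

Section BraidedTotal.
Context {k : fieldType} {A : hopfAlgType k} {V : crossedModType A}.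
Local Notation T := (talg V).
Local Notation g v := (tword [:: v] : T).
Local Notation one := (tword [::] : T).
Local Notation "x '·' y" := (@talg_mul k V x y) (at level 40, left associativity).
Local Notation D := (@talg_left k A V).
Local Notation act := (@talg_act k A V).
Local Notation coact := (@talg_coact k A V).
Local Notation cop := (@talg_cop k A V).
Local Notation deg := (@talg_deg k V).
Local Notation eps := (@talg_eps k A V).
Local Notation phi := (@braided_total k A V).
Let hm := @talg_mul_bilin k V.
Let hT := talg_generated V.

Lemma talg_grading : is_grading deg.
Proof. exact: (bg_grading hT). Qed.

Lemma talg_deg0 x : deg 0%N x = (eps x : k) *: one.
Proof. exact: (bg_deg0 hT). Qed.

Lemma talg_eps_deg n x : eps (deg n.+1 x) = 0.
Proof. exact: (bg_eps_deg hT). Qed.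

Lemma talg_eps1 : eps one = 1. Proof. by rewrite talg_eps_word. Qed.

Lemma talg_eps_gen v x : eps (g v · x) = 0.
Proof. exact: (bg_epsM hT). Qed.

Lemma braided_total1 : phi one = one.
Proof. by rewrite braided_total_word. Qed.

Lemma braided_total_recS n x : phi (deg n.+1 x) = \sw_(u, y <- D x) g u · phi (deg n y).
Proof.
rewrite braided_total_rec talg_eps_deg scale0r add0r talg_left_deg sw_sw //.
by apply: eq_sw => u y; rewrite swE.
Qed.

Lemma deg_braided_total n x : deg n (phi x) = phi (deg n x).
Proof.
elim: n x => [|n IH] x.
  rewrite !talg_deg0 braided_total_rec linD // !linZ // talg_eps1 (sw_push (f := eps)) //.
  rewrite [X in (_ + X)]sw_eq0 => [|u y]; last exact: talg_eps_gen.
  rewrite addr0 braided_total1; congr (_ *: _); exact: mulr1.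
rewrite braided_total_recS braided_total_rec linD // linZ // talg_deg_word scaler0 add0r.
by rewrite (sw_push (f := deg _)) //; apply: eq_sw => u y; rewrite talg_degM IH.
Qed.

Lemma talg_eps_act x a : eps (act x a) = heps a *: eps x.
Proof.
move: x; apply: talg_gen_ext => // [|v x _].
  by rewrite talg_act1 linZ.
rewrite talg_actM (sw_push (f := eps)) // talg_eps_gen scaler0.
by apply: sw_eq0 => *; rewrite talg_eps_gen.
Qed.

(** Induction on the degree: the recursion for phi is built from D, which is a module map, and from
    prefixing a letter. *)
Lemma braided_total_act x a : phi (act x a) = act (phi x) a.
Proof.
move: x; apply: (deg_ext talg_grading) => // n x.
elim: n x a => [|n IH] x a.
  by rewrite talg_deg0 (linZ _ _ (lin_talg_act_l a)) !linZ // braided_total1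
     (linZ _ _ (lin_talg_act_l a)) talg_act1 linZ // braided_total1.
rewrite braided_total_recS braided_total_rec talg_eps_act talg_eps_deg scaler0 scale0r add0r.
rewrite talg_left_act talg_left_deg; swl; swr; rewrite sw_swap //.
by do 2!apply: eq_sw => ? ?; rewrite IH.
Qed.

Lemma talg_eps_coact x : \sw_(x0, x1 <- coact x) (eps x0 : k) *: x1 = (eps x : k) *: 1.
Proof.
move: x; apply: talg_gen_ext => // [|v x _].
  by rewrite talg_coact1 swE.
rewrite talg_coactM talg_eps_gen scale0r; swl.
by do 2!apply: sw_eq0 => ? ?; rewrite talg_eps_gen scale0r.
Qed.

Lemma braided_total_coact x : coact (phi x) = \sw_(x0, x1 <- coact x) phi x0 ⊗ x1.
Proof.
move: x; apply: (deg_ext talg_grading) => // n x.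
elim: n x => [|n IH] x.
  by rewrite talg_deg0 !linZ // braided_total1 talg_coact1 swE // braided_total1.
rewrite braided_total_recS.
under [RHS]eq_sw => x0 x1 do rewrite braided_total_rec tpureDl tpureZl -tpureZr.
rewrite sw_add // -[X in _ = X + _](sw_push (f := @tpure k T A one)) // talg_eps_coact.
rewrite talg_eps_deg scale0r tpure0r add0r.
transitivity (tlift3 (fun u y a => (g u · phi y) ⊗ a)
   (\sw_(x0, x1 <- coact (deg n.+1 x)) (\sw_(u, y <- D x0) u ⊗ (y ⊗ x1)))); last first.
  by swl; apply: eq_sw => x0 x1; swr.
rewrite -talg_left_coact talg_left_deg; swl; swr.
do 2!apply: eq_sw => ? ?; rewrite IH sw_sw //.
by apply: eq_sw => *; rewrite swE.
Qed.

Lemma talg_eps_sgn x : eps (parity_inv deg x) = eps x.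
Proof.
move: x; apply: talg_gen_ext => // [|v x _]; first by rewrite talg_sgn1.
by rewrite talg_sgnM linN // !talg_eps_gen oppr0.
Qed.

Lemma talg_counitl x : \sw_(y, z <- cop x) (eps y : k) *: z = x.
Proof.
move: x; apply: talg_gen_ext => // [|v x h].
  by rewrite talg_cop_word /= swE // talg_eps1 scale1r.
rewrite -[in RHS]h talg_copM; swl.
rewrite [X in X + _]sw_eq0 => [|y z]; last by rewrite talg_eps_gen scale0r.
rewrite add0r (sw_opr (op := @talg_mul k V)) //; apply: eq_sw => y z.
rewrite (linZ _ _ (hm.2 _)) -[in RHS](talg_eps_sgn y).
transitivity ((fun a => g (cact v a) · z) (\sw_(y0, y1 <- coact (parity_inv deg y)) (eps y0 : k) *: y1)).
  rewrite (sw_push (f := fun a => g (cact v a) · z)) //; apply: eq_sw => y0 y1.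
  by rewrite (linZ (f := fun a => g (cact v a) · z)).
by rewrite talg_eps_coact (linZ (f := fun a => g (cact v a) · z)) // cact1.
Qed.

(** A cut either has empty prefix or begins with [v] and continues with a cut of the rest. No
    braiding occurs: phi transfers all of it from the coproduct to the product of letters. *)
Fixpoint word_deconcat (s : seq V) : T ⊗ T :=
  if s is v :: t then one ⊗ tword (v :: t) + \sw_(a, b <- word_deconcat t) (g v · a) ⊗ b
  else one ⊗ one.

Definition talg_deconcat : T -> T ⊗ T := wlift word_deconcat.

Lemma lin_talg_deconcat : linear talg_deconcat.
Proof. by move=> c x y; rewrite /talg_deconcat linearP. Qed.
Hint Resolve lin_talg_deconcat : lin.

Lemma word_deconcat_multilin : multilin word_deconcat.
Proof.
move=> c s; elim: s => [|w s IH] t u v /=.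
  rewrite (tword_multilin c [::]) tpure_linear_r scalerDr -!addrA; congr (_ + _).
  have hl z : linear (fun v : V => \sw_(a, b <- z) (g v · a) ⊗ b :> T ⊗ T) by [].
  by rewrite hl addrCA.
rewrite IH (tword_multilin c (w :: s)) tpure_linear_r linearP scalerDr -!addrA; congr (_ + _).
by rewrite addrCA.
Qed.

Lemma talg_deconcat1 : talg_deconcat one = one ⊗ one.
Proof. by rewrite /talg_deconcat wlift_word //; exact: word_deconcat_multilin. Qed.

Lemma talg_deconcat_gen v x : talg_deconcat (g v · x) =
  one ⊗ (g v · x) + \sw_(a, b <- talg_deconcat x) (g v · a) ⊗ b.
Proof.
move: x; apply: word_ext => // s.
by rewrite talg_mul_word /talg_deconcat !wlift_word //; exact: word_deconcat_multilin.
Qed.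

(** Both sides obey the same recursion on the first letter. If phi x = 0, the right side vanishes,
    and this is how the coproduct is shown to descend to the quotient. *)
Lemma braided_total_cop x : talg_deconcat (phi x) = \sw_(y, z <- cop x) phi y ⊗ phi z.
Proof.
move: x; apply: (deg_ext talg_grading) => // n x.
elim: n x => [|n IH] x.
  rewrite talg_deg0 !linZ // braided_total1 talg_deconcat1 talg_cop_word /= swE //.
  by rewrite braided_total1.
rewrite [in LHS]braided_total_recS.
under [RHS]eq_sw => y z do rewrite braided_total_rec tpureDl tpureZl -tpureZr -[_ *: phi z]linZ //.
rewrite sw_add //.
(* The counit term in the recursion for phi y accounts for the cut with empty prefix. *)
rewrite -[X in _ = X + _](sw_push (f := fun z => one ⊗ phi z)) // talg_counitl.
rewrite braided_total_recS (sw_push (f := talg_deconcat)) //.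
under eq_sw => u y do rewrite talg_deconcat_gen IH.
rewrite sw_add // (sw_opr (op := @tpure k T T)) //; congr (_ + _).
transitivity (tlift3 (fun u y z => (g u · phi y) ⊗ phi z)
   (\sw_(y, z <- cop (deg n.+1 x)) (\sw_(u, w <- D y) u ⊗ (w ⊗ z)))); last first.
  by swl; apply: eq_sw => x0 x1; swr.
rewrite talg_left_cop talg_left_deg; swl; swr.
by [].
Qed.
End BraidedTotal.

(** * Factoring a linear map through another, and quotient spaces *)

Section LinearFactor.
Context {k : fieldType} {V W U : lmodType k}.
Variables (f : V -> W) (h : V -> U).
Hypotheses (hf : linear f) (hh : linear h) (hker : forall v, f v = 0 -> h v = 0).

(* Partially defined maps are encoded as linear relations; single-valuedness
   follows from the agreement with h, applied at v = 0. *)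
Let partial (G : set (W * U)) := [/\ G (0, 0),
  forall c p q, G p -> G q -> G (c *: p.1 + q.1, c *: p.2 + q.2) &
  forall w u v, G (w, u) -> w = f v -> u = h v].

Let maximal_partial : exists2 G, partial G &
  forall G', partial G' -> (G `<=` G')%classic -> (G' `<=` G)%classic.
Proof.
pose P (G : set (W * U)) := G = set0 \/ partial G.
have [F FP Ftot|G [GP Gmax]] := @Zorn_bigcup _ P.
  have [[X [FX pX]]|noX] := pselect (exists X, F X /\ partial X); last first.
    left; apply/seteqP; split=> // p [X FX Xp]; case: (FP X FX) => [X0|pX].
      by rewrite X0 in Xp.
    by case: noX; exists X.
  right; split.
  - by exists X => //; case: pX.
  - move=> c p q [Y FY Yp] [Z FZ Zq].
    have pY : partial Y by case: (FP Y FY) => // Y0; rewrite Y0 in Yp.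
    have pZ : partial Z by case: (FP Z FZ) => // Z0; rewrite Z0 in Zq.
    case: (Ftot Y Z FY FZ) => sub.
      by exists Z => //; case: pZ => _ + _; apply => //; exact: sub.
    by exists Y => //; case: pY => _ + _; apply => //; exact: sub.
  - move=> w u v [Y FY Yp]; have pY : partial Y by case: (FP Y FY) => // Y0; rewrite Y0 in Yp.
    by case: pY => _ _; apply.
have pG : partial G.
  case: GP => // G0; exfalso; apply: (Gmax [set (0, 0)]%classic).
    by rewrite G0; split=> // /(_ (0, 0)); apply.
  right; split=> //= [c p q -> ->|w u v [-> ->] e]; first by rewrite /= !scaler0 !addr0.
  by rewrite hker.
exists G => // G' pG' sub p G'p; apply: contrapT => nGp.
apply: (Gmax G'); last by right.
by split=> // /(_ p G'p).
Qed.

(** On the image of [f] the value is forced, consistently by [hker]; maximality extends it to all of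
    W, so that the factor can be applied to any tensor leg. *)
Lemma linear_factor : exists2 g : W -> U, linear g & forall v, g (f v) = h v.
Proof.
have [G [G0 Glin Gh] Gmax] := maximal_partial.
have Gext w0 u0 : (forall c w u v, G (w, u) -> c *: w0 + w = f v -> c *: u0 + u = h v) ->
    G (w0, u0).
  move=> compat; pose G' := [set p : W * U | exists c w u,
    [/\ G (w, u), p.1 = c *: w0 + w & p.2 = c *: u0 + u]]%classic.
  apply: (Gmax G'); first split.
  - by exists 0, 0, 0; rewrite !scale0r !addr0.
  - move=> c p q [c1 [w1 [u1 [G1 -> ->]]]] [c2 [w2 [u2 [G2 -> ->]]]].
    exists (c * c1 + c2), (c *: w1 + w2), (c *: u1 + u2); split.
    + exact: (Glin c _ _ G1 G2).
    + by rewrite /= scalerDr scalerDl scalerA addrACA.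
    + by rewrite /= scalerDr scalerDl scalerA addrACA.
  - by move=> w u v [c [w1 [u1 [G1 /= -> ->]]]]; apply: compat.
  - by move=> [w u] Gwu; exists 0, w, u; rewrite !scale0r !add0r.
  - by exists 1, 0, 0; rewrite !scale1r !addr0.
have Gf v : G (f v, h v).
  apply: Gext => c w u v' Gwu e.
  have -> : u = h (v' - c *: v).
    by apply: (Gh w) => //; rewrite linB // linZ // -e addrAC subrr add0r.
  by rewrite linB // linZ // addrC subrK.
have Gtot w : exists u, G (w, u).
  (* Outside the domain the value 0 is tried. It can clash with [h] only if some multiple of w with
     c nonzero, plus a domain element, lies in the image of [f]; then w already has the value c^-1
     (h v - u). *)
  apply: contrapT => no; apply: (no); exists 0; apply: Gext => c w' u v Gwu e.
  have [c0|c0] := eqVneq c 0.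
    by move: e; rewrite c0 !scale0r !add0r; apply: Gh.
  exfalso; apply: (no); exists (c^-1 *: (h v - u)).
  have := Glin (- 1) _ _ Gwu (Gf v) => /(Glin c^-1 _ _)/(_ G0) /=.
  rewrite !addr0 !scaleN1r !(addrC (- _)) -e.
  by rewrite addrK scalerA mulVf // scale1r.
have Gfun w u u' : G (w, u) -> G (w, u') -> u = u'.
  move=> h1 h2; have /= := Glin (-1) _ _ h1 h2; rewrite !scaleN1r addNr => e0.
  have := Gh _ _ 0 e0; by rewrite !lin0 // => /(_ erefl)/eqP; rewrite addrC subr_eq0 => /eqP.
pose g w := projT1 (cid (Gtot w)).
have gG w : G (w, g w) by apply: (projT2 (cid (Gtot w))).
exists g => [c x y|v]; last exact: Gfun (gG _) (Gf v).
exact: Gfun (gG _) (Glin c _ _ (gG x) (gG y)).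
Qed.
End LinearFactor.

Section QuotientMap.
Context {k : fieldType} {M : lmodType k} (N : M -> Prop).

Lemma lin_quo_proj : linear (@quo_proj k M N).
Proof.
move=> c u v; have := pgen_respects (QuoLin N c u v).
rewrite /fsum !big_cons big_nil /= scale1r scaleNr scaleN1r addr0.
by rewrite -opprD => /eqP; rewrite subr_eq0 => /eqP.
Qed.

Lemma quo_proj0 u : N u -> quo_proj N u = 0.
Proof.
by move=> h; have := pgen_respects (QuoSub h); rewrite /fsum big_seq1 scale1r.
Qed.

Lemma quo_surj (x : quo N) : exists u, x = quo_proj N u.
Proof.
move: x; apply: pclassW => s; rewrite pres_piE.
elim: s => [|[c u] s [v IH]]; rewrite /fsum ?big_nil ?big_cons.
  by exists 0; rewrite (lin0 lin_quo_proj).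
by exists (c *: u + v); rewrite lin_quo_proj; congr (_ + _).
Qed.

Lemma quo_liftP (U : lmodType k) (f : M -> U) u : linear f ->
  (forall v, N v -> f v = 0) -> quo_lift (N := N) f (quo_proj N u) = f u.
Proof. by move=> hf; exact: (quo_liftE (f := linear_of hf)). Qed.

Lemma lin_quo_lift (U : lmodType k) (f : M -> U) : linear (quo_lift (N := N) f).
Proof. by move=> c x y; rewrite linearP. Qed.
End QuotientMap.
#[global] Hint Extern 0 (GRing.linear_for _ (@quo_proj _ _ _)) => refine (@lin_quo_proj _ _ _) : lin.
#[global] Hint Extern 0 (GRing.linear_for _ (@quo_lift _ _ _ _ _)) => refine (@lin_quo_lift _ _ _ _ _) : lin.

(** * The kernel of phi is a two-sided ideal *)

Section KernelIdeal.
Context {k : fieldType} {A : hopfAlgType k} {V : crossedModType A}.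
Local Notation T := (talg V).
Local Notation g v := (tword [:: v] : T).
Local Notation "x '·' y" := (@talg_mul k V x y) (at level 40, left associativity).
Local Notation D := (@talg_left k A V).
Local Notation act := (@talg_act k A V).
Local Notation deg := (@talg_deg k V).
Local Notation eps := (@talg_eps k A V).
Local Notation phi := (@braided_total k A V).
Local Notation B := (quo (bminus_ker (V := V))).
Local Notation q := (quo_proj (bminus_ker (V := V)) : T -> B).
Let hm := @talg_mul_bilin k V.

Lemma bminus_kerE x : bminus_ker x <-> phi x = 0.
Proof.
have e n : braided_fact (fun z : V ⊗ V => - Psi z) n (deg n x) = deg n (phi x).
  by rewrite deg_braided_total braided_total_deg.
split=> [h|h n]; last by rewrite [LHS]e h lin0.
have [N hN] := deg_fin talg_grading (phi x).
by rewrite (deg_sum talg_grading hN) big1 // => i _; rewrite -e; exact: h.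
Qed.

Lemma bminus_proj0 x : phi x = 0 -> q x = 0.
Proof. by move=> h; apply: quo_proj0; apply/bminus_kerE. Qed.

(** Having [r] on all of T, and not only on the image of phi, is what permits its use inside tensor
    products. *)
Lemma bminus_factor : exists2 r : T -> B, linear r & forall x, r (phi x) = q x.
Proof. by apply: linear_factor => // x; exact: bminus_proj0. Qed.

(* The kernel of id ⊗ phi is W ⊗ ker phi; [bminus_factor] provides the flatness
   of W. *)
Lemma sw_kernel (W U : lmodType k) (F : W -> T -> U) z : bilin F ->
  (forall v y, phi y = 0 -> F v y = 0) ->
  \sw_(v, y <- z) v ⊗ phi y = 0 -> tlift F z = 0.
Proof.
move=> hF F0 z0; have [r hr rE] := bminus_factor.
pose G v (b : B) : U := quo_lift (N := bminus_ker (V := V)) (F v) b.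
have GE v y : G v (q y) = F v y.
  by rewrite /G quo_liftP // => u /bminus_kerE; exact: F0.
have hG : bilin G.
  split=> [b|v]; last exact: lin_quo_lift.
  by have [y ->] := quo_surj b => c u v; rewrite !GE hF.1.
transitivity (tlift (fun v t => G v (r t)) (\sw_(v, y <- z) v ⊗ phi y)).
  by rewrite sw_sw //; apply: eq_sw => v y; rewrite swE // rE GE.
by rewrite z0 (linear0 (tlift _)).
Qed.

Fixpoint word_split (s : seq V) : V ⊗ T := if s is v :: t then v ⊗ tword t else 0.
(** Prefixing a letter embeds V ⊗ T into T, so Σ u·phi(y) = 0 in T can be lifted to Σ u ⊗ phi(y) =
    0. *)
Lemma cons_leftK z : wlift word_split (cons_left z) = z.
Proof.
have hw : multilin word_split.
  by move=> c [|w s] t u v /=; rewrite ?tpure_linear_l ?tword_multilin ?tpure_linear_r.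
have hs : linear (wlift word_split) by move=> c x y; rewrite linearP.
move: z; apply: sw_ext => // v y; rewrite /cons_left swE //.
by move: y; apply: word_ext => // s; rewrite talg_mul_word wlift_word.
Qed.

Lemma eps_braided_total x : eps (phi x) = eps x.
Proof.
rewrite braided_total_rec linD // linZ // talg_eps1 (sw_push (f := eps)) //.
rewrite sw_eq0 => [|u y]; last exact: talg_eps_gen.
by rewrite addr0; exact: mulr1.
Qed.

(** The counit of x equals that of phi x and so vanishes; the recursion then leaves Σ u·phi(y) = 0,
    and prefixing is injective. *)
Lemma talg_left_kernel x : phi x = 0 -> \sw_(u, y <- D x) u ⊗ phi y = 0.
Proof.
move=> h; have e : eps x = 0 by rewrite -eps_braided_total h lin0.
rewrite -[LHS]cons_leftK /cons_left sw_sw //.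
have := braided_total_rec x; rewrite h e scale0r add0r => h0.
rewrite -[X in wlift _ X](_ : 0 = _) ?linear0 // [LHS]h0.
by apply: eq_sw => u y; rewrite swE.
Qed.

Lemma talg_deg_act n x a : deg n (act x a) = act (deg n x) a.
Proof.
elim/(@talg_genE k A V): x n a => [c x y hx hy||v x h] n a.
- by rewrite (bilin_talg_act V).1 !lin_tdeg hx hy (bilin_talg_act V).1.
- rewrite talg_act1 linZ // talg_deg_word; case: n => [|n] /=; first by rewrite talg_act1.
  by rewrite scaler0 (lin0 (lin_talg_act_l a)).
rewrite talg_actM talg_degM (sw_push (f := deg n)) //; case: n => [|n].
  by rewrite (lin0 (lin_talg_act_l a)); apply: sw_eq0 => *; rewrite talg_degM.
by rewrite talg_actM; apply: eq_sw => *; rewrite talg_degM h.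
Qed.

Lemma talg_epsM x y : eps (x · y) = eps x * eps y.
Proof.
elim/(@talg_genE k A V): x => [c x x' h h'||v x h].
- by rewrite hm.1 !(lin_talg_eps (V := V)) h h' mulrDl scalerAl.
- by rewrite talg_mul1x talg_eps1 mul1r.
by rewrite -talg_mulA !talg_eps_gen mul0r.
Qed.

(** Induction on i + j: by the skew Leibniz rule D takes a letter from x or from y, so the total
    degree drops. Sign and action preserve both the degree and ker phi. *)
Lemma kernel_ideal_deg i j x y : phi (deg i x) = 0 \/ phi (deg j y) = 0 ->
  phi (deg i x · deg j y) = 0.
Proof.
have [n hn] : exists n, (i + j < n)%N by exists (i + j).+1.
elim: n i j x y hn => [//|n IH] i j x y hn hxy.
have hs : linear (parity_inv deg) by [].
have sgn0 z : phi (deg i z) = 0 -> phi (parity_inv deg (deg i z)) = 0.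
  by move=> h; rewrite (parity_inv_deg talg_grading) linZ // h scaler0.
have act0 z a : phi z = 0 -> phi (act z a) = 0.
  by move=> h; rewrite braided_total_act h (lin0 (lin_talg_act_l a)).
have degact a : act (parity_inv deg (deg i x)) a = deg i (act (parity_inv deg (deg i x)) a).
  by rewrite talg_deg_act (deg_parity_inv talg_grading) (degK talg_grading) eqxx.
have phideg m z : phi z = 0 -> phi (deg m z) = 0.
  by move=> h; rewrite -deg_braided_total h lin0.
rewrite braided_total_rec talg_epsM.
have -> : eps (deg i x) * eps (deg j y) = 0.
  by rewrite -eps_braided_total -[eps (deg j y)]eps_braided_total;
    case: hxy => ->; rewrite lin0 ?mul0r ?mulr0.
rewrite scale0r add0r talg_left_mul sw_argD.
rewrite [X in X + _](_ : _ = 0) ?add0r; last first.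
  rewrite sw_sw //.
  case: i hn hxy sgn0 degact => [|i] hn hxy _ _.
    by rewrite talg_left_deg (linear0 (tlift _)).
  (* Duplicating the projection lets one copy pass through D to the remainder, while the hypothesis
     still speaks of the other. *)
  have ex : deg i.+1 x = deg i.+1 (deg i.+1 x) by rewrite (degK talg_grading) eqxx.
  rewrite [X in D X]ex.
  rewrite talg_left_deg sw_sw //.
  transitivity (\sw_(u, z <- D (deg i.+1 x)) g u · phi (deg i z · deg j y)).
    by apply: eq_sw => u z; rewrite !swE.
  (* For the factor that D takes apart, membership in the kernel is known only for the whole sum,
     hence [sw_kernel]; for the other factor it holds term by term. *)
  case: hxy => [hx|hy].
    apply: sw_kernel => // [u z hz|]; last exact: talg_left_kernel.
    by rewrite IH ?(lin0 (hm.2 _)) //; left; apply: phideg.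
  apply: sw_eq0 => u z; rewrite IH ?(lin0 (hm.2 _)) //; by right.
rewrite sw_sw //.
case: j hn hxy => [|j] hn hxy.
  by rewrite talg_left_deg (linear0 (tlift _)).
have ey : deg j.+1 y = deg j.+1 (deg j.+1 y) by rewrite (degK talg_grading) eqxx.
rewrite [X in D X]ey.
rewrite talg_left_deg sw_sw //.
transitivity (\sw_(v, z <- D (deg j.+1 y)) \sw_(v0, v1 <- cco v)
    g v0 · phi (act (parity_inv deg (deg i x)) v1 · deg j z)).
  by apply: eq_sw => v z; rewrite swE // sw_sw //; apply: eq_sw => *; rewrite swE.
have hn' : (i + j < n)%N by rewrite addnS in hn.
case: hxy => [hx|hy].
  apply: sw_eq0 => v z; apply: sw_eq0 => v0 v1.
  rewrite degact IH ?(lin0 (hm.2 _)) //; left.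
  by rewrite -degact; apply: act0; apply: sgn0.
apply: sw_kernel => // [v z hz|]; last exact: talg_left_kernel.
apply: sw_eq0 => v0 v1; rewrite degact IH ?(lin0 (hm.2 _)) //; right; exact: phideg.
Qed.

Lemma kernel_idealr x y : phi x = 0 -> phi (x · y) = 0.
Proof.
move=> h; have h' n : phi (deg n x) = 0 by rewrite -deg_braided_total h lin0.
have [N hN] := deg_fin talg_grading x; have [M hM] := deg_fin talg_grading y.
rewrite (deg_sum talg_grading hN) (deg_sum talg_grading hM) (linS _ _ _ (hm.1 _)) linS //.
apply: big1 => i _; rewrite (linS _ _ _ (hm.2 _)) linS //; apply: big1 => j _.
by apply: kernel_ideal_deg; left.
Qed.

Lemma kernel_ideall x y : phi y = 0 -> phi (x · y) = 0.
Proof.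
move=> h; have h' n : phi (deg n y) = 0 by rewrite -deg_braided_total h lin0.
have [N hN] := deg_fin talg_grading x; have [M hM] := deg_fin talg_grading y.
rewrite (deg_sum talg_grading hN) (deg_sum talg_grading hM) (linS _ _ _ (hm.1 _)) linS //.
apply: big1 => i _; rewrite (linS _ _ _ (hm.2 _)) linS //; apply: big1 => j _.
by apply: kernel_ideal_deg; right.
Qed.
End KernelIdeal.

(** * The operations descend to B_-(V) *)

Section BminusGenerated.
Context {k : fieldType} {A : hopfAlgType k} (V : crossedModType A).
Local Notation T := (talg V).
Local Notation "x '·' y" := (@talg_mul k V x y) (at level 40, left associativity).
Local Notation act := (@talg_act k A V).
Local Notation coact := (@talg_coact k A V).
Local Notation cop := (@talg_cop k A V).
Local Notation deg := (@talg_deg k V).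
Local Notation eps := (@talg_eps k A V).
Local Notation phi := (@braided_total k A V).
Local Notation B := (Bminus V).
Local Notation q := (quo_proj (bminus_ker (V := V)) : T -> B).
Let hm := @talg_mul_bilin k V.

Lemma lin_bminus_proj : linear q. Proof. exact: lin_quo_proj. Qed.
Hint Resolve lin_bminus_proj : lin.

Lemma bminus_surj (b : B) : exists x, b = q x. Proof. exact: quo_surj. Qed.

Lemma bminus_lift (U : lmodType k) (f : T -> U) x : linear f ->
  (forall y, phi y = 0 -> f y = 0) ->
  quo_lift (N := bminus_ker (V := V)) f (q x) = f x.
Proof. by move=> hf f0; rewrite quo_liftP // => u /bminus_kerE; exact: f0. Qed.

Lemma bminus_degE n x : bs_deg n (q x) = q (deg n x).
Proof.
apply: bminus_lift => // y h; apply: bminus_proj0.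
by rewrite -deg_braided_total h lin0.
Qed.

Lemma bminus_actE x a : bs_act (q x) a = q (act x a).
Proof.
apply: (bminus_lift (f := fun x => q (act x a))) => // y h; apply: bminus_proj0.
by rewrite braided_total_act h (lin0 (lin_talg_act_l a)).
Qed.

Lemma bminus_coactE x : bs_coact (q x) = \sw_(x0, x1 <- coact x) q x0 ⊗ x1.
Proof.
have [r hr rE] := bminus_factor (V := V).
apply: (bminus_lift (f := fun x => \sw_(x0, x1 <- coact x) q x0 ⊗ x1)) => // y h.
transitivity (\sw_(t, a <- \sw_(x0, x1 <- coact y) phi x0 ⊗ x1) r t ⊗ a).
  by rewrite sw_sw //; apply: eq_sw => *; rewrite swE // rE.
by rewrite -braided_total_coact h lin0 // (linear0 (tlift _)).
Qed.

Lemma bminus_mulE x y : bs_mul (q x) (q y) = q (x · y).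
Proof.
have e z : quo_lift (N := bminus_ker (V := V)) (fun y => q (z · y)) (q y) = q (z · y).
  by apply: bminus_lift => // u h; apply: bminus_proj0; apply: kernel_ideall.
(* The product is a lift of lifts: the inner one must be evaluated for every z before the outer one
   has a recognisable linear argument. *)
have e2 : (fun z => quo_lift (N := bminus_ker (V := V)) (fun y => q (z · y)) (q y)) = (fun z => q (z · y)).
  exact/funext.
rewrite /bs_mul /= e2; apply: (bminus_lift (f := fun z => q (z · y))) => // u h.
by apply: bminus_proj0; apply: kernel_idealr.
Qed.

(** For y in ker phi, the sum Σ phi(y_1) ⊗ phi(y_2) is the deconcatenation of phi y, hence 0;
    applying [r] to both factors turns it into the sum of classes. *)
Lemma bminus_copE x : bs_cop (q x) = \sw_(y, z <- cop x) q y ⊗ q z.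
Proof.
have [r hr rE] := bminus_factor (V := V).
apply: (bminus_lift (f := fun x => \sw_(y, z <- cop x) q y ⊗ q z)) => // y h.
transitivity (\sw_(t, u <- \sw_(y, z <- cop y) phi y ⊗ phi z) r t ⊗ r u).
  by rewrite sw_sw //; apply: eq_sw => *; rewrite swE // !rE.
rewrite -braided_total_cop h (lin0 (@lin_talg_deconcat k A V)).
by rewrite (linear0 (tlift _)).
Qed.

Lemma bminus_epsE x : bs_eps (q x) = eps x.
Proof. by apply: (bminus_lift (f := eps)) => // y h; rewrite -eps_braided_total h lin0. Qed.

Lemma bminus_deg_linear n : linear (@bs_deg k A B n).
Proof. by move=> c x y; rewrite /bs_deg /= linearP. Qed.

Lemma bminus_grading : is_grading (@bs_deg k A B).
Proof.
split; first exact: bminus_deg_linear.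
  move=> m n b; have [x ->] := bminus_surj b.
  rewrite !bminus_degE (degK talg_grading); case: eqP => // _; exact: lin0.
move=> b; have [x ->] := bminus_surj b; have [N hN] := deg_fin talg_grading x.
exists N; rewrite {1}(deg_sum talg_grading hN) linS //; apply: eq_bigr => i _.
by rewrite bminus_degE.
Qed.

Lemma bminus_sgnE x : parity_inv (@bs_deg k A B) (q x) = q (parity_inv deg x).
Proof.
have hl := parity_inv_linear bminus_grading.
have hl2 : linear (fun x => parity_inv (@bs_deg k A B) (q x)) by exact: (lin_comp hl).
have hl3 : linear (fun x => q (parity_inv deg x)) by [].
move: x; apply: (deg_ext talg_grading) => // n x.
by rewrite -bminus_degE (parity_inv_deg bminus_grading) (parity_inv_deg talg_grading) linZ // bminus_degE.
Qed.

Lemma bminus_mul_bilin : bilin (@bs_mul k A B).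
Proof.
split=> [b|b] c x y; have [u ->] := bminus_surj x; have [v ->] := bminus_surj y;
  have [w ->] := bminus_surj b; rewrite -lin_bminus_proj !bminus_mulE.
  by rewrite hm.1 lin_bminus_proj.
by rewrite hm.2 lin_bminus_proj.
Qed.

Lemma bminus_act_bilin : bilin (@bs_act k A B).
Proof.
split=> [a|b] c x y; last first.
  have [w ->] := bminus_surj b; rewrite !bminus_actE -lin_bminus_proj.
  by rewrite (bilin_talg_act V).2.
have [u ->] := bminus_surj x; have [v ->] := bminus_surj y.
by rewrite -lin_bminus_proj !bminus_actE (bilin_talg_act V).1 lin_bminus_proj.
Qed.

Lemma bminus_coact_linear : linear (@bs_coact k A B).
Proof. by move=> c x y; rewrite /bs_coact /= linearP. Qed.

Lemma bminus_in_linear : linear (@bminus_in k A V).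
Proof. by rewrite /bminus_in. Qed.

Let bminus_sgn_linear : linear (parity_inv (@bs_deg k A B)).
Proof. exact: parity_inv_linear bminus_grading. Qed.
Hint Resolve bminus_mul_bilin bminus_coact_linear bminus_in_linear bminus_sgn_linear : lin.

Lemma bminus_generated : @bs_generated k A V B (@bminus_in k A V).
Proof.
split.
- exact: bminus_in_linear.
- exact: bminus_deg_linear.
- exact: bminus_mul_bilin.
- exact: bminus_act_bilin.
- exact: bminus_coact_linear.
- by move=> c x y; rewrite /bs_cop /= linearP.
- by move=> c x y; rewrite /bs_eps /= linearP.
- move=> x y z; have [u ->] := bminus_surj x; have [v ->] := bminus_surj y.
  by have [w ->] := bminus_surj z; rewrite !bminus_mulE talg_mulA.
- by move=> x; have [u ->] := bminus_surj x; rewrite bminus_mulE talg_mul1x.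
- by move=> x; have [u ->] := bminus_surj x; rewrite bminus_mulE talg_mulx1.
- move=> n; rewrite bminus_degE talg_deg_word; case: n => //= n; exact: lin0.
- move=> n v x; have [u ->] := bminus_surj x; rewrite bminus_mulE bminus_degE talg_degM.
  by case: n => [|n]; rewrite ?bminus_degE ?bminus_mulE //; exact: lin0.
- by move=> a; rewrite bminus_actE talg_act1 linZ.
- move=> v x a; have [u ->] := bminus_surj x; rewrite bminus_mulE bminus_actE talg_actM.
  by rewrite (sw_push (f := q)) //; apply: eq_sw => *; rewrite bminus_actE bminus_mulE.
- by rewrite bminus_coactE talg_coact1 swE.
- move=> v x; have [u ->] := bminus_surj x; rewrite bminus_mulE !bminus_coactE talg_coactM.
  rewrite sw_sw //; apply: eq_sw => v0 v1; rewrite sw_sw // sw_sw //.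
  by apply: eq_sw => *; rewrite !swE // bminus_mulE.
- by rewrite bminus_copE talg_cop_word /= swE.
- move=> v x; have [u ->] := bminus_surj x; rewrite bminus_mulE !bminus_copE talg_copM.
  rewrite !sw_sw //; apply: eq_sw => y z.
  rewrite sw_argD swE // [RHS]swE // bminus_mulE sw_sw //; congr (_ + _).
  rewrite bminus_sgnE bminus_coactE sw_sw //.
  by apply: eq_sw => *; rewrite !swE // bminus_mulE.
- by rewrite bminus_epsE talg_eps_word.
- by move=> v x; have [u ->] := bminus_surj x; rewrite bminus_mulE bminus_epsE talg_eps_gen.
move=> P hlin h1 hM x; have [u ->] := bminus_surj x.
elim/(@talg_genE k A V): u => // [c y z hy hz|v y hy].
  by rewrite lin_bminus_proj; apply: hlin.
by rewrite -bminus_mulE; apply: hM.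
Qed.
End BminusGenerated.

(** [2, -Psi] = id - Psi annihilates theta ⊗ theta, so this word lies in the subspace divided
    out. *)
Lemma bminus_in_sq (k : fieldType) (A : hopfAlgType k) (V : crossedModType A) (theta : V) :
  Psi (theta ⊗ theta) = theta ⊗ theta ->
  bs_mul (bminus_in theta) (bminus_in theta) = 0.
Proof.
move=> h.
rewrite /bminus_in (bminus_mulE (tword [:: theta]) (tword [:: theta])) talg_mul_word.
apply: bminus_proj0; rewrite braided_total_word /= /braided_int big_ord_recl big_ord_recl big_ord0.
rewrite /= braid_at_word ?lin_nPsi //=.
rewrite h (linN (f := tlift _)) // swE //; last exact: (word_at_bilin [::] [::]).
by rewrite addr0 subrr linear0.
Qed.

Theorem proposition3p9 (k : fieldType) (char_k : 2%N \notin [pchar k])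
    (A : hopfAlgType k) (S_bij : bijective (hS : A -> A))
    (L1 : crossedModType A) (theta : L1)
    (theta_cotensor : cotensor (ccoact theta - theta ⊗ (1 : A)))
    (Psi_theta : forall eta : L1, Psi (eta ⊗ theta) = theta ⊗ eta)
    (anticomm_theta : forall eta : L1,
       anticommutator (bminus_inA (ccoact theta - theta ⊗ (1 : A)))
                      (bminus_inA (ccoact eta)) = 0) :
  let Lambda := Bminus L1 in
  let Omega := bosonisation Lambda in
  let omega := fun a : A => bminus_in (cact theta a) in
  let delta := scomm (@bs_deg k A Lambda) (@bs_mul k A Lambda)
                 (bminus_in theta) in
  let d : Omega -> Omega := boson_diff omega delta in
  strongly_bicovariant_exterior_algebra (@boson_base k A Lambda) d /\
  inner_via d ((1 : A) ⊗ bminus_in theta).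
Proof.
move=> Lambda Omega omega delta d.
have hL := bminus_generated L1.
have sq := bminus_in_sq (Psi_theta theta).
(* The differential given by omega and delta is identified with the graded commutator as a function,
   so every clause reduces to a statement on [theta, }. *)
have dE : d = scomm (@boson_deg k A Lambda) (@boson_mul k A Lambda) ((1 : A) ⊗ bminus_in theta).
  by apply: funext => x; exact: boson_diff_inner.
split; last by split=> [|x]; [exact: boson_deg_iv|rewrite dE].
split; rewrite ?dE.
- exact: (boson_graded_super_hopf hL).
- exact: (boson_degree0_embedding hL).
- by split; [exact: (lin_inner hL)|exact: (inner_deg hL)|exact: (inner_sq hL)].
- exact: (inner_derivation hL).
exact: (inner_coderivation hL).
Qed.
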